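(* Let $(\mathcal V,1)$ be a complete matrix order unit space, and let $\mathcal D=(D_n)$ be a matrix metric on $\mathcal{CS}(\mathcal V)=(CS_n(\mathcal V))$ such that the $\mathcal D$-topology on $\mathcal{CS}(\mathcal V)$ agrees with the BW-topology. Then $\mathcal D$ comes from a lower semicontinuous matrix Lip-gauge $\mathcal G=(G_n)$ on $(\mathcal V,1)$ via the relation $$D_n(\varphi,\psi)=D_{G_n}(\varphi,\psi)\quad\text{for all }\varphi,\psi\in CS_n(\mathcal V),\ n\in\mathbb N,$$ if and only if $\mathcal D$ is convex, midpoint balanced, and midpoint concave.
   Context: All vector spaces are complex; $M_{m,n}$ denotes the complex $m\times n$ matrices with the operator norm, $M_n=M_{n,n}$, $1_n$ the identity. For a vector space $V$, $M_n(V)$ is the space of $n\times n$ matrices over $V$; $v\oplus w$ is the block-diagonal sum and $\alpha v\beta$ the product with scalar matrices; on a $*$-vector space $[v_{ij}]^*=[v_{ji}^*]$. A $*$-vector space $V$ is matrix ordered if each $M_n(V)$ is partially ordered (cone $M_n(V)^+$) and $\gamma^*M_n(V)^+\gamma\subseteq M_m(V)^+$ for $\gamma\in M_{n,m}$. A matrix order unit space $(\mathcal V,1)$ is a matrix ordered space with a distinguished order unit $1$ such that $\mathcal V^+$ is a proper cone with order unit $1$ and each $M_n(\mathcal V)^+$ is Archimedean (equivalently, an operator system). $M_n(\mathcal V)$ carries the norm $\|v\|_n=\inf\{t:\begin{bmatrix} t1&v\\ v^*&t1\end{bmatrix}\ge0\}$; complete means complete for $\|\cdot\|_1$. $CS_n(\mathcal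 V)$ is the set of completely positive (completely bounded) maps $\varphi:\mathcal V\to M_n$ with $\varphi(1)=1_n$, viewed inside $M_n(\mathcal V^* )$; $(\alpha^*\varphi\alpha)(v)=\alpha^*\varphi(v)\alpha$. For $\varphi=[\varphi_{kl}]:\mathcal V\to M_r$ and $a=[a_{ij}]\in M_n(\mathcal V)$, $\ll\varphi,a\gg=[\varphi_{kl}(a_{ij})]\in M_{rn}$. The BW-topology on $CS_n(\mathcal V)$ is the bounded-weak topology, i.e. point-norm convergence. A matrix metric $\mathcal D=(D_n)$ on $\mathcal{CS}(\mathcal V)$ is a sequence of metrics $D_n:CS_n(\mathcal V)\times CS_n(\mathcal V)\to[0,+\infty)$ such that (1) $D_{m+n}(x\oplus y,u\oplus v)=\max\{D_m(x,u),D_n(y,v)\}$ for $x,u\in CS_m(\mathcal V)$, $y,v\in CS_n(\mathcal V)$; (2) $D_n(\alpha^*x\alpha,\alpha^*u\alpha)\le D_m(x,u)$ for $x,u\in CS_m(\mathcal V)$, $\alpha\in M_{m,n}$ with $\alpha^*\alpha=1_n$. The $\mathcal D$-topology is the topology given on each $CS_n(\mathcal V)$ by $D_n$; agreement of topologies is meant for every $n$. A metric $\rho$ on a convex set $K$ is convex if $\rho(x,ty+(1-t)z)\le t\rho(x,y)+(1-t)\rho(x,z)$ for $x,y,z\in K$, $t\in[0,1]$; midpoint balanced if $\frac{x+v}2=\frac{y+u}2$ implies $\rho(x,u)=\rho(y,v)$; midpoint concave if $\rho(\frac{x+u}2,\frac{y+v}2)\le\frac12(\rho(x,y)+\rho(u,v))$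 for $x,y,u,v\in K$. $\mathcal D$ has one of these properties if every $D_n$ has it. A gauge on a vector space is a function $g$ into $[0,+\infty]$ with $g(v+w)\le g(v)+g(w)$ and $g(\alpha v)\le|\alpha|g(v)$ for $\alpha\in\mathbb C$ (with $0\cdot(+\infty)=0$). A matrix gauge $\mathcal G=(G_n)$ on $\mathcal V$ is a sequence of gauges $G_n:M_n(\mathcal V)\to[0,+\infty]$ with $G_{m+n}(v\oplus w)=\max\{G_m(v),G_n(w)\}$ and $G_n(\alpha v\beta)\le\|\alpha\|G_m(v)\|\beta\|$ for $v\in M_m(\mathcal V)$, $w\in M_n(\mathcal V)$, $\alpha\in M_{n,m}$, $\beta\in M_{m,n}$. A matrix Lipschitz gauge on the complete space $(\mathcal V,1)$ is a matrix gauge such that the null space of each $G_n$ is $M_n(\mathbb C1)$, $G_n(v^* )=G_n(v)$, and $\{v\in\mathcal V:G_1(v)<+\infty\}$ is dense in $\mathcal V$. For it define $$D_{G_n}(\varphi,\psi)=\sup\{\|\ll\varphi,a\gg-\ll\psi,a\gg\|:a\in M_r(\mathcal V),\ G_r(a)\le1,\ r\in\mathbb N\}\in[0,+\infty],\quad\varphi,\psi\in CS_n(\mathcal V).$$ A matrix Lip-gauge is a matrix Lipschitz gauge $\mathcal G$ such that the topology on each $CS_n(\mathcal V)$ given by $D_{G_n}$ is the BW-topology. $\mathcal G$ is lower semicontinuous if each $\{a\in M_n(\mathcal V):G_n(a)\le t\}$, $t>0$, is norm closed. *)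

(* Defs.v *)
From HB Require Import structures.
From mathcomp Require Import all_boot all_order all_algebra.
From mathcomp Require Import all_classical all_reals all_analysis.
From mathcomp Require Import complex.
From mathcomp Require mxtens.

Set Implicit Arguments.
Unset Strict Implicit.
Unset Printing Implicit Defensive.

Import Order.TTheory GRing.Theory Num.Theory.
Import ComplexField.
Local Open Scope classical_set_scope.
Local Open Scope ring_scope.
Local Open Scope sesquilinear_scope.

(* The complex numbers are R[i] over a realType R.  All matrix sizes range over
   nat, including 0: M_0(V) and CS_0(V) are one-point sets on which every
   metric, gauge and norm below is forced to be 0, and direct sums with and
   compressions to size 0 give trivial conditions, so the extra index adds
   nothing to families indexed by n >= 1. *)

Section ScalarMatrices.
Variable R : realType.
Local Notation C := (R[i]).

Definition l2norm n (x : 'cV[C]_n) : R :=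
  Num.sqrt (\sum_(i < n) Normc.normc (x i ord0) ^+ 2).

Definition opnorm m n (A : 'M[C]_(m, n)) : R :=
  sup [set l2norm (A *m x) | x in [set x : 'cV[C]_n | l2norm x <= 1]].

(* [0 <= z] in C means that z is real and nonnegative, so this entails that A
   is Hermitian. *)
Definition psdmx n (A : 'M[C]_n) : Prop :=
  forall x : 'cV[C]_n, 0 <= (x^t* *m A *m x) ord0 ord0.

End ScalarMatrices.

Section MatricesOverV.
Variables (R : realType) (V : lmodType R[i]).
Local Notation C := (R[i]).

Definition mxscalev m n (a : C) (v : 'M[V]_(m, n)) : 'M[V]_(m, n) :=
  map_mx ( *:%R a) v.

Definition mact m n p q (a : 'M[C]_(p, m)) (v : 'M[V]_(m, n))
    (b : 'M[C]_(n, q)) : 'M[V]_(p, q) :=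
  \matrix_(i, j) \sum_(k < m) \sum_(l < n) (a i k * b l j) *: v k l.

Definition mdsum m n (v : 'M[V]_m) (w : 'M[V]_n) : 'M[V]_(m + n) :=
  block_mx v 0 0 w.

Definition madj (star : V -> V) m n (v : 'M[V]_(m, n)) : 'M[V]_(n, m) :=
  map_mx star v^T.

(* A \otimes e, so that [mtensor e 1%:M] is the diagonal matrix 1_n \otimes e *)
Definition mtensor (e : V) n (A : 'M[C]_n) : 'M[V]_n :=
  map_mx (fun a => a *: e) A.

(* the identification of V with M_1(V) *)
Definition M1 (v : V) : 'M[V]_1 := const_mx v.

End MatricesOverV.

Record matrix_ordered_space (R : realType) := MatrixOrderedSpace {
  mo_carrier :> lmodType R[i];
  star : mo_carrier -> mo_carrier;
  mpos : forall n, set 'M[mo_carrier]_n;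
  starK : involutive star;
  starD : forall v w, star (v + w) = star v + star w;
  starZ : forall (a : R[i]) v, star (a *: v) = Num.conj a *: star v;
  mpos_sa : forall n (v : 'M[mo_carrier]_n), mpos v -> madj star v = v;
  mpos0 : forall n, mpos (0 : 'M[mo_carrier]_n);
  mposD : forall n (v w : 'M[mo_carrier]_n), mpos v -> mpos w -> mpos (v + w);
  mposZ : forall n (t : R) (v : 'M[mo_carrier]_n),
    0 <= t -> mpos v -> mpos (mxscalev t%:C%C v);
  mpos_compress : forall n m (g : 'M[R[i]]_(n, m)) (v : 'M[mo_carrier]_n),
    mpos v -> mpos (mact (g^t* ) v g)
}.

Record matrix_order_unit_space (R : realType) := MatrixOrderUnitSpace {
  mou_base :> matrix_ordered_space R;
  munit : mou_base;
  mpos_proper : forall v : mou_base,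
    mpos (M1 v) -> mpos (M1 (- v)) -> v = 0;
  munit_order : forall v : mou_base, star v = v ->
    exists2 t : R, 0 < t & mpos (M1 (t%:C%C *: munit - v)) /\
                           mpos (M1 (t%:C%C *: munit + v));
  (* the hypothesis makes both v and w self-adjoint *)
  mpos_archimedean : forall n (v w : 'M[mou_base]_n),
    (forall t : R, 0 < t -> mpos (w + mxscalev t%:C%C v)) -> mpos v
}.

Section Spaces.
Variables (R : realType) (V : matrix_order_unit_space R).
Local Notation C := (R[i]).

Definition mnorm n (v : 'M[V]_n) : R :=
  inf [set t : R | mpos (block_mx (mtensor (munit V) t%:C%C%:M) v
                           (madj (@star R V) v)
                           (mtensor (munit V) t%:C%C%:M))].

Definition complete_mou : Prop :=
  forall u : nat -> V,
    (forall e : R, 0 < e -> exists N, forall m n, (N <= m)%N -> (N <= n)%N ->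
       mnorm (M1 (u m - u n)) < e) ->
    exists l : V, forall e : R, 0 < e -> exists N, forall n, (N <= n)%N ->
      mnorm (M1 (u n - l)) < e.

Definition mnorm_closed n (S : set 'M[V]_n) : Prop :=
  forall a, (forall e : R, 0 < e -> exists2 b, S b & mnorm (b - a) < e) -> S a.

Definition mnorm_dense (S : set V) : Prop :=
  forall (v : V) (e : R), 0 < e -> exists2 w, S w & mnorm (M1 (w - v)) < e.

(* The matrix << phi, a >>, rows and columns being indexed by pairs (i, k) with
   i an index of a and k an index of phi; it is also the amplification of phi
   applied to a. *)
Definition pairing r n (phi : V -> 'M[C]_r) (a : 'M[V]_n) : 'M[C]_(n * r) :=
  \matrix_(p, q)
    phi (a (mxtens.mxtens_unindex p).1 (mxtens.mxtens_unindex q).1)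
        (mxtens.mxtens_unindex p).2 (mxtens.mxtens_unindex q).2.

Definition completely_positive n (phi : V -> 'M[C]_n) : Prop :=
  forall r (a : 'M[V]_r), mpos a -> psdmx (pairing phi a).

Definition completely_bounded n (phi : V -> 'M[C]_n) : Prop :=
  exists c : R, forall r (a : 'M[V]_r), opnorm (pairing phi a) <= c * mnorm a.

Definition CS n : set (V -> 'M[C]_n) :=
  [set phi | [/\ linear phi, completely_positive phi, completely_bounded phi
               & phi (munit V) = 1%:M]].

Definition state_dsum m n (phi : V -> 'M[C]_m) (psi : V -> 'M[C]_n) :
    V -> 'M[C]_(m + n) :=
  fun v => block_mx (phi v) 0 0 (psi v).

Definition state_compress m n (a : 'M[C]_(m, n)) (phi : V -> 'M[C]_m) :
    V -> 'M[C]_n :=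
  fun v => a^t* *m phi v *m a.

Definition metric_on (T : Type) (K : set T) (d : T -> T -> R) : Prop :=
  [/\ forall x y, K x -> K y -> 0 <= d x y,
      forall x y, K x -> K y -> (d x y = 0 <-> x = y),
      forall x y, K x -> K y -> d x y = d y x &
      forall x y z, K x -> K y -> K z -> d x z <= d x y + d y z].

(* D n is only meaningful on CS n. *)
Definition matrix_metric
    (D : forall n, (V -> 'M[C]_n) -> (V -> 'M[C]_n) -> R) : Prop :=
  [/\ forall n, metric_on (@CS n) (D n),
      forall m n x u y v, @CS m x -> @CS m u -> @CS n y -> @CS n v ->
        D (m + n)%N (state_dsum x y) (state_dsum u v) =
          Num.max (D m x u) (D n y v) &
      forall m n x u (a : 'M[C]_(m, n)), @CS m x -> @CS m u ->
        a^t* *m a = 1%:M ->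
        D n (state_compress a x) (state_compress a u) <= D m x u].

(* extended real values, so that it also applies to D_{G_n} *)
Definition dist_open (T : Type) (K : set T) (d : T -> T -> \bar R)
    (U : set T) : Prop :=
  U `<=` K /\ forall x, U x -> exists2 e : R, 0 < e &
    forall y, K y -> (d x y < e%:E)%E -> U y.

Definition BW_open n (U : set (V -> 'M[C]_n)) : Prop :=
  U `<=` @CS n /\ forall phi, U phi -> exists s : seq V, exists2 e : R, 0 < e &
    forall psi, @CS n psi ->
      (forall v, v \in s -> opnorm (psi v - phi v) < e) -> U psi.

Definition topology_is_BW
    (d : forall n, (V -> 'M[C]_n) -> (V -> 'M[C]_n) -> \bar R) : Prop :=
  forall n (U : set (V -> 'M[C]_n)), dist_open (@CS n) (d n) U <-> BW_open U.

Definition convex_metric (E : lmodType C) (K : set E) (rho : E -> E -> R) :=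
  forall x y z (t : R), K x -> K y -> K z -> 0 <= t <= 1 ->
    rho x (t%:C%C *: y + (1 - t)%:C%C *: z) <=
      t * rho x y + (1 - t) * rho x z.

Definition midpoint_balanced (E : lmodType C) (K : set E)
    (rho : E -> E -> R) :=
  forall x y u v, K x -> K y -> K u -> K v ->
    (2^-1 : C) *: (x + v) = (2^-1 : C) *: (y + u) -> rho x u = rho y v.

Definition midpoint_concave (E : lmodType C) (K : set E)
    (rho : E -> E -> R) :=
  forall x y u v, K x -> K y -> K u -> K v ->
    rho ((2^-1 : C) *: (x + u)) ((2^-1 : C) *: (y + v)) <=
      2^-1 * (rho x y + rho u v).

Definition is_gauge n (g : 'M[V]_n -> \bar R) : Prop :=
  [/\ forall v, (0 <= g v)%E,
      forall v w : 'M[V]_n, (g (v + w)%R <= g v + g w)%E &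
      forall (a : C) v, (g (mxscalev a v) <= (Normc.normc a)%:E * g v)%E].

Definition matrix_gauge (G : forall n, 'M[V]_n -> \bar R) : Prop :=
  [/\ forall n, is_gauge (G n),
      forall m n (v : 'M[V]_m) (w : 'M[V]_n),
        G (m + n)%N (mdsum v w) = maxe (G m v) (G n w) &
      forall m n (v : 'M[V]_m) (a : 'M[C]_(n, m)) (b : 'M[C]_(m, n)),
        (G n (mact a v b) <= (opnorm a)%:E * G m v * (opnorm b)%:E)%E].

Definition matrix_Lipschitz_gauge (G : forall n, 'M[V]_n -> \bar R) : Prop :=
  [/\ matrix_gauge G,
      forall n (v : 'M[V]_n),
        G n v = 0%E <-> exists A : 'M[C]_n, v = mtensor (munit V) A,
      forall n (v : 'M[V]_n), G n (madj (@star R V) v) = G n v &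
      mnorm_dense [set v : V | (G 1%N (M1 v) < +oo)%E]].

Definition DG (G : forall n, 'M[V]_n -> \bar R) n
    (phi psi : V -> 'M[C]_n) : \bar R :=
  ereal_sup [set x | exists r (a : 'M[V]_r), (G r a <= 1)%E /\
                       x = (opnorm (pairing phi a - pairing psi a))%:E].

Definition matrix_Lip_gauge (G : forall n, 'M[V]_n -> \bar R) : Prop :=
  matrix_Lipschitz_gauge G /\ topology_is_BW (DG G).

Definition lsc_gauge (G : forall n, 'M[V]_n -> \bar R) : Prop :=
  forall n (t : R), 0 < t -> mnorm_closed [set a : 'M[V]_n | (G n a <= t%:E)%E].

End Spaces.

(* Main.v *)
Require Import Defs.
From HB Require Import structures.
From mathcomp Require Import all_boot all_order all_algebra.
From mathcomp Require Import all_classical all_reals all_analysis.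
From mathcomp Require Import complex.
From mathcomp Require mxtens.
From mathcomp Require Import ring lra.

Set Implicit Arguments.
Unset Strict Implicit.
Unset Printing Implicit Defensive.

Import Order.TTheory GRing.Theory Num.Theory.
Import numFieldNormedType.Exports.
Local Open Scope classical_set_scope.
Local Open Scope ring_scope.
Local Open Scope sesquilinear_scope.

(** Necessity. The distance that a gauge defines is the supremum of the seminorms
    [f |-> opnorm (pairing f a)] of the difference [f = phi - psi], over the
    matrices [a] of gauge at most 1. Such a supremum is convex, depends on the
    difference only, and is subadditive in it.

    Sufficiency. The gauge of a matrix [a] over V is its Lipschitz constant: the
    least [t] such that [phi |-> << phi, a >>] is [t]-Lipschitz for D on the
    matrix states of every size ([lip_gauge]). All properties of a lower
    semicontinuous matrix gauge are immediate, and so is the inequality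
    [D_G <= D]. What must be shown is that D is attained: given two matrix states
    there is a matrix of gauge at most 1 whose values at them differ in norm by
    almost their distance ([separation]).

    The three conditions on D_n say precisely that D_n is the restriction of a
    norm L_n on the real span of the differences of matrix states ([diffnormE],
    [diffnormD]). The axioms of a matrix metric make these norms compatible: a
    direct sum has the maximum of the norms, and compression by a contraction
    decreases the norm, since a contraction dilates to an isometry
    ([diffs_dsum], [diffs_contract]).

    Separation then follows the matricial Hahn-Banach theorem of Effros and
    Winkler. A functional F norms the given difference [f0] for L_n
    ([norming_functional]). As L_n is compatible with direct sums and
    contractions, the pairs [(al^* al, F (al^* f al))] with [L_k f <= 1] form a
    convex cone, so that a second application of Hahn-Banach gives a positive
    functional [l] on scalar matrices with [F (al^* f al) <= l (al^* al)] for all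
    sizes k at once ([dominating_functional]). Normalising the quadratic form of
    [l] ([gram_normalise]) turns this into an operator norm bound.

    A priori F is a functional on a space of maps on V and could live in a
    bidual. But F is Lipschitz for D, and the D-topology is the topology of
    pointwise convergence, so F yields continuous affine functions on the
    compact convex set of states. Because V is complete, Kadison's theorem
    ([kadison_representation]) represents these by elements of V, hence F by a
    matrix over V ([functional_matrix]).

    Finally, since D separates the states, the case n = 1 of separation shows
    that the elements of finite gauge do so too, and a real space of self-adjoint
    elements that contains the unit and separates the states is norm dense in the
    self-adjoint part ([affine_approx], [lip_gauge_dense]). *)

(** * Hilbert space norms of complex matrices *)

Section Hilbert.
Variable R : realType.
Local Notation C := R[i].
Local Notation Re := complex.Re.
Local Notation Im := complex.Im.

Lemma ctrM m n p (A : 'M[C]_(m, n)) (B : 'M[C]_(n, p)) :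
  (A *m B)^t* = B^t* *m A^t*.
Proof. by rewrite trmx_mul map_mxM. Qed.

Lemma ctrD m n (A B : 'M[C]_(m, n)) : (A + B)^t* = A^t* + B^t*.
Proof. by rewrite linearD map_mxD. Qed.

Lemma ctrN m n (A : 'M[C]_(m, n)) : (- A)^t* = - A^t*.
Proof. by rewrite linearN map_mxN. Qed.

Lemma ctrZ m n (a : C) (A : 'M[C]_(m, n)) : (a *: A)^t* = Num.conj a *: A^t*.
Proof. by rewrite linearZ map_mxZ. Qed.

Lemma ctr1 n : (1%:M : 'M[C]_n)^t* = 1%:M.
Proof. by rewrite trmx1 map_mx1. Qed.

Lemma ctrE m n (A : 'M[C]_(m, n)) i j : A^t* i j = Num.conj (A j i).
Proof. by rewrite !mxE. Qed.

Lemma trace_adj n (A : 'M[C]_n) : \tr (A^t*) = Num.conj (\tr A).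
Proof. by rewrite /mxtrace rmorph_sum; apply: eq_bigr => i _; rewrite ctrE. Qed.

Lemma complexRe_conj (z : C) : Re (Num.conj z) = Re z.
Proof. by case: z. Qed.

Lemma conj_real (t : R) : Num.conj (t%:C%C : C) = t%:C%C.
Proof. exact: conjc_real. Qed.

Lemma Re_realM (t : R) (z : C) : Re (t%:C%C * z) = t * Re z.
Proof. by case: z => a b /=; rewrite mul0r subr0. Qed.

Lemma normc_ge0 (z : C) : 0 <= Normc.normc z.
Proof. by case: z => a b; exact: sqrtr_ge0. Qed.

Lemma normc_real (t : R) : Normc.normc (t%:C%C : C) = `|t|.
Proof. by rewrite /= expr0n addr0 sqrtr_sqr. Qed.

Lemma ctr_delta m n i j : (delta_mx i j : 'M[C]_(m, n))^t* = delta_mx j i.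
Proof.
by apply/matrixP => p q; rewrite ctrE !mxE andbC; case: (_ && _);
  rewrite ?rmorph1 ?rmorph0.
Qed.

(** The real part of the Frobenius inner product. Its norm is Euclidean on
    columns and Hilbert-Schmidt on matrices, so that one calculus serves both
    the definition of the operator norm and the vectors of C^n (x) C^r, which
    are read below as r x n matrices. *)
Definition rip m n (Y X : 'M[C]_(m, n)) : R := Re (\tr (Y^t* *m X)).

Definition sqn m n (X : 'M[C]_(m, n)) : R := rip X X.

Lemma ripC m n (Y X : 'M[C]_(m, n)) : rip Y X = rip X Y.
Proof. by rewrite /rip -[RHS]complexRe_conj -trace_adj ctrM trmxCK. Qed.

Lemma ripDr m n (Y X Z : 'M[C]_(m, n)) : rip Y (X + Z) = rip Y X + rip Y Z.
Proof. by rewrite /rip mulmxDr mxtraceD raddfD. Qed.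

Lemma ripZr m n (t : R) (Y X : 'M[C]_(m, n)) :
  rip Y (t%:C%C *: X) = t * rip Y X.
Proof. by rewrite /rip -scalemxAr mxtraceZ Re_realM. Qed.

Lemma ripDl m n (Y X Z : 'M[C]_(m, n)) : rip (X + Z) Y = rip X Y + rip Z Y.
Proof. by rewrite ripC ripDr !(ripC Y). Qed.

Lemma ripZl m n (t : R) (Y X : 'M[C]_(m, n)) :
  rip (t%:C%C *: Y) X = t * rip Y X.
Proof. by rewrite ripC ripZr ripC. Qed.

Lemma ripMl m n p (A : 'M[C]_(m, n)) (Y : 'M[C]_(m, p)) (X : 'M[C]_(n, p)) :
  rip Y (A *m X) = rip (A^t* *m Y) X.
Proof. by rewrite /rip ctrM trmxCK mulmxA. Qed.

Lemma trace_adj_mul m n (X : 'M[C]_(m, n)) :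
  \tr (X^t* *m X) = (\sum_i \sum_j Normc.normc (X i j) ^+ 2)%:C%C.
Proof.
rewrite /mxtrace exchange_big /= rmorph_sum /=.
apply: eq_bigr => j _; rewrite mxE rmorph_sum /=; apply: eq_bigr => i _.
rewrite ctrE mulrC -[RHS]/((Normc.normc (X i j) ^+ 2)%:C%C).
by rewrite rmorphXn /= -[(Normc.normc _)%:C%C]/(`|X i j|) sqr_normc.
Qed.

Lemma sqnE m n (X : 'M[C]_(m, n)) :
  sqn X = \sum_i \sum_j Normc.normc (X i j) ^+ 2.
Proof. by rewrite /sqn /rip trace_adj_mul. Qed.

Lemma sqn_tr m n (X : 'M[C]_(m, n)) : (sqn X)%:C%C = \tr (X^t* *m X).
Proof. by rewrite sqnE trace_adj_mul. Qed.

Lemma sqn_ge0 m n (X : 'M[C]_(m, n)) : 0 <= sqn X.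
Proof.
by rewrite sqnE; apply: sumr_ge0 => i _; apply: sumr_ge0 => j _; exact: sqr_ge0.
Qed.

Lemma sqn_eq0 m n (X : 'M[C]_(m, n)) : sqn X = 0 -> X = 0.
Proof.
have h i : 0 <= \sum_j Normc.normc (X i j) ^+ 2.
  by apply: sumr_ge0 => j _; exact: sqr_ge0.
rewrite sqnE => /eqP; rewrite psumr_eq0 // => /allP X0.
apply/matrixP => i j; rewrite mxE; move: (X0 i); rewrite mem_index_enum /=.
move/(_ isT); rewrite psumr_eq0; last by move=> k _; exact: sqr_ge0.
move/allP/(_ j); rewrite mem_index_enum sqrf_eq0 => /(_ isT)/eqP.
exact: Normc.eq0_normc.
Qed.

Lemma sqnD m n (X Y : 'M[C]_(m, n)) :
  sqn (X + Y) = sqn X + 2 * rip X Y + sqn Y.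
Proof. by rewrite /sqn ripDr !ripDl (ripC Y X); ring. Qed.

Lemma sqnZ m n (t : R) (X : 'M[C]_(m, n)) : sqn (t%:C%C *: X) = t ^+ 2 * sqn X.
Proof. by rewrite /sqn ripZr ripZl; ring. Qed.

Lemma sqn0 m n : sqn (0 : 'M[C]_(m, n)) = 0.
Proof. by rewrite /sqn /rip mulmx0 mxtrace0. Qed.

Lemma ripNr m n (Y X : 'M[C]_(m, n)) : rip Y (- X) = - rip Y X.
Proof. by rewrite /rip mulmxN !raddfN. Qed.

Lemma ripNl m n (Y X : 'M[C]_(m, n)) : rip (- Y) X = - rip Y X.
Proof. by rewrite ripC ripNr ripC. Qed.

Lemma sqnN m n (X : 'M[C]_(m, n)) : sqn (- X) = sqn X.
Proof. by rewrite /sqn ripNr ripNl opprK. Qed.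

Lemma ge0_eq (a b : R) : a = b -> 0 <= a -> 0 <= b.
Proof. by move->. Qed.

Lemma rip_cauchy m n (X Y : 'M[C]_(m, n)) : rip X Y ^+ 2 <= sqn X * sqn Y.
Proof.
have [/sqn_eq0 ->|Y0] := eqVneq (sqn Y) 0.
  by rewrite sqn0 mulr0 /rip mulmx0 mxtrace0 expr0n.
have Yp : 0 < sqn Y by rewrite lt_def Y0 sqn_ge0.
have := sqn_ge0 (X + (- (rip X Y / sqn Y))%:C%C *: Y).
rewrite sqnD ripZr sqnZ -(pmulr_rge0 _ Yp) => h; rewrite -subr_ge0.
by move: h; apply: ge0_eq; field.
Qed.

Definition hnorm m n (X : 'M[C]_(m, n)) : R := Num.sqrt (sqn X).

Lemma hnorm_ge0 m n (X : 'M[C]_(m, n)) : 0 <= hnorm X.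
Proof. exact: sqrtr_ge0. Qed.

Lemma sqr_hnorm m n (X : 'M[C]_(m, n)) : hnorm X ^+ 2 = sqn X.
Proof. by rewrite sqr_sqrtr // sqn_ge0. Qed.

Lemma ler_rip m n (X Y : 'M[C]_(m, n)) : rip X Y <= hnorm X * hnorm Y.
Proof.
apply: (le_trans (ler_norm _)).
rewrite -(@ler_pXn2r _ 2) ?nnegrE ?normr_ge0 ?mulr_ge0 ?hnorm_ge0 //.
by rewrite exprMn !sqr_hnorm real_normK ?num_real // rip_cauchy.
Qed.

Lemma hnormD m n (X Y : 'M[C]_(m, n)) : hnorm (X + Y) <= hnorm X + hnorm Y.
Proof.
have h := ler_rip X Y.
rewrite -(@ler_pXn2r _ 2) ?nnegrE ?addr_ge0 ?hnorm_ge0 //.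
rewrite sqr_hnorm sqnD sqrrD !sqr_hnorm; lra.
Qed.

Lemma l2normE n (x : 'cV[C]_n) : l2norm x = hnorm x.
Proof.
rewrite /l2norm /hnorm sqnE; congr Num.sqrt.
by apply: eq_bigr => i _; rewrite big_ord1.
Qed.

Lemma hnormZc m n (t : C) (X : 'M[C]_(m, n)) :
  hnorm (t *: X) = Normc.normc t * hnorm X.
Proof.
rewrite /hnorm -(ger0_norm (normc_ge0 t)) -sqrtr_sqr -sqrtrM ?sqr_ge0 //.
congr Num.sqrt; rewrite !sqnE mulr_sumr; apply: eq_bigr => i _.
rewrite mulr_sumr; apply: eq_bigr => j _.
by rewrite mxE Normc.normcM exprMn.
Qed.

Lemma hnormZ m n (t : R) (X : 'M[C]_(m, n)) : 0 <= t ->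
  hnorm (t%:C%C *: X) = t * hnorm X.
Proof. by move=> t0; rewrite hnormZc normc_real ger0_norm. Qed.

Lemma normc_entry_le n (x : 'cV[C]_n) i : Normc.normc (x i ord0) <= hnorm x.
Proof.
rewrite -(@ler_pXn2r _ 2) ?nnegrE ?hnorm_ge0 ?normc_ge0 //.
rewrite sqr_hnorm sqnE (bigD1 i) //= big_ord1 lerDl.
by apply: sumr_ge0 => k _; apply: sumr_ge0 => j _; exact: sqr_ge0.
Qed.

(** A crude bound, enough to make the supremum defining the operator norm
    finite. *)
Lemma mulmx_bounded m n (A : 'M[C]_(m, n)) :
  exists2 c : R, 0 <= c & forall x : 'cV[C]_n, hnorm (A *m x) <= c * hnorm x.
Proof.
have hsum (I : Type) (s : seq I) (F : I -> 'cV[C]_m) :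
    hnorm (\sum_(i <- s) F i) <= \sum_(i <- s) hnorm (F i).
  elim: s => [|i s IH]; first by rewrite !big_nil /hnorm sqn0 sqrtr0.
  by rewrite !big_cons (le_trans (hnormD _ _)) // lerD2l.
exists (\sum_j hnorm (col j A)) => [|x].
  by apply: sumr_ge0 => j _; exact: hnorm_ge0.
have -> : A *m x = \sum_j x j ord0 *: col j A.
  apply/matrixP => i k; rewrite summxE mxE; apply: eq_bigr => j _.
  by rewrite !mxE mulrC (ord1 k).
apply: (le_trans (hsum _ _ _)); rewrite mulr_suml; apply: ler_sum => j _.
by rewrite hnormZc mulrC ler_wpM2l ?hnorm_ge0 // normc_entry_le.
Qed.

Lemma opnorm_has_sup m n (A : 'M[C]_(m, n)) :
  has_sup [set l2norm (A *m x) | x in [set x : 'cV[C]_n | l2norm x <= 1]].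
Proof.
split; first by exists (l2norm (A *m 0)), 0 => //=; rewrite l2normE /hnorm sqn0 sqrtr0.
have [c c0 Ac] := mulmx_bounded A; exists c => _ [x /= x1 <-].
rewrite l2normE (le_trans (Ac x)) // -[leRHS]mulr1 ler_wpM2l //.
by rewrite -l2normE.
Qed.

Lemma opnorm_ge0 m n (A : 'M[C]_(m, n)) : 0 <= opnorm A.
Proof.
apply: sup_upper_bound (opnorm_has_sup A) _ _; exists 0 => /=.
  by rewrite l2normE /hnorm sqn0 sqrtr0.
by rewrite mulmx0 l2normE /hnorm sqn0 sqrtr0.
Qed.

Lemma opnormP m n (A : 'M[C]_(m, n)) (x : 'cV[C]_n) :
  hnorm (A *m x) <= opnorm A * hnorm x.
Proof.
have [x0|x0] := eqVneq (hnorm x) 0.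
  have /sqn_eq0-> : sqn x = 0 by rewrite -sqr_hnorm x0 expr0n.
  by rewrite mulmx0 /hnorm !sqn0 sqrtr0 mulr0.
have xp : 0 < hnorm x by rewrite lt_def x0 hnorm_ge0.
rewrite -ler_pdivrMr // mulrC -hnormZ ?invr_ge0 ?hnorm_ge0 // scalemxAr.
apply: sup_upper_bound (opnorm_has_sup A) _ _; rewrite -l2normE.
exists ((hnorm x)^-1%:C%C *: x) => //=.
by rewrite l2normE hnormZ ?invr_ge0 ?hnorm_ge0 // mulVf.
Qed.

Lemma opnorm_le m n (A : 'M[C]_(m, n)) (c : R) : 0 <= c ->
  (forall x : 'cV[C]_n, hnorm (A *m x) <= c * hnorm x) -> opnorm A <= c.
Proof.
move=> c0 Ac; apply: ge_sup; first by have [] := opnorm_has_sup A.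
move=> _ [x /= x1 <-]; rewrite l2normE (le_trans (Ac x)) //.
by rewrite -[leRHS]mulr1 ler_wpM2l // -l2normE.
Qed.

Lemma opnormD m n (A B : 'M[C]_(m, n)) : opnorm (A + B) <= opnorm A + opnorm B.
Proof.
apply: opnorm_le => [|x]; first by rewrite addr_ge0 ?opnorm_ge0.
by rewrite mulmxDl mulrDl (le_trans (hnormD _ _)) // lerD // opnormP.
Qed.

Lemma opnormZ m n (t : C) (A : 'M[C]_(m, n)) :
  opnorm (t *: A) <= Normc.normc t * opnorm A.
Proof.
apply: opnorm_le => [|x]; first by rewrite mulr_ge0 ?opnorm_ge0 ?normc_ge0.
by rewrite -scalemxAl hnormZc -mulrA ler_wpM2l ?normc_ge0 ?opnormP.
Qed.

Lemma opnormZr m n (t : R) (A : 'M[C]_(m, n)) : 0 <= t ->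
  opnorm (t%:C%C *: A) <= t * opnorm A.
Proof. by move=> t0; have := opnormZ t%:C%C A; rewrite normc_real ger0_norm. Qed.

Lemma opnormN m n (A : 'M[C]_(m, n)) : opnorm (- A) = opnorm A.
Proof.
have le (B : 'M[C]_(m, n)) : opnorm (- B) <= opnorm B.
  have := opnormZ (-1) B; rewrite scaleN1r normcN Normc.normc1 mul1r; exact.
by apply/le_anti; rewrite le /= -{1}(opprK A) le.
Qed.

Lemma hnorm0 m n : hnorm (0 : 'M[C]_(m, n)) = 0.
Proof. by rewrite /hnorm sqn0 sqrtr0. Qed.

Lemma hnorm_eq0 m n (X : 'M[C]_(m, n)) : hnorm X = 0 -> X = 0.
Proof. by move=> X0; apply: sqn_eq0; rewrite -sqr_hnorm X0 expr0n. Qed.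

Lemma opnorm0 m n : opnorm (0 : 'M[C]_(m, n)) = 0.
Proof.
apply/le_anti; rewrite opnorm_ge0 andbT; apply: opnorm_le => // x.
by rewrite mul0mx hnorm0 mul0r.
Qed.

Lemma opnorm_eq0 m n (A : 'M[C]_(m, n)) : opnorm A = 0 -> A = 0.
Proof.
move=> A0; apply/matrixP => i j.
have /hnorm_eq0 : hnorm (A *m delta_mx j 0 : 'cV_m) = 0.
  apply/le_anti; rewrite hnorm_ge0 andbT -[leRHS](mul0r (hnorm (delta_mx j 0 : 'cV[C]_n))).
  by rewrite -A0 opnormP.
by rewrite -colE => /matrixP/(_ i 0); rewrite !mxE.
Qed.

Lemma sqn_opnorm m n (A : 'M[C]_(m, n)) (x : 'cV[C]_n) :
  sqn (A *m x) <= opnorm A ^+ 2 * sqn x.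
Proof.
rewrite -!sqr_hnorm -exprMn ler_pXn2r ?nnegrE ?hnorm_ge0 //.
  exact: opnormP.
by rewrite mulr_ge0 ?opnorm_ge0 ?hnorm_ge0.
Qed.

Lemma opnorm_le_sqn m n (A : 'M[C]_(m, n)) (c : R) : 0 <= c ->
  (forall x : 'cV[C]_n, sqn (A *m x) <= c ^+ 2 * sqn x) -> opnorm A <= c.
Proof.
move=> c0 Ac; apply: opnorm_le => // x.
rewrite -(@ler_pXn2r _ 2) ?nnegrE ?mulr_ge0 ?hnorm_ge0 //.
by rewrite exprMn !sqr_hnorm.
Qed.

Lemma opnorm_adj_le m n (A : 'M[C]_(m, n)) : opnorm (A^t*) <= opnorm A.
Proof.
apply: opnorm_le => [|x]; first exact: opnorm_ge0.
have [->|y0] := eqVneq (hnorm (A^t* *m x)) 0.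
  by rewrite mulr_ge0 ?opnorm_ge0 ?hnorm_ge0.
have yp : 0 < hnorm (A^t* *m x) by rewrite lt_def y0 hnorm_ge0.
rewrite -(ler_pM2r yp) -expr2 sqr_hnorm /sqn ripMl trmxCK ripC.
apply: (le_trans (ler_rip _ _)); rewrite [opnorm A * _]mulrC -mulrA.
by rewrite ler_wpM2l ?hnorm_ge0 ?opnormP.
Qed.

Lemma opnorm_adj m n (A : 'M[C]_(m, n)) : opnorm (A^t*) = opnorm A.
Proof.
apply/le_anti; rewrite opnorm_adj_le /=.
by have := opnorm_adj_le (A^t*); rewrite trmxCK.
Qed.

(** Positivity of the block matrix [c A; A^* c] bounds A by c: minimising the
    form over [x] for fixed [y] leaves [c |y|^2 - c^-1 |A y|^2]. *)
Lemma opnorm_form m n (A : 'M[C]_(m, n)) (c : R) : 0 <= c ->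
  (forall (x : 'cV[C]_m) (y : 'cV[C]_n),
     0 <= c * sqn x + 2 * rip x (A *m y) + c * sqn y) ->
  opnorm A <= c.
Proof.
move=> c0 Ac; apply: opnorm_le_sqn => // y; set z := A *m y.
have hz (s : R) : 0 <= c * s ^+ 2 * sqn z - 2 * s * sqn z + c * sqn y.
  have := Ac ((- s)%:C%C *: z) y; rewrite sqnZ ripZl -/z -/(sqn z) sqrrN.
  by apply: ge0_eq; ring.
have [c00|cn0] := eqVneq c 0.
  move: hz; rewrite c00 expr0n /= mul0r => /(_ 1); rewrite !mul0r addr0 add0r mulr1.
  have := sqn_ge0 z; lra.
have cp : 0 < c by rewrite lt_def cn0 c0.
(* the minimum over x = - s z is attained at s = c^-1 *)
have := hz c^-1; rewrite -(pmulr_rge0 _ cp).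
have -> : c * (c * c^-1 ^+ 2 * sqn z - 2 / c * sqn z + c * sqn y) =
   c ^+ 2 * sqn y - sqn z by field.
by rewrite subr_ge0.
Qed.

(** A Hermitian matrix is normed by its quadratic form: by the parallelogram
    law, [c +- A] positive makes the block matrix of [opnorm_form] positive. *)
Lemma opnorm_herm n (A : 'M[C]_n) (c : R) : 0 <= c -> A^t* = A ->
  (forall x : 'cV[C]_n, `|rip x (A *m x)| <= c * sqn x) -> opnorm A <= c.
Proof.
move=> c0 Ah Ac; apply: opnorm_form => // x y.
have := Ac (x + y); have := Ac (x - y).
rewrite !ler_norml !mulmxDr !mulmxN => /andP[_ h1] /andP[h2 _]; move: h1 h2.
rewrite !ripDr !ripDl !sqnD sqnN !(ripNr, ripNl) opprK.
rewrite (ripMl A y x) Ah (ripC (A *m y)); lra.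
Qed.

Lemma quad_compress m n p (A : 'M[C]_m) (B : 'M[C]_(m, n)) (Y : 'M[C]_(n, p)) :
  (B *m Y)^t* *m A *m (B *m Y) = Y^t* *m (B^t* *m A *m B) *m Y.
Proof. by rewrite ctrM !mulmxA. Qed.

(** Polarisation with [x + y] and [x + i y] recovers the sesquilinear form; this
    is where complex scalars are indispensable: on real vectors the quadratic
    form of a skew-symmetric matrix vanishes. *)
Lemma quad_eq0 n (A : 'M[C]_n) :
  (forall x : 'cV[C]_n, x^t* *m A *m x = 0) -> A = 0.
Proof.
move=> A0.
have pol (x y : 'cV[C]_n) : x^t* *m A *m y = 0.
  have h1 : x^t* *m A *m y + y^t* *m A *m x = 0.
    have := A0 (x + y); rewrite ctrD !mulmxDl !mulmxDr !A0 add0r addr0.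
    by rewrite addrC.
  have := A0 (x + 'i%C *: y).
  rewrite ctrD ctrZ !mulmxDl !mulmxDr -!scalemxAl -!scalemxAr !A0.
  rewrite !scaler0 add0r addr0 -[Num.conj 'i%C]/(0 -i* 1)%C.
  move: h1 => /eqP; rewrite addrC addr_eq0 => /eqP ->.
  rewrite scalerN -scalerBl => /eqP; rewrite scaler_eq0 => /orP[|/eqP //].
  by rewrite eq_complex /= opprK -mulr2n pnatr_eq0 andbF.
apply/matrixP => i j; have /matrixP/(_ 0 0) := pol (delta_mx i 0) (delta_mx j 0).
rewrite -mulmxA -colE mxE (bigD1 i) //= big1 ?addr0.
  by rewrite !mxE !eqxx rmorph1 mul1r.
by move=> k ki; rewrite !mxE (negPf ki) /= rmorph0 mul0r.
Qed.

(** The quadratic form of [A^t* - A] is the conjugate of that of [A] minus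
    itself, so [quad_eq0] applies. *)
Lemma herm_of_real_quad n (A : 'M[C]_n) :
  (forall x : 'cV[C]_n, Im ((x^t* *m A *m x) ord0 ord0) = 0) -> A^t* = A.
Proof.
move=> Ap; apply/eqP; rewrite -subr_eq0; apply/eqP; apply: quad_eq0 => x.
rewrite mulmxBr mulmxBl.
have -> : x^t* *m A^t* *m x = (x^t* *m A *m x)^t*.
  by rewrite !ctrM trmxCK mulmxA.
move: (Ap x); move: (x^t* *m A *m x) => z z0.
apply/eqP; rewrite subr_eq0; apply/eqP/matrixP => i j; rewrite !ord1 ctrE.
move: z0; case: (z ord0 ord0) => a b /= ->.
by apply/eqP; rewrite eq_complex /= oppr0 !eqxx.
Qed.

Lemma psd_herm n (A : 'M[C]_n) : psdmx A -> A^t* = A.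
Proof.
move=> Ap; apply: herm_of_real_quad => x.
by move: (Ap x); rewrite lecE /= => /andP[/eqP].
Qed.

Lemma psd_rip n (A : 'M[C]_n) : A^t* = A ->
  (forall x : 'cV[C]_n, 0 <= rip x (A *m x)) -> psdmx A.
Proof.
move=> Ah Ap x; have := Ap x; rewrite /rip mulmxA trace_mx11 lecE => ->.
rewrite andbT.
have : (x^t* *m A *m x)^t* = x^t* *m A *m x by rewrite !ctrM trmxCK mulmxA Ah.
move=> /matrixP/(_ ord0 ord0); rewrite ctrE; case: (_ ord0 ord0) => a b [] /= /eqP.
by rewrite eqNr.
Qed.

(** Diagonalise unitarily and take square roots of the eigenvalues. *)
Lemma psd_factor n (A : 'M[C]_n) : psdmx A -> exists B : 'M[C]_n, A = B^t* *m B.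
Proof.
move=> Ap; have Ah := psd_herm Ap.
have /orthomx_spectralP/= AE : A \is normalmx by apply/normalmxP; rewrite Ah.
set P := spectralmx A in AE; set d := spectral_diag A in AE.
have Pu : P \is unitarymx by exact: spectral_unitarymx.
rewrite invmx_unitary // in AE.
have PP : P *m P^t* = 1%:M by apply/unitarymxP.
have dE : diag_mx d = P *m A *m P^t*.
  by rewrite [in RHS]AE !mulmxA PP mul1mx -mulmxA PP mulmx1.
have d0 i : 0 <= d 0 i.
  have := Ap (P^t* *m delta_mx i 0).
  rewrite (quad_compress A) trmxCK -dE.
  by rewrite ctr_delta -rowE -colE !mxE eqxx mulr1n.
pose s := map_mx sqrtC d.
have ss : (diag_mx s)^t* *m diag_mx s = diag_mx d.
  rewrite mul_mx_diag; apply/matrixP => i j; rewrite mxE ctrE [in RHS]mxE [diag_mx _ _ _]mxE.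
  have [->|ij] := eqVneq j i; last first.
    by rewrite !mulr0n rmorph0 mul0r.
  rewrite ?eqxx !mulr1n mxE.
  have -> : Num.conj (sqrtC (d 0 i)) = sqrtC (d 0 i).
    by apply: geC0_conj; rewrite sqrtC_ge0.
  by rewrite -expr2 sqrtCK.
exists (diag_mx s *m P); rewrite ctrM mulmxA -(mulmxA (P^t*)) ss.
by rewrite [LHS]AE.
Qed.
End Hilbert.

(** * The pairing of maps with matrices over V *)

Section Linear.
Variables (K : pzRingType) (U W : lmodType K) (f : U -> W).
Hypothesis f_lin : linear f.

Lemma linD x y : f (x + y) = f x + f y.
Proof. by have := f_lin 1 x y; rewrite !scale1r. Qed.

Lemma lin0 : f 0 = 0.
Proof. by have /eqP := linD 0 0; rewrite addr0 eq_sym -subr_eq0 addrK => /eqP. Qed.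

Lemma linZ a x : f (a *: x) = a *: f x.
Proof. by have := f_lin a x 0; rewrite lin0 !addr0. Qed.

Lemma linN x : f (- x) = - f x.
Proof. by rewrite -scaleN1r linZ scaleN1r. Qed.

Lemma linB x y : f (x - y) = f x - f y.
Proof. by rewrite linD linN. Qed.

Lemma lin_sum (I : Type) (s : seq I) (P : pred I) (F : I -> U) :
  f (\sum_(i <- s | P i) F i) = \sum_(i <- s | P i) f (F i).
Proof. exact: (big_morph f linD lin0). Qed.

End Linear.

Section Pairing.
Variables (R : realType) (V : matrix_order_unit_space R).
Local Notation C := R[i].
Local Notation Re := complex.Re.
Local Notation Im := complex.Im.

Definition tomx r n (x : 'cV[C]_(n * r)) : 'M[C]_(r, n) :=
  \matrix_(k, i) x (mxtens.mxtens_index (i, k)) ord0.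

Definition ofmx r n (X : 'M[C]_(r, n)) : 'cV[C]_(n * r) :=
  \col_p X (mxtens.mxtens_unindex p).2 (mxtens.mxtens_unindex p).1.

Lemma ofmxK r n : cancel (@ofmx r n) (@tomx r n).
Proof. by move=> X; apply/matrixP => k i; rewrite !mxE mxtens.mxtens_indexK. Qed.

Lemma sum_mxtens (T : nmodType) n r (F : 'I_(n * r) -> T) :
  \sum_p F p = \sum_i \sum_k F (mxtens.mxtens_index (i, k)).
Proof.
rewrite pair_big /= (reindex (@mxtens.mxtens_index n r)) /=.
  by apply: eq_bigr => -[i k].
by exists (@mxtens.mxtens_unindex n r) => p _;
  rewrite (mxtens.mxtens_indexK, mxtens.mxtens_unindexK).
Qed.

Lemma sqn_tomx r n (x : 'cV[C]_(n * r)) : sqn (tomx x) = sqn x.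
Proof.
rewrite !sqnE sum_mxtens exchange_big /=; apply: eq_bigr => i _.
by apply: eq_bigr => k _; rewrite big_ord1 !mxE.
Qed.

(** The action of the matrix [<< f, a >>] on C^n (x) C^r, whose vectors are
    read as r x n matrices: this avoids double indices. *)
Definition papp r n (f : V -> 'M[C]_r) (a : 'M[V]_n) (X : 'M[C]_(r, n)) :
    'M[C]_(r, n) :=
  \matrix_(k, i) \sum_j (f (a i j) *m X) k j.

Lemma tomx_pairing r n (f : V -> 'M[C]_r) (a : 'M[V]_n) (x : 'cV[C]_(n * r)) :
  tomx (pairing f a *m x) = papp f a (tomx x).
Proof.
apply/matrixP => k i; rewrite !mxE sum_mxtens; apply: eq_bigr => j _.
by rewrite !mxE; apply: eq_bigr => l _; rewrite !mxE !mxtens.mxtens_indexK.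
Qed.

Lemma hnorm_tomx r n (x : 'cV[C]_(n * r)) : hnorm (tomx x) = hnorm x.
Proof. by rewrite /hnorm sqn_tomx. Qed.

Lemma opnorm_pairing_le r n (f : V -> 'M[C]_r) (a : 'M[V]_n) (c : R) : 0 <= c ->
  (forall X, hnorm (papp f a X) <= c * hnorm X) -> opnorm (pairing f a) <= c.
Proof.
move=> c0 fa; apply: opnorm_le => // x.
by rewrite -hnorm_tomx -(hnorm_tomx x) tomx_pairing.
Qed.

Lemma hnorm_papp r n (f : V -> 'M[C]_r) (a : 'M[V]_n) (X : 'M[C]_(r, n)) :
  hnorm (papp f a X) <= opnorm (pairing f a) * hnorm X.
Proof.
by rewrite -{1}(ofmxK X) -{2}(ofmxK X) -tomx_pairing !hnorm_tomx opnormP.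
Qed.

Lemma rip_tomx r n (y x : 'cV[C]_(n * r)) : rip (tomx y) (tomx x) = rip y x.
Proof.
have := sqn_tomx (y + x); rewrite !sqnD.
have -> : tomx (y + x) = tomx y + tomx x by apply/matrixP => i k; rewrite !mxE.
by rewrite sqnD !sqn_tomx; lra.
Qed.

Lemma rip_pairing r n (f : V -> 'M[C]_r) (a : 'M[V]_n) (y x : 'cV[C]_(n * r)) :
  rip y (pairing f a *m x) = rip (tomx y) (papp f a (tomx x)).
Proof. by rewrite -rip_tomx tomx_pairing. Qed.

Lemma papp_mact r n m (f : V -> 'M[C]_r) (v : 'M[V]_m)
    (al : 'M[C]_(n, m)) (be : 'M[C]_(m, n)) X : linear f ->
  papp f (mact al v be) X = papp f v (X *m be^T) *m al^T.
Proof.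
move=> fl; apply/matrixP => k i; rewrite !mxE.
under eq_bigr => j _.
  rewrite [mact _ _ _ _ _]mxE (lin_sum fl) mulmx_suml summxE.
  under eq_bigr => p _.
    rewrite (lin_sum fl) mulmx_suml summxE.
    under eq_bigr => q _ do rewrite (linZ fl) -scalemxAl mxE -mulrA.
    rewrite -mulr_sumr; over.
  over.
rewrite exchange_big /=; apply: eq_bigr => p _; rewrite -mulr_sumr !mxE mulrC.
congr (_ * _); rewrite exchange_big /=; apply: eq_bigr => q _.
rewrite mulmxA mxE; apply: eq_bigr => j _.
by rewrite !mxE mulrC.
Qed.

Lemma papp_compress m r n (al : 'M[C]_(m, r)) (f : V -> 'M[C]_m) (a : 'M[V]_n) X :
  papp (state_compress al f) a X = al^t* *m papp f a (al *m X).
Proof.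
apply/matrixP => k i; rewrite [LHS]mxE [RHS]mxE.
under [RHS]eq_bigr => p _ do rewrite [papp _ _ _ _ _]mxE mulr_sumr.
rewrite exchange_big /=; apply: eq_bigr => j _.
by rewrite /state_compress -!mulmxA mxE; apply: eq_bigr.
Qed.

Lemma papp_dsum m r n (f : V -> 'M[C]_m) (g : V -> 'M[C]_r) (a : 'M[V]_n) X Y :
  papp (state_dsum f g) a (col_mx X Y) = col_mx (papp f a X) (papp g a Y).
Proof.
apply/matrixP => k i; rewrite !mxE.
under eq_bigr => j _ do
  rewrite /state_dsum mul_block_col !mul0mx addr0 add0r mxE.
by case: (fintype.split k) => k'; rewrite mxE.
Qed.

Lemma mx0E (T : nmodType) p q (i : 'I_p) (j : 'I_q) : (0 : 'M[T]_(p, q)) i j = 0.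
Proof. by rewrite mxE. Qed.

Lemma papp_mdsum r m n (f : V -> 'M[C]_r) (v : 'M[V]_m) (w : 'M[V]_n) X Y :
  linear f ->
  papp f (mdsum v w) (row_mx X Y) = row_mx (papp f v X) (papp f w Y).
Proof.
move=> fl; apply/matrixP => k i; rewrite !mxE big_split_ord /=.
under eq_bigr => j _ do rewrite mul_mx_row row_mxEl.
under [X in _ + X]eq_bigr => j _ do rewrite mul_mx_row row_mxEr.
rewrite /mdsum; case: fintype.splitP => i' ii'.
  have -> : i = lshift n i' by apply: val_inj.
  rewrite [RHS]mxE [X in _ + X]big1 ?addr0.
    by apply: eq_bigr => j _; rewrite block_mxEul.
  by move=> j _; rewrite block_mxEur mx0E (lin0 fl) mul0mx mx0E.
have -> : i = rshift m i' by apply: val_inj.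
rewrite [RHS]mxE [X in X + _]big1 ?add0r.
  by apply: eq_bigr => j _; rewrite block_mxEdr.
by move=> j _; rewrite block_mxEdl mx0E (lin0 fl) mul0mx mx0E.
Qed.

Lemma sqn_row m n1 n2 (X : 'M[C]_(m, n1)) (Y : 'M[C]_(m, n2)) :
  sqn (row_mx X Y) = sqn X + sqn Y.
Proof.
rewrite !sqnE -big_split; apply: eq_bigr => i _; rewrite big_split_ord /=.
by congr (_ + _); apply: eq_bigr => j _; rewrite ?row_mxEl ?row_mxEr.
Qed.

(** The rows of [X *m al^T] are the images under [al] of the rows of [X]. *)
Lemma hnorm_mul_tr r m n (X : 'M[C]_(r, m)) (al : 'M[C]_(n, m)) :
  hnorm (X *m al^T) <= opnorm al * hnorm X.
Proof.
rewrite -(@ler_pXn2r _ 2) ?nnegrE ?mulr_ge0 ?hnorm_ge0 ?opnorm_ge0 //.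
rewrite exprMn !sqr_hnorm.
have rows p (Y : 'M[C]_(r, p)) : sqn Y = \sum_k sqn (row k Y)^T.
  rewrite sqnE; apply: eq_bigr => k _; rewrite sqnE; apply: eq_bigr => i _.
  by rewrite big_ord1 !mxE.
rewrite !rows mulr_sumr; apply: ler_sum => k _.
by rewrite row_mul trmx_mul trmxK sqn_opnorm.
Qed.

Lemma opnorm_pairing_mact r n m (f : V -> 'M[C]_r) (v : 'M[V]_m)
    (al : 'M[C]_(n, m)) (be : 'M[C]_(m, n)) : linear f ->
  opnorm (pairing f (mact al v be)) <=
    opnorm al * opnorm (pairing f v) * opnorm be.
Proof.
move=> fl; apply: opnorm_pairing_le => [|X].
  by rewrite !mulr_ge0 ?opnorm_ge0.
rewrite papp_mact // (le_trans (hnorm_mul_tr _ _)) // -!mulrA.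
rewrite ler_wpM2l ?opnorm_ge0 // (le_trans (hnorm_papp _ _ _)) //.
by rewrite ler_wpM2l ?opnorm_ge0 // hnorm_mul_tr.
Qed.

Lemma opnorm_pairing_mdsum r m n (f : V -> 'M[C]_r) (v : 'M[V]_m) (w : 'M[V]_n)
    (c : R) : linear f -> 0 <= c -> opnorm (pairing f v) <= c ->
  opnorm (pairing f w) <= c -> opnorm (pairing f (mdsum v w)) <= c.
Proof.
move=> fl c0 vc wc; apply: opnorm_pairing_le => // X.
rewrite -(@ler_pXn2r _ 2) ?nnegrE ?mulr_ge0 ?hnorm_ge0 //.
rewrite exprMn !sqr_hnorm -(hsubmxK X) papp_mdsum // !sqn_row mulrDr.
have h p (a : 'M[V]_p) Y : opnorm (pairing f a) <= c ->
    sqn (papp f a Y) <= c ^+ 2 * sqn Y.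
  move=> ac; rewrite -!sqr_hnorm -exprMn ler_pXn2r ?nnegrE ?hnorm_ge0 //.
    by rewrite (le_trans (hnorm_papp _ _ _)) // ler_wpM2r ?hnorm_ge0.
  by rewrite mulr_ge0 ?hnorm_ge0.
by rewrite lerD // h.
Qed.

Lemma pairing_fB r n (f g : V -> 'M[C]_r) (a : 'M[V]_n) :
  pairing f a - pairing g a = pairing (f - g) a.
Proof. by apply/matrixP => i j; rewrite !mxE. Qed.

Lemma pairing_fD r n (f g : V -> 'M[C]_r) (a : 'M[V]_n) :
  pairing (f + g) a = pairing f a + pairing g a.
Proof. by apply/matrixP => i j; rewrite !mxE. Qed.

Lemma pairing_fZ r n (t : C) (f : V -> 'M[C]_r) (a : 'M[V]_n) :
  pairing (t *: f) a = t *: pairing f a.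
Proof. by apply/matrixP => i j; rewrite !mxE. Qed.

Lemma pairingD r n (f : V -> 'M[C]_r) (a b : 'M[V]_n) : linear f ->
  pairing f (a + b) = pairing f a + pairing f b.
Proof. by move=> fl; apply/matrixP => i j; rewrite !mxE (linD fl) mxE. Qed.

Lemma pairingZ r n (f : V -> 'M[C]_r) (t : C) (a : 'M[V]_n) : linear f ->
  pairing f (mxscalev t a) = t *: pairing f a.
Proof. by move=> fl; apply/matrixP => i j; rewrite !mxE (linZ fl) mxE. Qed.

Lemma pairing0 r n (f : V -> 'M[C]_r) : linear f -> pairing f (0 : 'M[V]_n) = 0.
Proof. by move=> fl; apply/matrixP => i j; rewrite !mxE (lin0 fl) mxE. Qed.

Lemma linear_fB r (f g : V -> 'M[C]_r) : linear f -> linear g -> linear (f - g).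
Proof.
move=> fl gl a u v; rewrite !fctE (linD fl) (linD gl) (linZ fl) (linZ gl).
by rewrite scalerBr addrACA -opprD.
Qed.

Lemma quad_pairing r n (f : V -> 'M[C]_r) (a : 'M[V]_n) (x : 'cV[C]_(n * r)) :
  (x^t* *m pairing f a *m x) ord0 ord0 =
  \tr ((tomx x)^t* *m papp f a (tomx x)).
Proof.
rewrite -tomx_pairing -mulmxA mxE sum_mxtens /mxtrace; apply: eq_bigr => i _.
rewrite [RHS]mxE; apply: eq_bigr => k _; rewrite !ctrE.
by congr (Num.conj _ * _); rewrite [RHS]mxE.
Qed.

Lemma psd_pairingP r n (f : V -> 'M[C]_r) (a : 'M[V]_n) :
  (forall X, 0 <= \tr (X^t* *m papp f a X)) <-> psdmx (pairing f a).
Proof.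
split=> h; first by move=> x; rewrite quad_pairing; exact: h.
by move=> X; have := h (ofmx X); rewrite quad_pairing ofmxK.
Qed.

End Pairing.

(** * Matrix order unit norms *)

Section OrderUnit.
Variables (R : realType) (V : matrix_order_unit_space R).
Local Notation C := R[i].
Local Notation Re := complex.Re.
Local Notation Im := complex.Im.
Local Notation st := (@star R V).
Local Notation one := (munit V).

Lemma star0 : st 0 = 0.
Proof. by have /eqP := starD (0 : V) 0; rewrite addr0 eq_sym -subr_eq0 addrK => /eqP. Qed.

Lemma starN v : st (- v) = - st v.
Proof. by apply/eqP; rewrite -subr_eq0 opprK -starD addNr star0. Qed.

Lemma starB v w : st (v - w) = st v - st w.
Proof. by rewrite starD starN. Qed.

Lemma starZr (t : R) v : st (t%:C%C *: v) = t%:C%C *: st v.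
Proof. by rewrite starZ conj_real. Qed.

Lemma mxscalev_M1 (t : C) (v : V) : mxscalev t (M1 v) = M1 (t *: v).
Proof. by apply/matrixP => i j; rewrite !mxE. Qed.

Lemma M1D (v w : V) : M1 (v + w) = M1 v + M1 w.
Proof. by apply/matrixP => i j; rewrite !mxE. Qed.

Lemma mpos_M1D (v w : V) : mpos (M1 v) -> mpos (M1 w) -> mpos (M1 (v + w)).
Proof. by rewrite M1D; exact: mposD. Qed.

Lemma mpos_M1Z (t : R) (v : V) : 0 <= t -> mpos (M1 v) -> mpos (M1 (t%:C%C *: v)).
Proof. by rewrite -mxscalev_M1; exact: mposZ. Qed.

Lemma mpos_unit : mpos (M1 one).
Proof.
have [t t0 []] := munit_order star0; rewrite subr0 => + _.
move/(mpos_M1Z (ltW (etrans (invr_gt0 _) t0))); rewrite scalerA -rmorphM mulVf ?gt_eqF //.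
by rewrite scale1r.
Qed.

Lemma mpos_M1_sa (v : V) : mpos (M1 v) -> st v = v.
Proof. by move=> /mpos_sa/matrixP/(_ ord0 ord0); rewrite !mxE. Qed.

Lemma star_unit : st one = one.
Proof. exact: mpos_M1_sa mpos_unit. Qed.

Definition reV (v : V) : V := (2^-1 : R)%:C%C *: (v + st v).
Definition imV (v : V) : V := (2^-1 : R)%:C%C *: ('i%C *: (st v - v)).

Lemma conj_i : Num.conj ('i%C : C) = - 'i%C.
Proof. by apply/eqP; rewrite -[Num.conj _]/(0 -i* 1)%C eq_complex /= oppr0 !eqxx. Qed.

Lemma reV_sa v : st (reV v) = reV v.
Proof. by rewrite starZr starD starK addrC. Qed.

Lemma imV_sa v : st (imV v) = imV v.
Proof. by rewrite starZr starZ starB starK conj_i scaleNr -scalerN opprB. Qed.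

Lemma half_half : (2^-1 : R)%:C%C + (2^-1 : R)%:C%C = 1 :> C.
Proof. by rewrite -rmorphD (_ : 2^-1 + 2^-1 = 1 :> R) ?rmorph1 //; lra. Qed.

Lemma reimV v : v = reV v + 'i%C *: imV v.
Proof.
rewrite /reV /imV [in X in _ + X]scalerA [_ * _%:C%C]mulrC -scalerA.
rewrite (scalerA 'i%C 'i%C) -expr2 sqr_i scaleN1r opprB -scalerDr addrACA subrr addr0.
by rewrite scalerDr -scalerDl half_half scale1r.
Qed.

Lemma reV_id v : st v = v -> reV v = v.
Proof. by move=> vs; rewrite /reV vs scalerDr -scalerDl half_half scale1r. Qed.

Lemma mtensorD (e : V) n (A B : 'M[C]_n) :
  mtensor e (A + B) = mtensor e A + mtensor e B.
Proof. by apply/matrixP => i j; rewrite !mxE scalerDl. Qed.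

(** A simple tensor of positive elements is positive: write the scalar factor
    as a sum of rank one matrices. *)
Lemma mpos_tensor (v : V) n (A : 'M[C]_n) :
  mpos (M1 v) -> psdmx A -> mpos (mtensor v A).
Proof.
move=> v0 /psd_factor[B ->].
have -> : mtensor v (B^t* *m B) = \sum_k mact ((row k B)^t*) (M1 v) (row k B).
  apply/matrixP => i j; rewrite summxE !mxE scaler_suml; apply: eq_bigr => k _.
  by rewrite !mxE !big_ord1 ctrE !mxE.
by elim/big_ind: _ => //; [exact: mpos0|exact: mposD|move=> k _; exact: mpos_compress].
Qed.

Lemma psd_gram m n (B : 'M[C]_(m, n)) : psdmx (B^t* *m B).
Proof.
move=> x; rewrite mulmxA -mulmxA -ctrM -trace_mx11 -sqn_tr lecE /= eqxx.
exact: sqn_ge0.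
Qed.

Lemma psdD n (A B : 'M[C]_n) : psdmx A -> psdmx B -> psdmx (A + B).
Proof. by move=> A0 B0 x; rewrite mulmxDr mulmxDl mxE addr_ge0. Qed.

Lemma psdZ n (t : R) (A : 'M[C]_n) : 0 <= t -> psdmx A -> psdmx (t%:C%C *: A).
Proof.
move=> t0 A0 x; rewrite -scalemxAr -scalemxAl mxE mulr_ge0 //.
by rewrite lecE /= eqxx.
Qed.

Lemma opnorm_shift_psd n (H : 'M[C]_n) : H^t* = H ->
  psdmx ((opnorm H)%:C%C%:M + H).
Proof.
move=> Hh; apply: psd_rip => [|x].
  by rewrite ctrD Hh -scalemx1 ctrZ ctr1 conj_real.
rewrite mulmxDl ripDr mul_scalar_mx ripZr -/(sqn x).
rewrite -sqr_hnorm expr2 mulrA.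
have : - rip x (H *m x) <= opnorm H * hnorm x * hnorm x.
  rewrite -ripNr; apply: le_trans (ler_rip _ _) _.
  have -> : hnorm (- (H *m x)) = hnorm (H *m x) by rewrite /hnorm sqnN.
  by rewrite mulrC ler_wpM2r ?hnorm_ge0 ?opnormP.
by rewrite -subr_ge0 opprK.
Qed.

Lemma psd1 n : psdmx (1%:M : 'M[C]_n).
Proof. by rewrite -(mulmx1 1%:M) -{1}ctr1; exact: psd_gram. Qed.

Lemma mpos_scalar n (t : R) : 0 <= t -> mpos (mtensor one (t%:C%C%:M : 'M[C]_n)).
Proof.
move=> t0; apply: mpos_tensor mpos_unit _; rewrite -scalemx1.
by apply: psdZ => //; exact: psd1.
Qed.

(** [w (x) H] is dominated by the matrix order unit, because
    [2 (s t + w (x) H) = (s + w) (x) (t + H) + (s - w) (x) (t - H)]. *)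
Lemma tensor_bounded (w : V) n (H : 'M[C]_n) (s t : R) : 0 <= s -> 0 <= t ->
  mpos (M1 (s%:C%C *: one + w)) -> mpos (M1 (s%:C%C *: one - w)) ->
  psdmx (t%:C%C%:M + H) -> psdmx (t%:C%C%:M - H) ->
  mpos (mtensor w H + mtensor one ((s * t)%:C%C%:M)).
Proof.
move=> s0 t0 w1 w2 H1 H2.
have := mposZ (_ : 0 <= 2^-1) (mposD (mpos_tensor w1 H1) (mpos_tensor w2 H2)).
rewrite invr_ge0 ler0n => /(_ isT); congr (mpos _).
apply/matrixP => i j; rewrite !mxE.
set a := one; set h := H i j; set d := (i == j).
rewrite -[RHS]scale1r -half_half [RHS]scalerDl -[RHS]scalerDr; congr (_ *: _).
have -> : (t%:C%C *+ d : C) = t%:C%C * d%:R by rewrite mulr_natr.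
have -> : ((s * t)%:C%C *+ d : C) = s%:C%C * (t%:C%C * d%:R).
  by rewrite rmorphM /= mulrA mulr_natr.
move: (t%:C%C * d%:R : C) => e.
rewrite !scalerDr !scalerDl !scaleNr !scalerN !scalerA opprK.
rewrite ![_ * s%:C%C]mulrC.
rewrite addrACA [X in X + _]addrACA [X in _ + X]addrACA !subrr addr0 add0r.
by rewrite [RHS]addrACA addrC.
Qed.

Definition bounded_below n (a : 'M[V]_n) : Prop :=
  exists2 t : R, 0 <= t & mpos (a + mtensor one t%:C%C%:M).

Lemma bounded_belowD n (a b : 'M[V]_n) :
  bounded_below a -> bounded_below b -> bounded_below (a + b).
Proof.
move=> [s s0 sa] [t t0 tb]; exists (s + t); first exact: addr_ge0.
by rewrite rmorphD /= raddfD mtensorD addrACA; exact: mposD.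
Qed.

Lemma bounded_below_tensor (w : V) n (H : 'M[C]_n) :
  st w = w -> H^t* = H -> bounded_below (mtensor w H).
Proof.
move=> ws Hh; have [s s0 [w2 w1]] := munit_order ws.
exists (s * opnorm H); first by rewrite mulr_ge0 ?opnorm_ge0 // ltW.
apply: tensor_bounded => //; rewrite ?opnorm_ge0 ?(ltW s0) //.
  exact: opnorm_shift_psd.
by rewrite -(opnormN H); apply: opnorm_shift_psd; rewrite ctrN Hh.
Qed.

Lemma sum_delta n (x : 'I_n -> 'I_n -> V) (f : C -> C) p q : f 0 = 0 ->
  \sum_i \sum_j f ((delta_mx i j : 'M[C]_n) p q) *: x i j = f 1 *: x p q.
Proof.
move=> f0; rewrite (bigD1 p) //= [X in _ + X]big1 ?addr0; last first.
  move=> i ip; rewrite big1 // => j _.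
  by rewrite mxE eq_sym (negPf ip) f0 scale0r.
rewrite (bigD1 q) //= big1 ?addr0; first by rewrite mxE !eqxx.
by move=> j jq; rewrite mxE eqxx eq_sym (negPf jq) f0 scale0r.
Qed.

(** The order unit of V gives a matrix order unit: a self-adjoint matrix over V
    is a real combination of tensors of self-adjoint elements. *)
Lemma sa_bounded_below n (a : 'M[V]_n) : madj st a = a -> bounded_below a.
Proof.
move=> asa; have aE i j : st (a i j) = a j i.
  by rewrite -[in RHS]asa !mxE.
pose H (c : C) i j : 'M[C]_n :=
  c *: delta_mx i j + (c *: delta_mx i j)^t*.
have Hh c i j : (H c i j)^t* = H c i j by rewrite ctrD trmxCK addrC.
pose h : C := (2^-1 : R)%:C%C.
have -> : a = \sum_i \sum_j (mtensor (reV (a i j)) (H h i j) +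
                            mtensor (imV (a i j)) (H (h * 'i%C) i j)).
  have HS c (x : 'I_n -> 'I_n -> V) p q :
      (\sum_i \sum_j mtensor (x i j) (H c i j)) p q =
      c *: x p q + Num.conj c *: x q p.
    rewrite summxE.
    transitivity (\sum_i \sum_j ((c * (delta_mx i j : 'M[C]_n) p q) *: x i j +
        Num.conj (c * (delta_mx i j : 'M[C]_n) q p) *: x i j)).
      apply: eq_bigr => i _; rewrite summxE; apply: eq_bigr => j _.
      by rewrite -scalerDl !mxE.
    under eq_bigr => i _ do rewrite big_split /=.
    rewrite big_split /= (sum_delta x (f := fun z => c * z)) ?mulr0 //.
    rewrite (sum_delta x (f := fun z => Num.conj (c * z))) ?mulr0 ?rmorph0 //.
    by rewrite !mulr1.
  apply/matrixP => p q; under eq_bigr => i _ do rewrite big_split /=.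
  rewrite big_split /= [RHS]mxE !HS.
  have -> : Num.conj (h * 'i%C : C) = - (h * 'i%C).
    by rewrite rmorphM /= conj_i /h conj_real mulrN.
  rewrite /h conj_real -[RHS]addrA.
  have rs : reV (a q p) = reV (a p q) by rewrite /reV !aE addrC.
  have is' : imV (a q p) = - imV (a p q) by rewrite /imV !aE -scalerN -scalerN opprB.
  rewrite rs is' scaleNr scalerN opprK [RHS]addrA -scalerDl half_half scale1r.
  by rewrite -scalerDl -mulrDl half_half mul1r -reimV.
elim/big_ind: _ => [||i _]; [|exact: bounded_belowD|].
  by exists 0 => //; rewrite add0r; exact: mpos_scalar.
elim/big_ind: _ => [||j _]; [|exact: bounded_belowD|].
  by exists 0 => //; rewrite add0r; exact: mpos_scalar.
by apply: bounded_belowD; apply: bounded_below_tensor; rewrite ?reV_sa ?imV_sa.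
Qed.

Lemma mtensor_block (e : V) m n (t : C) :
  mtensor e (t%:M : 'M[C]_(m + n)) =
  block_mx (mtensor e t%:M) 0 0 (mtensor e t%:M).
Proof.
rewrite /mtensor scalar_mx_block map_block_mx.
by congr block_mx; apply/matrixP => i j; rewrite !mxE scale0r.
Qed.

Lemma mnorm_set_nonempty n (v : 'M[V]_n) :
  exists2 t : R, 0 <= t &
    mpos (block_mx (mtensor one t%:C%C%:M) v (madj st v) (mtensor one t%:C%C%:M)).
Proof.
have [|t t0] := @sa_bounded_below (n + n) (block_mx 0 v (madj st v) 0).
  rewrite /madj tr_block_mx map_block_mx; congr block_mx; apply/matrixP => i j;
    by rewrite !mxE ?star0 ?starK.
rewrite mtensor_block add_block_mx !add0r !addr0 => h; by exists t.
Qed.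

Lemma mpos_diag n (a : 'M[V]_n) i : mpos a -> mpos (M1 (a i i)).
Proof.
move=> /(mpos_compress (delta_mx i 0 : 'M[C]_(n, 1))); congr (mpos _).
apply/matrixP => j k; rewrite !mxE (bigD1 i) //= [X in _ + X]big1 ?addr0.
  rewrite (bigD1 i) //= big1 ?addr0.
    by rewrite !mxE !ord1 !eqxx rmorph1 mulr1 scale1r.
  by move=> l li; rewrite !mxE (negPf li) mulr0 scale0r.
move=> l li; rewrite big1 // => q _.
by rewrite !mxE (negPf li) rmorph0 mul0r scale0r.
Qed.

Lemma unit0_trivial : one = 0 -> forall v : V, v = 0.
Proof.
move=> one0; have sa0 v : st v = v -> v = 0.
  move=> /munit_order[t t0]; rewrite one0 scaler0 !add0r => -[h1 h2].
  exact: mpos_proper.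
by move=> v; rewrite (reimV v) (sa0 _ (reV_sa v)) (sa0 _ (imV_sa v)) scaler0 addr0.
Qed.

Lemma negative_unit_trivial (t : R) : t < 0 -> mpos (M1 (t%:C%C *: one)) -> one = 0.
Proof.
move=> t0 h; have := mpos_proper h; rewrite -scaleNr -rmorphN.
move=> /(_ (mpos_M1Z _ mpos_unit)); rewrite oppr_ge0 => /(_ (ltW t0))/eqP.
by rewrite scaler_eq0 eq_complex /= (lt_eqF t0) => /eqP.
Qed.

(** A negative admissible scalar makes a negative multiple of the order unit
    positive, and properness of the cone then leaves only the space 0. *)
Lemma mnorm_set_neg_trivial n (v : 'M[V]_n) (t : R) : t < 0 ->
  mpos (block_mx (mtensor one t%:C%C%:M) v (madj st v) (mtensor one t%:C%C%:M)) ->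
  forall a b : 'M[V]_(n + n), a = b.
Proof.
move=> t0; case: n v => [|n] v h a b; first by apply/matrixP => -[].
have := mpos_diag (lshift n.+1 ord0) h; rewrite block_mxEul !mxE eqxx mulr1n.
move=> /(negative_unit_trivial t0)/unit0_trivial V0.
by apply/matrixP => i j; rewrite (V0 (a i j)) (V0 (b i j)).
Qed.

(** When the admissible set is unbounded below, [inf] returns its default value
    0, which still satisfies the bound. *)
Lemma mnorm_le n (v : 'M[V]_n) (t : R) : 0 <= t ->
  mpos (block_mx (mtensor one t%:C%C%:M) v (madj st v) (mtensor one t%:C%C%:M)) ->
  mnorm v <= t.
Proof.
move=> t0 h; rewrite /mnorm; set S := [set _ | _].
have [lb|nlb] := pselect (has_lbound S); first exact: ge_inf.
by rewrite inf_out // => -[_].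
Qed.

(** In the degenerate case of a negative admissible scalar every scalar is
    admissible, all matrices being equal; then 0 is admissible, so [c <= 0], and
    the norm is the default value 0 of [inf]. *)
Lemma mnorm_ge (n : nat) (v : 'M[V]_n) (c : R) :
  (forall t : R, 0 <= t ->
    mpos (block_mx (mtensor one t%:C%C%:M) v (madj st v) (mtensor one t%:C%C%:M)) ->
    c <= t) -> c <= mnorm v.
Proof.
move=> h; have [t t0 vt] := mnorm_set_nonempty v.
rewrite /mnorm; set S := [set _ | _].
have [[s s0 vs]|npos] := pselect (exists2 s, s < 0 & S s).
  have allS r : S r.
    by rewrite /S /= (mnorm_set_neg_trivial s0 vs (block_mx _ _ _ _) 0); exact: mpos0.
  rewrite inf_out; first by apply: h (lexx _) (allS 0).
  move=> -[_ [l hl]]; have := hl _ (allS (l - 1)); lra.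
apply: lb_le_inf; first by exists t.
move=> r Sr; apply: h (Sr); rewrite leNgt; apply/negP => r0.
by apply: npos; exists r.
Qed.

End OrderUnit.

(** * Matrix states *)

Section MatrixStates.
Variables (R : realType) (V : matrix_order_unit_space R).
Local Notation C := R[i].
Local Notation Re := complex.Re.
Local Notation Im := complex.Im.
Local Notation st := (@star R V).
Local Notation one := (munit V).

(** Dominating real and imaginary parts by the order unit bounds the norm. The
    2x2 matrix that defines the norm of [d + i e] is [d (x) H1 + e (x) H2] up to
    the diagonal, for Pauli matrices H1 and H2 (up to sign); these lie between -1 and 1,
    so [tensor_bounded] applies to both terms. *)
Lemma mnorm_re_im (d e : V) (t : R) : 0 <= t ->
  mpos (M1 (t%:C%C *: one + d)) -> mpos (M1 (t%:C%C *: one - d)) ->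
  mpos (M1 (t%:C%C *: one + e)) -> mpos (M1 (t%:C%C *: one - e)) ->
  mnorm (M1 (d + 'i%C *: e)) <= 2 * t.
Proof.
move=> t0 d1 d2 e1 e2.
have sa x : mpos (M1 (t%:C%C *: one + x)) -> st x = x.
  move/mpos_M1_sa; rewrite starD starZr star_unit => /(congr1 (fun v => v - t%:C%C *: one)).
  by rewrite addrAC subrr add0r addrAC subrr add0r.
pose H1 : 'M[C]_(1 + 1) := block_mx 0 1%:M 1%:M 0.
pose H2 : 'M[C]_(1 + 1) := block_mx 0 'i%C%:M (- 'i%C)%:M 0.
(* 1 + K = (1 + K)^* (1 + K) / 2 for a Hermitian involution K *)
have psd_sym (H : 'M[C]_(1 + 1)) : H^t* = H -> H *m H = 1%:M ->
    psdmx (1%:C%C%:M + H) /\ psdmx (1%:C%C%:M - H).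
  move=> Hh HH; have P (K : 'M[C]_(1 + 1)) : K^t* = K -> K *m K = 1%:M ->
      psdmx (1%:C%C%:M + K).
    move=> Kh KK; have -> : 1%:C%C%:M + K = (2^-1 : R)%:C%C *: ((1%:M + K)^t* *m (1%:M + K)).
      rewrite ctrD ctr1 Kh mulmxDl !mulmxDr !mulmx1 mul1mx KK.
      by rewrite [K + _]addrC scalerDr -scalerDl half_half scale1r.
    by apply: psdZ; rewrite ?invr_ge0 ?ler0n //; exact: psd_gram.
  split; first exact: P.
  by apply: P; rewrite ?ctrN ?Hh // mulmxN mulNmx opprK.
have H1h : H1^t* = H1.
  by rewrite /H1 tr_block_mx map_block_mx !trmx0 !map_mx0 !ctr1.
have iC : ('i%C%:M : 'M[C]_1)^t* = (- 'i%C)%:M.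
  by rewrite tr_scalar_mx map_scalar_mx; congr scalar_mx; exact: conj_i.
have niC : ((- 'i%C)%:M : 'M[C]_1)^t* = 'i%C%:M.
  by rewrite -iC trmxCK.
have H2h : H2^t* = H2.
  by rewrite /H2 tr_block_mx map_block_mx !trmx0 !map_mx0 iC niC.
have H1H : H1 *m H1 = 1%:M.
  by rewrite mulmx_block !mul0mx !mulmx0 !mulmx1 !add0r !addr0 -scalar_mx_block.
have H2H : H2 *m H2 = 1%:M.
  rewrite mulmx_block !mul0mx !mulmx0 !add0r !addr0 -!scalar_mxM mulrN mulNr.
  by rewrite -expr2 sqr_i opprK -scalar_mx_block.
have [H1p H1m] := psd_sym _ H1h H1H; have [H2p H2m] := psd_sym _ H2h H2H.
apply: mnorm_le; first by rewrite mulr_ge0.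
have := mposD (tensor_bounded t0 ler01 d1 d2 H1p H1m)
              (tensor_bounded t0 ler01 e1 e2 H2p H2m).
rewrite addrACA -mtensorD -raddfD mulr1 -rmorphD -mulr2n -mulr_natl.
rewrite mtensor_block; congr (mpos _).
rewrite /mtensor /H1 /H2 !map_block_mx !add_block_mx.
have [ds es] := (sa _ d1, sa _ e1).
congr block_mx; apply/matrixP => i j; rewrite !mxE ?starD ?starZ ?conj_i ?ds ?es ?ord1 ?eqxx ?mulr1n;
  by rewrite ?scale0r ?scale1r ?add0r ?addr0 ?mulr1 ?mulr_natl.
Qed.

Lemma papp_M1 r (f : V -> 'M[C]_r) (v : V) (X : 'M[C]_(r, 1)) :
  papp f (M1 v) X = f v *m X.
Proof.
by apply/matrixP => k i; rewrite mxE big_ord1 (ord1 i) [M1 _ _ _]mxE.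
Qed.

Lemma cp_psd r (f : V -> 'M[C]_r) (v : V) : completely_positive f ->
  mpos (M1 v) -> psdmx (f v).
Proof.
move=> fcp v0 x; have /psd_pairingP/(_ x) := fcp _ _ v0.
by rewrite papp_M1 mulmxA trace_mx11.
Qed.

Lemma cp_star r (f : V -> 'M[C]_r) (v : V) : linear f -> completely_positive f ->
  f (st v) = (f v)^t*.
Proof.
move=> fl fcp.
have sa w : st w = w -> (f w)^t* = f w.
  move=> /munit_order[t t0 [_ w0]].
  have h1 : (f (t%:C%C *: one))^t* = f (t%:C%C *: one).
    by apply: psd_herm; apply: cp_psd => //; apply: mpos_M1Z (mpos_unit V); exact: ltW.
  have h2 := psd_herm (cp_psd fcp w0).
  have -> : w = (t%:C%C *: one + w) - t%:C%C *: one by rewrite addrAC subrr add0r.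
  by rewrite (linB fl) ctrD ctrN h1 h2.
have -> : st v = reV v - 'i%C *: imV v.
  by rewrite {1}(reimV v) starD starZ reV_sa imV_sa conj_i scaleNr.
have -> : f v = f (reV v) + 'i%C *: f (imV v).
  by rewrite {1}(reimV v) (linD fl) (linZ fl 'i%C).
rewrite (linB fl) (linZ fl 'i%C) ctrD ctrZ conj_i scaleNr.
by rewrite (sa _ (reV_sa v)) (sa _ (imV_sa v)).
Qed.

Lemma pairing_madj r n (f : V -> 'M[C]_r) (a : 'M[V]_n) :
  (forall v, f (st v) = (f v)^t*) -> pairing f (madj st a) = (pairing f a)^t*.
Proof. by move=> fs; apply/matrixP => i j; rewrite !mxE fs ctrE. Qed.

Lemma papp_block r n (f : V -> 'M[C]_r) (a b c d : 'M[V]_n) X Y :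
  papp f (block_mx a b c d) (row_mx X Y) =
  row_mx (papp f a X + papp f b Y) (papp f c X + papp f d Y).
Proof.
apply/matrixP => k i; rewrite !mxE big_split_ord /=.
under eq_bigr => j _ do rewrite mul_mx_row row_mxEl.
under [X in _ + X]eq_bigr => j _ do rewrite mul_mx_row row_mxEr.
case: fintype.splitP => i' ii'.
  have -> : i = lshift n i' by apply: val_inj.
  rewrite [RHS]mxE ![papp _ _ _ _ _]mxE; congr (_ + _); apply: eq_bigr => j _.
    by rewrite block_mxEul.
  by rewrite block_mxEur.
have -> : i = rshift n i' by apply: val_inj.
rewrite [RHS]mxE ![papp _ _ _ _ _]mxE; congr (_ + _); apply: eq_bigr => j _.
  by rewrite block_mxEdl.
by rewrite block_mxEdr.
Qed.

Lemma papp_tensor1 r n (f : V -> 'M[C]_r) (t : C) (X : 'M[C]_(r, n)) :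
  linear f -> f one = 1%:M -> papp f (mtensor one t%:M) X = t *: X.
Proof.
move=> fl f1; have e i j : mtensor one (t%:M : 'M[C]_n) i j = (t *+ (i == j)) *: one.
  by rewrite !mxE.
apply/matrixP => k i; rewrite [LHS]mxE (bigD1 i) //= big1 ?addr0.
  by rewrite e eqxx mulr1n (linZ fl) f1 -scalemxAl mul1mx.
move=> j ji; rewrite e eq_sym (negPf ji) mulr0n scale0r (lin0 fl).
by rewrite mul0mx mxE.
Qed.

(** A unital completely positive map sends the positive 2x2 matrix with diagonal
    [t] and corner [a], which defines the norm of [a], to a positive scalar
    matrix with diagonal [t]; then [opnorm_form] bounds its corner by [t]. Hence
    complete boundedness of matrix states is automatic. *)
Lemma opnorm_pairing_mnorm r n (f : V -> 'M[C]_r) (a : 'M[V]_n) :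
  linear f -> completely_positive f -> f one = 1%:M ->
  opnorm (pairing f a) <= mnorm a.
Proof.
move=> fl fcp f1; apply: mnorm_ge => t t0 /fcp/psd_pairingP h.
apply: opnorm_form => // x y.
have := h (row_mx (tomx x) (tomx y)); rewrite papp_block !papp_tensor1 //.
rewrite lecE => /andP[_]; rewrite -/(rip _ _).
have rip_row m n1 n2 (X1 X2 : 'M[C]_(m, n1)) (Y1 Y2 : 'M[C]_(m, n2)) :
    rip (row_mx X1 Y1) (row_mx X2 Y2) = rip X1 X2 + rip Y1 Y2.
  have := sqn_row (X1 + X2) (Y1 + Y2); rewrite -add_row_mx !sqnD !sqn_row; lra.
rewrite rip_row !ripDr !ripZr -!rip_pairing pairing_madj => [|v]; last exact: cp_star.
by rewrite -[rip y (_ *m _)]ripC -ripMl -/(sqn _) -/(sqn _) !sqn_tomx; apply: ge0_eq; ring.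
Qed.

Lemma CS_intro n (f : V -> 'M[C]_n) :
  linear f -> completely_positive f -> f one = 1%:M -> CS f.
Proof.
move=> fl fcp f1; split => //; exists 1 => r a.
by rewrite mul1r; exact: opnorm_pairing_mnorm.
Qed.

Lemma CS_lin n (f : V -> 'M[C]_n) : CS f -> linear f.
Proof. by case. Qed.

Lemma CS_cp n (f : V -> 'M[C]_n) : CS f -> completely_positive f.
Proof. by case. Qed.

Lemma CS_unit n (f : V -> 'M[C]_n) : CS f -> f one = 1%:M.
Proof. by case. Qed.

Lemma CS_star n (f : V -> 'M[C]_n) v : CS f -> f (st v) = (f v)^t*.
Proof. by move=> [fl fcp _ _]; exact: cp_star. Qed.

Lemma CS_dsum m n (f : V -> 'M[C]_m) (g : V -> 'M[C]_n) :
  CS f -> CS g -> CS (state_dsum f g).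
Proof.
move=> [fl fcp _ f1] [gl gcp _ g1]; apply: CS_intro.
- move=> t u v; rewrite /state_dsum (linD fl) (linD gl) (linZ fl) (linZ gl).
  by rewrite scale_block_mx !scaler0 add_block_mx !addr0.
- move=> r a a0; apply/psd_pairingP => X; rewrite -(vsubmxK X) papp_dsum.
  rewrite tr_col_mx map_row_mx mul_row_col mxtraceD addr_ge0 //.
    by have /psd_pairingP := fcp _ _ a0; exact.
  by have /psd_pairingP := gcp _ _ a0; exact.
- by rewrite /state_dsum f1 g1 -scalar_mx_block.
Qed.

Lemma CS_compress m n (f : V -> 'M[C]_m) (al : 'M[C]_(m, n)) :
  CS f -> al^t* *m al = 1%:M -> CS (state_compress al f).
Proof.
move=> [fl fcp _ f1] al1; apply: CS_intro.
- move=> t u v; rewrite /state_compress (linD fl) (linZ fl).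
  by rewrite mulmxDr mulmxDl -scalemxAr -scalemxAl.
- move=> r a a0; apply/psd_pairingP => X; rewrite papp_compress mulmxA -ctrM.
  by have /psd_pairingP := fcp _ _ a0; exact.
- by rewrite /state_compress f1 mulmx1.
Qed.

Lemma CS_conv n (f g : V -> 'M[C]_n) (t : R) : 0 <= t <= 1 ->
  CS f -> CS g -> CS (t%:C%C *: f + (1 - t)%:C%C *: g).
Proof.
move=> /andP[t0 t1] [fl fcp _ f1] [gl gcp _ g1]; apply: CS_intro.
- move=> c u v; rewrite !fctE (linD fl) (linD gl) (linZ fl) (linZ gl).
  rewrite !scalerDr !scalerA addrACA; congr (_ + _).
  by rewrite ![_%:C%C * c]mulrC.
- move=> r a a0; rewrite pairing_fD !pairing_fZ; apply: psdD; apply: psdZ => //.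
  + exact: fcp.
  + by rewrite subr_ge0.
  + exact: gcp.
- by rewrite !fctE f1 g1 -scalerDl -rmorphD addrC subrK scale1r.
Qed.

(** A positive functional is completely positive: the quadratic form of [<<f, a>>]
    at [X] is the value of [f] at the compression of [a] by the vector [X]. *)
Lemma state_intro (f : V -> 'M[C]_1) : linear f -> f one = 1%:M ->
  (forall v, mpos (M1 v) -> 0 <= f v ord0 ord0) -> CS f.
Proof.
move=> fl f1 fp; apply: CS_intro => // n a a0; apply/psd_pairingP => X.
have := fp (mact ((X^T)^t*) a X^T ord0 ord0).
have -> : M1 (mact ((X^T)^t*) a X^T ord0 ord0) = mact ((X^T)^t*) a X^T.
  by apply/matrixP => i j; rewrite mxE !ord1.
move=> /(_ (mpos_compress _ a0)); congr (is_true (0 <= _)).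
rewrite mxE (lin_sum fl) summxE /mxtrace; apply: eq_bigr => i _.
rewrite (lin_sum fl) summxE [RHS]mxE big_ord1 [papp _ _ _ _ _]mxE mulr_sumr.
apply: eq_bigr => j _; rewrite (linZ fl) !mxE big_ord1 -mulrA; congr (_ * _).
by rewrite mulrC.
Qed.

End MatrixStates.

(** * Hahn-Banach with a cone constraint *)

Section HahnBanach.
Variables (R : realType) (X : lmodType R[i]).
Local Notation C := R[i].
Local Notation Re := complex.Re.
Local Notation Im := complex.Im.
Local Notation "t *r: x" := (t%:C%C *: x) (at level 40).

Definition csubspace (W : set X) : Prop :=
  [/\ W 0, forall x y, W x -> W y -> W (x + y) &
      forall (c : C) x, W x -> W (c *: x)].

Definition sublinear_on (W : set X) (p : X -> R) : Prop :=
  (forall x y, W x -> W y -> p (x + y) <= p x + p y) /\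
  (forall (t : R) x, 0 <= t -> W x -> p (t *r: x) = t * p x).

Definition convex_cone_on (W : set X) (P : X -> R -> Prop) : Prop :=
  [/\ forall y s, P y s -> W y, P 0 0,
      forall y s y' s', P y s -> P y' s' -> P (y + y') (s + s') &
      forall (t : R) y s, 0 <= t -> P y s -> P (t *r: y) (t * s)].

(** The largest sublinear functional below [p] that is at most [- s] at [- y]
    for every [(y, s)] in the cone; a linear functional below it therefore has
    the lower bound [s] at [y]. *)
Definition cone_hull (p : X -> R) (P : X -> R -> Prop) (x : X) : R :=
  inf [set z | exists y s, P y s /\ z = p (x + y) - s].

Lemma le_inf_add (A B : set R) (c : R) : A !=set0 -> B !=set0 ->
  (forall a b, A a -> B b -> c <= a + b) -> c <= inf A + inf B.
Proof.
move=> A0 B0 h; rewrite -lerBlDr; apply: lb_le_inf => // a Aa.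
rewrite lerBlDr -lerBlDl; apply: lb_le_inf => // b Bb.
by rewrite lerBlDl; exact: h.
Qed.

Definition ray (x : X) (r : R) (y : X) (s : R) : Prop :=
  exists2 t : R, 0 <= t & y = t *r: x /\ s = t * r.

Lemma ray_cone W x r : csubspace W -> W x -> convex_cone_on W (ray x r).
Proof.
move=> [_ _ WZ] Wx; split.
- by move=> _ _ [t _ [-> _]]; exact: WZ.
- by exists 0 => //; rewrite mul0r -[0%:C%C]/(0 : C) scale0r.
- move=> _ _ _ _ [t t0 [-> ->]] [s s0 [-> ->]]; exists (t + s).
    exact: addr_ge0.
  by rewrite rmorphD scalerDl mulrDl.
- move=> u _ _ u0 [t t0 [-> ->]]; exists (u * t); first exact: mulr_ge0.
  by rewrite rmorphM scalerA mulrA.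
Qed.

Lemma ray1 x r : ray x r x r.
Proof. by exists 1 => //; rewrite mul1r scale1r. Qed.

Lemma ray_le W p x y s : sublinear_on W p -> W x -> ray x (p x) y s -> s <= p y.
Proof. by move=> [_ pZ] Wx [t t0 [-> ->]]; rewrite pZ. Qed.

Lemma sublinear0 W p : W 0 -> sublinear_on W p -> p 0 = 0.
Proof. by move=> W0 [_ pZ]; rewrite -(scale0r 0) -[0 : C]/(0%:C%C) pZ // mul0r. Qed.

Lemma sublinear_opp W p x : csubspace W -> sublinear_on W p -> W x ->
  - p (- x) <= p x.
Proof.
move=> [W0 WD WZ] p_sub Wx; rewrite lerNl -subr_ge0 opprK.
rewrite -(sublinear0 W0 p_sub) -(addNr x); have [pD _] := p_sub.
by apply: pD => //; rewrite -scaleN1r; exact: WZ.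
Qed.

Lemma cone_hull_sublinear W p P : csubspace W -> sublinear_on W p ->
  convex_cone_on W P -> (forall y s, P y s -> s <= p y) ->
  [/\ sublinear_on W (cone_hull p P),
      forall x, W x -> cone_hull p P x <= p x &
      forall y s, P y s -> cone_hull p P (- y) <= - s].
Proof.
move=> Wsub p_sub [PW P0 PD PZ] Pp.
have [W0 WD WZ] := Wsub; have [pD pZ] := p_sub.
have WN x : W x -> W (- x) by rewrite -scaleN1r; exact: WZ.
have ne x : [set z | exists y s, P y s /\ z = p (x + y) - s] !=set0.
  by exists (p (x + 0) - 0), 0, 0.
have lb x y s : W x -> P y s -> - p (- x) <= p (x + y) - s.
  move=> Wx Pys; rewrite lerBrDr addrC lerBlDr (le_trans (Pp _ _ Pys)) //.
  have := pD _ _ (WD _ _ Wx (PW _ _ Pys)) (WN _ Wx).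
  by rewrite addrAC subrr add0r.
have le_elt x y s : W x -> P y s -> cone_hull p P x <= p (x + y) - s.
  move=> Wx Pys; apply: ge_inf; last by exists y, s.
  by exists (- p (- x)) => _ [y' [s' [P' ->]]]; exact: lb.
have hZ t x : 0 < t -> W x -> t * cone_hull p P x <= cone_hull p P (t *r: x).
  move=> t0 Wx; apply: lb_le_inf => // _ [y [s [Pys ->]]].
  rewrite -ler_pdivlMl // mulrBr -pZ ?invr_ge0 ?(ltW t0) //; last first.
    by apply: WD; [exact: WZ|exact: PW Pys].
  rewrite scalerDr scalerA -rmorphM mulVf ?gt_eqF // scale1r.
  by apply: le_elt => //; apply: PZ; rewrite ?invr_ge0 ?(ltW t0).
split.
- split=> [x y Wx Wy|t x].
    apply: le_inf_add => // _ _ [y1 [s1 [P1 ->]]] [y2 [s2 [P2 ->]]].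
    apply: le_trans (le_elt _ _ _ (WD _ _ Wx Wy) (PD _ _ _ _ P1 P2)) _.
    rewrite addrACA opprD [leRHS]addrACA lerD2r.
    by apply: pD; apply: WD => //; [exact: PW P1|exact: PW P2].
  rewrite le_eqVlt => /predU1P[<- _|t0 Wx].
    rewrite mul0r -[0%:C%C]/(0 : C) scale0r; apply/le_anti/andP; split.
      by have := le_elt _ _ _ W0 P0; rewrite addr0 subr0 (sublinear0 W0 p_sub).
    apply: lb_le_inf => // _ [y [s [Pys ->]]].
    by have := lb _ _ _ W0 Pys; rewrite oppr0 (sublinear0 W0 p_sub) oppr0.
  apply/le_anti; rewrite hZ // andbT -ler_pdivrMl //.
  have := hZ t^-1 (t *r: x); rewrite invr_gt0 scalerA -rmorphM mulVf ?gt_eqF //.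
  by rewrite scale1r; apply => //; exact: WZ.
- by move=> x Wx; have := le_elt _ _ _ Wx P0; rewrite addr0 subr0.
- move=> y s Pys; have := le_elt _ _ _ (WN _ (PW _ _ Pys)) Pys.
  by rewrite addNr (sublinear0 W0 p_sub) add0r.
Qed.

(** By Zorn there is a minimal sublinear functional below [p]. It is linear,
    because it coincides with its own [cone_hull] along the ray of any vector. *)
Lemma exists_linear_below W p : csubspace W -> sublinear_on W p ->
  exists l : X -> R,
  [/\ forall x y, W x -> W y -> l (x + y) = l x + l y,
      forall (t : R) x, W x -> l (t *r: x) = t * l x &
      forall x, W x -> l x <= p x].
Proof.
move=> Wsub p_sub; have [W0 WD WZ] := Wsub.
have WN x : W x -> W (- x) by rewrite -scaleN1r; exact: WZ.
pose below (q : X -> R) := sublinear_on W q /\ forall x, W x -> q x <= p x.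
pose T := {q : X -> R | below q}.
pose le_T (q1 q2 : T) := `[< forall x, W x -> sval q2 x <= sval q1 x >].
have [|||q qmin] := @ZL_preorder T (exist below p (conj p_sub (fun x _ => lexx _))) le_T.
- by move=> q; apply/asboolP.
- move=> q r s /asboolP h1 /asboolP h2; apply/asboolP => x Wx.
  by rewrite (le_trans (h2 _ Wx)) ?h1.
- move=> A Atot; have [[q0 Aq0]|A0] := pselect (A !=set0); last first.
    exists (exist below p (conj p_sub (fun x _ => lexx _))) => s As.
    by case: A0; exists s.
  pose S x := [set z | exists2 q : T, A q & z = sval q x].
  have Sne x : S x !=set0 by exists (sval q0 x), q0.
  have lbS x : W x -> lbound (S x) (- p (- x)).
    move=> Wx _ [[q [q_sub qp]] /= _ ->].
    by rewrite (le_trans _ (sublinear_opp Wsub q_sub Wx)) // lerN2 qp //; exact: WN.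
  have infS x (q : T) : W x -> A q -> inf (S x) <= sval q x.
    by move=> Wx Aq; apply: ge_inf; [exists (- p (- x)); exact: lbS|exists q].
  have q_sub : sublinear_on W (fun x => inf (S x)).
    split=> [x y Wx Wy|t x t0 Wx].
      apply: le_inf_add => // _ _ [q Aq ->] [r Ar ->].
      have Wxy := WD _ _ Wx Wy.
      have [/asboolP qr|/asboolP qr] := Atot _ _ Aq Ar.
        have [[rD _] _] := svalP r.
        apply: le_trans (infS _ _ Wxy Ar) _; apply: le_trans (rD _ _ Wx Wy) _.
        by rewrite lerD2r qr.
      have [[rD _] _] := svalP q.
      apply: le_trans (infS _ _ Wxy Aq) _; apply: le_trans (rD _ _ Wx Wy) _.
      by rewrite lerD2l qr.
    have hZ s y : 0 <= s -> W y -> s * inf (S y) <= inf (S (s *r: y)).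
      move=> s0 Wy; apply: lb_le_inf => // _ [q Aq ->].
      have [[_ ->] //] := svalP q; rewrite ler_wpM2l //; exact: infS.
    apply/le_anti; rewrite hZ // andbT.
    have [->|tn0] := eqVneq t 0.
      rewrite mul0r (le_trans (infS _ q0 (WZ _ _ Wx) Aq0)) //.
      by have [[_ ->] //] := svalP q0; rewrite mul0r.
    have {tn0}t_gt0 : 0 < t by rewrite lt_def tn0.
    rewrite -ler_pdivrMl //.
    have := hZ t^-1 (t *r: x); rewrite scalerA -rmorphM mulVf ?(gt_eqF t_gt0) //.
    by rewrite scale1r; apply; [rewrite invr_ge0|exact: WZ].
  have qp x : W x -> inf (S x) <= p x.
    by move=> Wx; rewrite (le_trans (infS _ _ Wx Aq0)) //; have [_] := svalP q0; exact.
  by exists (exist below _ (conj q_sub qp)) => s As; apply/asboolP => x Wx /=; exact: infS.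
case: q qmin => q [q_sub qp] qmin; have [qD qZ] := q_sub.
have qN y : W y -> q (- y) = - q y.
  move=> Wy; have Pq := @ray_le _ _ y _ _ q_sub Wy.
  have [h_sub hq hN] := cone_hull_sublinear Wsub q_sub (ray_cone (q y) Wsub Wy) Pq.
  have hp x : W x -> cone_hull q (ray y (q y)) x <= p x.
    by move=> Wx; rewrite (le_trans (hq _ Wx)) ?qp.
  have /asboolP qh := qmin (exist below _ (conj h_sub hp)) (asboolT hq).
  apply/le_anti/andP; split.
    apply: le_trans (qh _ (WN _ Wy)) _; apply: hN; exact: ray1.
  by rewrite lerNl; have := sublinear_opp Wsub q_sub Wy.
exists q; split=> //.
- move=> x y Wx Wy; apply/le_anti; rewrite qD //= -lerBrDr -qN //.
  by rewrite -{1}(addrK y x) qD //; [exact: WD|exact: WN].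
- move=> t x Wx; case: (leP 0 t) => t0; first exact: qZ.
  rewrite -[t *r: x]opprK -scaleNr -rmorphN qN; last exact: WZ.
  by rewrite qZ ?oppr_ge0 ?(ltW t0) // mulNr opprK.
Qed.

Definition complexify (l : X -> R) (x : X) : C :=
  Complex (l x) (- l ('i%C *: x)).

Lemma complexify_linear W (l : X -> R) : csubspace W ->
  (forall x y, W x -> W y -> l (x + y) = l x + l y) ->
  (forall (t : R) x, W x -> l (t *r: x) = t * l x) ->
  (forall x y, W x -> W y ->
     complexify l (x + y) = complexify l x + complexify l y) /\
  (forall (c : C) x, W x -> complexify l (c *: x) = c * complexify l x).
Proof.
move=> [W0 WD WZ] lD lZ; rewrite /complexify.
have WN x : W x -> W (- x) by rewrite -scaleN1r; exact: WZ.
have lN x : W x -> l (- x) = - l x.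
  by move=> Wx; rewrite -scaleN1r -[X in X *: _](rmorphN1 (real_complex R)) lZ // mulN1r.
split.
- move=> x y Wx Wy; rewrite scalerDr lD // lD; try exact: WZ.
  by apply/eqP; rewrite eq_complex /= opprD !eqxx.
- move=> [a b] x Wx; have Wix : W ('i%C *: x) by exact: WZ.
  have cE (y : X) : (a +i* b)%C *: y = a *r: y + b *r: ('i%C *: y).
    by rewrite scalerA -scalerDl; congr (_ *: _); apply/eqP; rewrite eq_complex /=
      !(mul0r, mulr0, mul1r, mulr1, addr0, add0r, subr0, subrr) !eqxx.
  have iiE (y : X) : 'i%C *: ('i%C *: y) = - y by rewrite scalerA -expr2 sqr_i scaleN1r.
  have e1 : l ((a +i* b)%C *: x) = a * l x + b * l ('i%C *: x).
    by rewrite cE lD; [rewrite lZ // lZ|exact: WZ|exact: WZ].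
  have e2 : l ('i%C *: ((a +i* b)%C *: x)) = a * l ('i%C *: x) - b * l x.
    rewrite scalerA mulrC -scalerA cE iiE lD; [|exact: WZ|by apply: WZ; exact: WN].
    by rewrite lZ // lZ ?lN ?mulrN //; exact: WN.
  by rewrite e1 e2; apply/eqP; rewrite eq_complex /= !mulrN opprK opprB eqxx addrC eqxx.
Qed.

(** The form of the Hahn-Banach theorem behind every separation argument below:
    [p] bounds the functional from above, and the cone [P] of pairs carries
    lower bounds that are compatible with [p]. Since [p] need only be sublinear
    for real scalars, complex linearity comes for free. *)
Theorem hahn_banach_cone W p P : csubspace W -> sublinear_on W p ->
  convex_cone_on W P -> (forall y s, P y s -> s <= p y) ->
  exists F : X -> C,
  [/\ forall x y, W x -> W y -> F (x + y) = F x + F y,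
      forall (c : C) x, W x -> F (c *: x) = c * F x,
      forall x, W x -> Re (F x) <= p x &
      forall y s, P y s -> s <= Re (F y)].
Proof.
move=> Wsub p_sub Pcone Pp; have [W0 WD WZ] := Wsub.
have [h_sub hp hN] := cone_hull_sublinear Wsub p_sub Pcone Pp.
have [l [lD lZ lh]] := exists_linear_below Wsub h_sub.
have WN x : W x -> W (- x) by rewrite -scaleN1r; exact: WZ.
have lN x : W x -> l (- x) = - l x.
  by move=> Wx; rewrite -scaleN1r -[X in X *: _](rmorphN1 (real_complex R)) lZ // mulN1r.
have [FD FZ] := complexify_linear Wsub lD lZ.
exists (complexify l); split=> //.
- by move=> x Wx /=; rewrite (le_trans (lh _ Wx)) ?hp.
- move=> y s Pys /=; have [PW _ _ _] := Pcone; have Wy := PW _ _ Pys.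
  by rewrite -lerN2 -lN // (le_trans (lh _ _)) //; [exact: WN|exact: hN].
Qed.

End HahnBanach.

(** * States norm an order unit space *)

Section States.
Variables (R : realType) (V : matrix_order_unit_space R).
Local Notation C := R[i].
Local Notation Re := complex.Re.
Local Notation Im := complex.Im.
Local Notation st := (@star R V).
Local Notation one := (munit V).

Lemma ReD (a b : C) : Re (a + b) = Re a + Re b.
Proof. by rewrite raddfD. Qed.

Lemma ReN (a : C) : Re (- a) = - Re a.
Proof. by rewrite raddfN. Qed.

Lemma reVD (v w : V) : reV (v + w) = reV v + reV w.
Proof. by rewrite /reV starD addrACA scalerDr. Qed.

Lemma reVZ (t : R) (v : V) : reV (t%:C%C *: v) = t%:C%C *: reV v.
Proof. by rewrite /reV starZr -scalerDr !scalerA mulrC. Qed.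

Lemma reV0 : reV (0 : V) = 0.
Proof. by rewrite /reV star0 addr0 scaler0. Qed.

Lemma reVN (v : V) : reV (- v) = - reV v.
Proof. by rewrite /reV starN -opprD scalerN. Qed.

Lemma reV_i (v : V) : st v = v -> reV ('i%C *: v) = 0.
Proof. by move=> vs; rewrite /reV starZ conj_i vs scaleNr subrr scaler0. Qed.

Lemma M1_0 : M1 (0 : V) = 0.
Proof. by apply/matrixP => i j; rewrite !mxE. Qed.

Lemma mpos_archimedean1 (v : V) :
  (forall t : R, 0 < t -> mpos (M1 (t%:C%C *: one + v))) -> mpos (M1 v).
Proof.
move=> h; apply: (@mpos_archimedean _ _ _ _ (M1 one)) => t t0.
have := mpos_M1Z (ltW t0) (h _ (etrans (invr_gt0 t) t0)).
rewrite scalerDr scalerA -rmorphM mulfV ?gt_eqF // scale1r.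
by rewrite M1D mxscalev_M1.
Qed.

(** The gauge whose linear minorants are the states. It is defined on all of V,
    through real parts, so that it can be fed to [hahn_banach_cone]. *)
Definition order_gauge (w : V) : R :=
  inf [set t : R | mpos (M1 (t%:C%C *: one - reV w))].

Lemma order_gauge_nonempty (w : V) :
  [set t : R | mpos (M1 (t%:C%C *: one - reV w))] !=set0.
Proof. by have [t _ [h _]] := munit_order (reV_sa w); exists t. Qed.

Lemma order_gauge_lbound (w : V) : one != 0 ->
  has_lbound [set t : R | mpos (M1 (t%:C%C *: one - reV w))].
Proof.
move=> one0; have [s s0 [_ h]] := munit_order (reV_sa w).
exists (- s) => t /= tw; rewrite lerNl leNgt; apply/negP => ts.
have := mpos_M1D tw h; rewrite addrACA addNr addr0 -scalerDl -rmorphD.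
have neg : t + s < 0 by lra.
by move=> /(negative_unit_trivial neg) /eqP; rewrite (negPf one0).
Qed.

Lemma order_gauge_le (w : V) (t : R) : one != 0 ->
  mpos (M1 (t%:C%C *: one - reV w)) -> order_gauge w <= t.
Proof. by move=> one0 h; apply: ge_inf; [exact: order_gauge_lbound|]. Qed.

Lemma order_gauge_sublinear : one != 0 -> sublinear_on setT order_gauge.
Proof.
move=> one0.
have hD x y : order_gauge (x + y) <= order_gauge x + order_gauge y.
  apply: le_inf_add; [exact: order_gauge_nonempty|exact: order_gauge_nonempty|].
  move=> s t /= sx ty; apply: order_gauge_le => //.
  by rewrite rmorphD scalerDl reVD opprD addrACA; exact: mpos_M1D.
have hZ (t : R) x : 0 < t -> t * order_gauge x <= order_gauge (t%:C%C *: x).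
  move=> t0; apply: lb_le_inf; first exact: order_gauge_nonempty.
  move=> s /= sx; rewrite -ler_pdivlMl //; apply: order_gauge_le => //.
  have ti : 0 <= t^-1 by rewrite invr_ge0 ltW.
  have := mpos_M1Z ti sx; rewrite scalerBr scalerA -rmorphM -reVZ scalerA.
  by rewrite -rmorphM mulVf ?gt_eqF // scale1r.
split=> [x y _ _|t x]; first exact: hD.
rewrite le_eqVlt => /predU1P[<- _|t0 _].
  rewrite mul0r -[0%:C%C]/(0 : C) scale0r; apply/le_anti/andP; split.
    by apply: order_gauge_le; rewrite // reV0 subr0 -[0%:C%C]/(0 : C) scale0r M1_0; exact: mpos0.
  apply: lb_le_inf => [|s]; first exact: order_gauge_nonempty.
  rewrite /= reV0 subr0 leNgt => h; apply/negP => /negative_unit_trivial/(_ h)/eqP.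
  by rewrite (negPf one0).
apply/le_anti; rewrite hZ // andbT -ler_pdivrMl //.
have := hZ t^-1 (t%:C%C *: x); rewrite invr_gt0 scalerA -rmorphM mulVf ?gt_eqF //.
by rewrite scale1r; apply.
Qed.

(** Hahn-Banach for the order gauge, norming along the ray of [- v]. The gauge is
    positive there, since otherwise [t + v] would be positive for all [t > 0] and
    [v] too, by the Archimedean property. A functional below the gauge is
    positive and unital. *)
Lemma exists_negative_state (v : V) : st v = v -> ~ mpos (M1 v) ->
  exists2 phi : V -> 'M[C]_1, CS phi & Re (phi v ord0 ord0) < 0.
Proof.
move=> vs nv; have one0 : one != 0.
  apply/eqP => /unit0_trivial V0; apply: nv; rewrite (V0 v).
  by rewrite M1_0; exact: mpos0.
have gs := order_gauge_sublinear one0.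
have p0 : 0 < order_gauge (- v).
  rewrite ltNge; apply/negP => h; apply: nv; apply: mpos_archimedean1 => t t0.
  have /(inf_lt (order_gauge_nonempty _))[s /= sv st0] : order_gauge (- v) < t.
    exact: le_lt_trans h t0.
  rewrite reVN opprK reV_id // in sv.
  have ts : 0 <= t - s by rewrite subr_ge0 ltW.
  have := mpos_M1D (mpos_M1Z ts (mpos_unit V)) sv.
  by rewrite addrA -scalerDl -rmorphD subrK.
have Vsub : csubspace (setT : set V) by split.
have Ppos y s := @ray_le _ _ _ _ (- v) y s gs I.
have [F [FD FZ Fp FP]] := hahn_banach_cone Vsub gs (ray_cone _ Vsub I) Ppos.
have FN w : F (- w) = - F w by rewrite -scaleN1r FZ // mulN1r.
have Fsa w : st w = w -> Im (F w) = 0.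
  move=> ws; have i0 u : reV u = 0 -> Re (F u) <= 0.
    move=> u0; apply: le_trans (Fp _ I) _; apply: order_gauge_le => //.
    by rewrite u0 subr0 -[0%:C%C]/(0 : C) scale0r M1_0; exact: mpos0.
  have h1 := i0 _ (reV_i ws).
  have h2 : Re (F (- ('i%C *: w))) <= 0 by apply: i0; rewrite reVN reV_i // oppr0.
  rewrite FN FZ // ReN in h2; rewrite FZ // in h1.
  move: h1 h2; case: (F w) => a b /=; rewrite mul0r mul1r sub0r; lra.
have Fpos w : mpos (M1 w) -> 0 <= F w.
  move=> w0; have ws := mpos_M1_sa w0; rewrite lecE Fsa // eqxx /=.
  rewrite -oppr_le0 -ReN -FN; apply: le_trans (Fp _ I) _; apply: order_gauge_le => //.
  by rewrite reVN reV_id // opprK -[0%:C%C]/(0 : C) scale0r add0r.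
have F1 : F one = 1.
  apply/eqP; rewrite eq_complex Fsa ?star_unit // eqxx andbT; apply/eqP/le_anti/andP.
  split.
    apply: le_trans (Fp _ I) _; apply: order_gauge_le => //.
    by rewrite reV_id ?star_unit // scale1r subrr M1_0; exact: mpos0.
  rewrite -lerN2 -ReN -FN; apply: le_trans (Fp _ I) _; apply: order_gauge_le => //.
  rewrite reVN reV_id ?star_unit // opprK rmorphN scaleN1r addNr.
  by rewrite M1_0; exact: mpos0.
exists (fun w => (F w)%:M); last first.
  rewrite mxE eqxx mulr1n.
  have := FP (- v) (order_gauge (- v)); rewrite FN ReN => h.
  by rewrite -oppr_gt0 (lt_le_trans p0) // h //; exact: ray1.
apply: state_intro.
- by move=> c u w; rewrite FD // FZ // raddfD /= -scale_scalar_mx.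
- by rewrite F1.
- by move=> w w0; rewrite mxE eqxx mulr1n; exact: Fpos.
Qed.

(** Real-valued evaluation: on self-adjoint elements states are real. *)
Definition sev (phi : V -> 'M[C]_1) (v : V) : R := Re (phi v ord0 ord0).

Lemma mpos_states (v : V) : st v = v ->
  (forall phi, CS phi -> 0 <= sev phi v) -> mpos (M1 v).
Proof.
move=> vs h; apply: contrapT => /(exists_negative_state vs)[phi phiS].
by rewrite ltNge h.
Qed.

Section OneState.
Variables (phi : V -> 'M[C]_1) (phiS : CS phi).

Lemma sevD v w : sev phi (v + w) = sev phi v + sev phi w.
Proof. by rewrite /sev (linD (CS_lin phiS)) mxE ReD. Qed.

Lemma sevZ (t : R) v : sev phi (t%:C%C *: v) = t * sev phi v.
Proof. by rewrite /sev (linZ (CS_lin phiS)) mxE Re_realM. Qed.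

Lemma sevN v : sev phi (- v) = - sev phi v.
Proof. by rewrite /sev (linN (CS_lin phiS)) mxE ReN. Qed.

Lemma sevB v w : sev phi (v - w) = sev phi v - sev phi w.
Proof. by rewrite sevD sevN. Qed.

Lemma sev1 : sev phi one = 1.
Proof. by rewrite /sev (CS_unit phiS) mxE. Qed.

Lemma sev_saE v : st v = v -> phi v ord0 ord0 = (sev phi v)%:C%C.
Proof.
move=> vs; have := CS_star v phiS; rewrite vs => /matrixP/(_ ord0 ord0).
rewrite ctrE /sev; case: (phi v _ _) => a b [] /= /eqP.
by rewrite -subr_eq0 opprK -mulr2n mulrn_eq0 /= => /eqP ->.
Qed.

Lemma sev_reim v :
  phi v ord0 ord0 = (sev phi (reV v))%:C%C + 'i%C * (sev phi (imV v))%:C%C.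
Proof.
rewrite -(sev_saE (reV_sa v)) -(sev_saE (imV_sa v)) {1}(reimV v).
by rewrite (linD (CS_lin phiS)) (linZ (CS_lin phiS) 'i%C) !mxE.
Qed.

Lemma normc_state v : Normc.normc (phi v ord0 ord0) <= mnorm (M1 v).
Proof.
have [pl pcp _ p1] := phiS.
apply: le_trans (opnorm_pairing_mnorm (M1 v) pl pcp p1).
have := hnorm_papp phi (M1 v) (1%:M : 'M[C]_1); rewrite papp_M1 mulmx1.
have h1 (A : 'M[C]_1) : hnorm A = Normc.normc (A ord0 ord0).
  by rewrite /hnorm sqnE !big_ord1 sqrtr_sqr ger0_norm ?normc_ge0.
by rewrite !h1 [1%:M _ _]mxE eqxx mulr1n Normc.normc1 mulr1.
Qed.

Lemma sev_mnorm v : `|sev phi v| <= mnorm (M1 v).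
Proof.
apply: le_trans (normc_state v); rewrite -lecR.
exact: normc_ge_Re.
Qed.

End OneState.

Lemma state_ext (phi psi : V -> 'M[C]_1) : CS phi -> CS psi ->
  (forall v, st v = v -> sev phi v = sev psi v) -> phi = psi.
Proof.
move=> phiS psiS h; apply/funext => v; apply/matrixP => i j; rewrite !ord1.
by rewrite (sev_reim phiS) (sev_reim psiS) !h ?reV_sa ?imV_sa.
Qed.

Lemma states_separate (v : V) :
  (forall phi : V -> 'M[C]_1, CS phi -> phi v ord0 ord0 = 0) -> v = 0.
Proof.
move=> h; have hsa w : st w = w -> (forall phi, CS phi -> sev phi w = 0) -> w = 0.
  move=> ws w0; apply: mpos_proper; apply: mpos_states.
  - by [].
  - by move=> phi /w0 ->.
  - by rewrite starN ws.
  - by move=> phi phiS; rewrite sevN // w0 // oppr0.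
have hri phi : CS phi -> sev phi (reV v) = 0 /\ sev phi (imV v) = 0.
  move=> phiS; have := h _ phiS; rewrite (sev_reim phiS) => /eqP.
  by rewrite eq_complex /= !(mul0r, mul1r, mulr0, subr0, addr0, add0r) => /andP[/eqP -> /eqP ->].
rewrite (reimV v) (hsa (reV v)) ?reV_sa // => [|phi /hri[]//].
by rewrite (hsa (imV v)) ?imV_sa // => [|phi /hri[]//]; rewrite scaler0 addr0.
Qed.

Lemma mpos_state_bound (d : V) (t : R) : st d = d ->
  (forall phi, CS phi -> `|sev phi d| <= t) ->
  mpos (M1 (t%:C%C *: one + d)) /\ mpos (M1 (t%:C%C *: one - d)).
Proof.
move=> ds h; split; apply: mpos_states.
- by rewrite starD starZr star_unit ds.
- move=> phi phiS; rewrite sevD // sevZ // sev1 // mulr1.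
  by have := h _ phiS; rewrite ler_norml => /andP[]; lra.
- by rewrite starB starZr star_unit ds.
- move=> phi phiS; rewrite sevB // sevZ // sev1 // mulr1.
  by have := h _ phiS; rewrite ler_norml => /andP[]; lra.
Qed.

End States.

(** * Compactness of the state space *)

Section Compactness.
Variables (R : realType) (V : matrix_order_unit_space R).
Local Notation C := R[i].
Local Notation Re := complex.Re.
Local Notation Im := complex.Im.
Local Notation st := (@star R V).
Local Notation one := (munit V).
Local Notation state := (V -> 'M[C]_1).

Lemma ultra_bounded_cvg (T : Type) (U : set_system T) (f : T -> R) (M : R) :
  UltraFilter U -> (forall t, `|f t| <= M) -> exists l : R, f @ U --> l.
Proof.
move=> UU fM; have UF : ProperFilter U := @ultra_proper _ _ UU.
have fU : ProperFilter (f @ U) by exact: fmap_proper_filter.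
have [|l [_ lcl]] := @segment_compact R (- M) M (f @ U) fU.
  by apply: (@filterE _ U) => t /=; rewrite in_itv /= -ler_norml.
exists l; apply/cvgrPdist_lt => e e0.
have [//|h] := in_ultra_setVsetC [set t | `|l - f t| < e] UU.
have [x [xn xb]] := lcl (~` [set x | `|l - x| < e]) (ball l e) h (nbhsx_ballx _ _ e0).
by case: xn.
Qed.

(** Compactness of the state space: values of states at [v] stay in an interval
    of radius [mnorm v], so they converge along an ultrafilter, and linearity,
    positivity and unitality pass to pointwise limits. *)
Lemma ultra_state_limit (T : Type) (U : set_system T) (chi : T -> state) :
  UltraFilter U -> (forall t, CS (chi t)) ->
  exists2 phi : state, CS phi & forall v, (fun t => sev (chi t) v) @ U --> sev phi v.
Proof.
move=> UU chiS; have UF : ProperFilter U := @ultra_proper _ _ UU.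
have lim v : {l : R | (fun t => sev (chi t) v) @ U --> l}.
  apply: cid; apply: (@ultra_bounded_cvg _ _ _ (mnorm (M1 v))) => t.
  exact: sev_mnorm (chiS t) v.
pose u v := sval (lim v); have ul v : (fun t => sev (chi t) v) @ U --> u v := svalP (lim v).
have uD v w : u (v + w) = u v + u w.
  apply: (norm_cvg_unique (F := (fun t => sev (chi t) (v + w)) @ U)); first exact: ul.
  rewrite /= (_ : (fun t => sev (chi t) (v + w)) = (fun t => sev (chi t) v + sev (chi t) w)).
    exact: (cvgD (ul v) (ul w)).
  by apply/funext => t; rewrite (sevD (chiS t)).
have uZ (r : R) v : u (r%:C%C *: v) = r * u v.
  apply: (norm_cvg_unique (F := (fun t => sev (chi t) (r%:C%C *: v)) @ U)); first exact: ul.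
  rewrite /= (_ : (fun t => sev (chi t) (r%:C%C *: v)) = (fun t => r * sev (chi t) v)).
    exact: (cvgM (cvg_cst r) (ul v)).
  by apply/funext => t; rewrite (sevZ (chiS t)).
have u_cst v c : (forall t, sev (chi t) v = c) -> u v = c.
  move=> h; apply: (norm_cvg_unique (F := (fun t => sev (chi t) v) @ U)); first exact: ul.
  by rewrite /= (_ : (fun t => sev (chi t) v) = cst c); [exact: cvg_cst|apply/funext].
have u_i v : st v = v -> u ('i%C *: v) = 0.
  move=> vs; apply: u_cst => t.
  by rewrite /sev (linZ (CS_lin (chiS t))) mxE (sev_saE (chiS t) vs) /= !mul0r mulr0 subr0.
have Vsub : csubspace (setT : set V) by split.
have [cD cZ] := complexify_linear Vsub (fun x y _ _ => uD x y) (fun t x _ => uZ t x).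
pose phi : state := fun v => (complexify u v)%:M.
have phiE v : sev phi v = u v by rewrite /sev mxE eqxx mulr1n.
exists phi; last by move=> v; rewrite phiE; exact: ul.
apply: state_intro.
- by move=> c x y; rewrite /phi cD // cZ // raddfD /= -scale_scalar_mx.
- rewrite /phi; congr (_%:M); apply/eqP; rewrite eq_complex /= u_i ?star_unit // oppr0.
  by rewrite (u_cst one 1) ?eqxx // => t; exact: sev1.
- move=> v v0; rewrite mxE eqxx mulr1n lecE /= u_i ?(mpos_M1_sa v0) // oppr0 eqxx /=.
  apply: (cvgr_to_ge (ul v)); apply: nearW => t.
  have := cp_psd (CS_cp (chiS t)) v0 1%:M; rewrite mulmx1 ctr1 mul1mx.
  by rewrite lecE => /andP[].
Qed.

Definition state_continuous (f : state -> R) : Prop :=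
  forall phi : state, CS phi -> forall d : R, 0 < d ->
  exists (s : seq V) (r : R), 0 < r /\ forall psi : state, CS psi ->
    (forall v, v \in s -> `|sev psi v - sev phi v| < r) -> `|f psi - f phi| < d.

(** Uniform continuity, measured by any set of elements that separates the
    states. If it fails, the violating pairs that are close on finite subsets of
    [E] generate a filter; along a finer ultrafilter both components converge,
    to limits which agree on [E] and so coincide, against continuity there. *)
Lemma state_modulus (f : state -> R) (E : set V) (e : R) :
  (forall phi psi : state, CS phi -> CS psi ->
     (forall v, E v -> sev phi v = sev psi v) -> phi = psi) ->
  state_continuous f -> 0 < e ->
  exists (s : seq V) (r : R), [/\ 0 < r, forall v, v \in s -> E v &
    forall phi psi : state, CS phi -> CS psi ->
      (forall v, v \in s -> `|sev phi v - sev psi v| < r) -> `|f phi - f psi| < e].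
Proof.
move=> Esep fcont e0; apply: contrapT => nmod.
pose T := {p : state * state | [/\ CS p.1, CS p.2 & e <= `|f p.1 - f p.2|]}.
pose D := [set i : seq V * R | 0 < i.2 /\ forall v, v \in i.1 -> E v].
pose B (i : seq V * R) : set T :=
  [set t | forall v, v \in i.1 -> `|sev (sval t).1 v - sev (sval t).2 v| < i.2].
have FF : Filter (filter_from D B).
  apply: filter_from_filter; first by exists ([::], 1); split=> //; exact: ltr01.
  move=> [s1 r1] [s2 r2] [/= r10 s1E] [/= r20 s2E].
  exists (s1 ++ s2, Num.min r1 r2).
    split=> /= [|v]; first by rewrite lt_min r10.
    by rewrite mem_cat => /orP[/s1E|/s2E].
  move=> t /= h; split=> v vs /=.
    by have := h v; rewrite mem_cat vs lt_min => /(_ isT)/andP[].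
  by have := h v; rewrite mem_cat vs orbT lt_min => /(_ isT)/andP[].
have FP : ProperFilter (filter_from D B).
  apply: filter_from_proper => -[s r] [/= r0 sE].
  apply: contrapT => Bempty; apply: nmod; exists s, r; split=> // phi psi phiS psiS h.
  rewrite ltNge; apply/negP => ef; apply: Bempty.
  by exists (exist _ (phi, psi) (And3 phiS psiS ef)).
have [U [UU FU]] := ultraFilterLemma FP.
have UF : ProperFilter U := @ultra_proper _ _ UU.
have S1 (t : T) : CS (sval t).1 by case: (svalP t).
have S2 (t : T) : CS (sval t).2 by case: (svalP t).
have [phi phiS lphi] := ultra_state_limit UU S1.
have [psi psiS lpsi] := ultra_state_limit UU S2.
have phipsi : phi = psi.
  apply: Esep => // v Ev; apply/eqP; rewrite -subr_eq0 -normr_le0.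
  apply/ler_addgt0Pl => d d0; rewrite addr0.
  have l : (fun t : T => sev (sval t).1 v - sev (sval t).2 v) @ U -->
    sev phi v - sev psi v by exact: (cvgB (lphi v) (lpsi v)).
  apply: (cvgr_to_le (cvg_norm l)); apply: FU; exists ([:: v], d).
    by split=> //= w; rewrite inE => /eqP ->.
  by move=> t /= /(_ v); rewrite inE eqxx => /(_ isT)/ltW.
subst psi; have [s [r [r0 hs]]] := fcont _ phiS _ (divr_gt0 e0 (ltr0n _ 2)).
have near_all (chi : T -> state) : (forall v, (fun t => sev (chi t) v) @ U --> sev phi v) ->
    U [set t | forall v, v \in s -> `|sev (chi t) v - sev phi v| < r].
  move=> lchi; elim: s {hs} => [|v s IH]; first by apply: filterE => t v; rewrite in_nil.
  have := lchi v => /cvgrPdist_lt/(_ _ r0) => hv.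
  apply: filterS (filterI hv IH) => t /= [h1 h2] w; rewrite inE => /orP[/eqP ->|/h2//].
  by rewrite distrC.
have [t [t1 t2]] := filter_ex (filterI (near_all _ lphi) (near_all _ lpsi)).
have h1 := hs _ (S1 t) t1; have h2 := hs _ (S2 t) t2.
case: (svalP t) => _ _; rewrite leNgt => /negP; apply.
have -> : f (sval t).1 - f (sval t).2 = (f (sval t).1 - f phi) - (f (sval t).2 - f phi).
  by rewrite opprB addrA subrK.
rewrite (le_lt_trans (ler_normB _ _)) // [ltRHS]splitr; exact: ltrD.
Qed.

End Compactness.

(** * Kadison's representation of affine functions *)

Section AffineFunctions.
Variables (R : realType) (V : matrix_order_unit_space R).
Local Notation C := R[i].
Local Notation Re := complex.Re.
Local Notation Im := complex.Im.
Local Notation st := (@star R V).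
Local Notation one := (munit V).
Local Notation state := (V -> 'M[C]_1).

Definition state_affine (f : state -> R) : Prop :=
  forall (phi psi : state) (t : R), CS phi -> CS psi -> 0 <= t <= 1 ->
  f (t%:C%C *: phi + (1 - t)%:C%C *: psi) = t * f phi + (1 - t) * f psi.

Lemma sev_affine v : state_affine (fun phi => sev phi v).
Proof.
by move=> phi psi t _ _ _; rewrite /sev !fctE !mxE ReD !Re_realM.
Qed.

Lemma sum_ge_mem (T : eqType) (s : seq T) (F : T -> R) x :
  (forall y, 0 <= F y) -> x \in s -> F x <= \sum_(y <- s) F y.
Proof.
move=> F0; elim: s => // y s IH; rewrite inE big_cons => /orP[/eqP ->|/IH h].
  by rewrite lerDl sumr_ge0.
by rewrite (le_trans h) // lerDr.
Qed.

(** Shrinking a pair of states towards each other turns a modulus of uniform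
    continuity of an affine function into a Lipschitz estimate up to [e]. *)
Lemma affine_modulus (f : state -> R) (s : seq V) (r e : R) : state_affine f ->
  0 < r ->
  (forall phi psi : state, CS phi -> CS psi ->
      (forall v, v \in s -> `|sev phi v - sev psi v| < r) -> `|f phi - f psi| < e) ->
  forall phi psi : state, CS phi -> CS psi ->
    f phi - f psi <= e + 2 * e / r * \sum_(v <- s) `|sev phi v - sev psi v|.
Proof.
move=> faff r0 fmod phi psi phiS psiS; set M := \sum_(v <- s) _.
have vM v : v \in s -> `|sev phi v - sev psi v| <= M.
  by move=> vs; apply: (sum_ge_mem (F := fun v => `|sev phi v - sev psi v|)).
have M0 : 0 <= M by apply: sumr_ge0.
have e0 : 0 < e.
  apply: le_lt_trans (normr_ge0 (f phi - f phi)) (fmod _ _ phiS phiS _) => v _.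
  by rewrite subrr normr0.
have [Mr|rM] := ltP M r.
  apply: le_trans (ler_norm _) _; apply: le_trans (ltW (fmod _ _ phiS psiS _)) _.
    by move=> v /vM; move/le_lt_trans; apply.
  by rewrite lerDl mulr_ge0 // divr_ge0 ?mulr_ge0 // ltW.
have Mp : 0 < M by exact: lt_le_trans rM.
pose t := r / (2 * M).
have t0 : 0 < t by rewrite divr_gt0 ?mulr_gt0.
have t1 : t <= 1 by rewrite ler_pdivrMr ?mulr_gt0 // mul1r; lra.
have t01 : 0 <= t <= 1 by rewrite (ltW t0).
have := fmod _ _ (CS_conv t01 phiS psiS) psiS.
rewrite faff //.
have -> : t * f phi + (1 - t) * f psi - f psi = t * (f phi - f psi) by ring.
have h v : v \in s -> `|sev (t%:C%C *: phi + (1 - t)%:C%C *: psi) v - sev psi v| < r.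
  move=> /vM vs; rewrite sev_affine //.
  have -> : t * sev phi v + (1 - t) * sev psi v - sev psi v =
    t * (sev phi v - sev psi v) by ring.
  rewrite normrM gtr0_norm //; apply: le_lt_trans (ler_wpM2l (ltW t0) vs) _.
  have -> : t * M = r / 2 by rewrite /t; field; rewrite gt_eqF.
  lra.
move=> /(_ h); rewrite normrM gtr0_norm // => ht.
apply: le_trans (ler_norm _) _.
have : `|f phi - f psi| < e / t by rewrite ltr_pdivlMr // mulrC.
move/ltW/le_trans; apply.
have -> : e / t = 2 * e / r * M by rewrite /t; field; rewrite !gt_eqF.
by rewrite lerDr ltW.
Qed.

(** A separating real subspace [E] approximates [f] up to a constant. The modulus
    of continuity involves finitely many elements of [E], so that [f phi - f psi]
    is bounded, up to [e], by a seminorm of the difference of two vectors in C^N;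
    a functional on C^N that separates this seminorm from the differences of [f]
    has as its coordinates the coefficients of an element of [E]. *)
Lemma affine_approx (f : state -> R) (E : set V) (e : R) :
  (forall phi psi : state, CS phi -> CS psi ->
     (forall v, E v -> sev phi v = sev psi v) -> phi = psi) ->
  E 0 -> (forall v w, E v -> E w -> E (v + w)) ->
  (forall (t : R) v, E v -> E (t%:C%C *: v)) ->
  state_affine f -> state_continuous f -> 0 < e ->
  exists2 w, E w & forall phi psi : state, CS phi -> CS psi ->
    `|(f phi - sev phi w) - (f psi - sev psi w)| <= e.
Proof.
move=> Esep E0 ED EZ faff fcont e0.
have [[phi0 phi0S]|noS] := pselect (exists phi : state, CS phi); last first.
  by exists 0 => // phi psi phiS; case: noS; exists phi.
have [s [r [r0 sE fmod]]] := state_modulus Esep fcont e0.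
have flip := affine_modulus faff r0 fmod.
pose N := size s; pose x (i : 'I_N) := nth 0 s i.
pose T (phi : state) : 'rV[C]_N := \row_i (sev phi (x i))%:C%C.
pose K := 2 * e / r.
have K0 : 0 <= K by rewrite divr_ge0 ?mulr_ge0 // ltW.
pose p (y : 'rV[C]_N) := K * \sum_i Normc.normc (y 0 i).
pose P (y : 'rV[C]_N) (c : R) := exists2 t : R, 0 <= t & exists phi psi : state,
  [/\ CS phi, CS psi, y = t%:C%C *: (T phi - T psi) & c = t * (f phi - f psi - e)].
have p_sub : sublinear_on setT p.
  split=> [y z _ _|t y t0 _].
    rewrite /p -mulrDr ler_wpM2l // -big_split /=; apply: ler_sum => i _.
    by rewrite mxE le_normcD.
  rewrite /p mulrCA; congr (_ * _); rewrite mulr_sumr; apply: eq_bigr => i _.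
  by rewrite mxE Normc.normcM normc_real ger0_norm.
(* pairs of states are closed under convex combination, so the scaled
   differences form a cone *)
have mix (t u : R) (phi psi : state) : 0 <= t -> 0 <= u -> CS phi -> CS psi ->
    exists2 chi : state, CS chi & (t + u) * f chi = t * f phi + u * f psi /\
      (t + u)%:C%C *: T chi = t%:C%C *: T phi + u%:C%C *: T psi.
  move=> t0 u0 phiS psiS; have [tu0|tun0] := eqVneq (t + u) 0.
    have [-> ->] : t = 0 /\ u = 0 by split; lra.
    by exists phi => //; rewrite !(addr0, mul0r) !scale0r addr0.
  have tup : 0 < t + u by rewrite lt_def tun0 addr_ge0.
  have h01 : 0 <= t / (t + u) <= 1.
    by rewrite divr_ge0 ?(ltW tup) //= ler_pdivrMr // mul1r lerDl.
  exists ((t / (t + u))%:C%C *: phi + (1 - t / (t + u))%:C%C *: psi).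
    exact: CS_conv.
  rewrite faff //; split; first by field.
  apply/rowP => i; rewrite !mxE sev_affine // -!rmorphM -rmorphD; congr (_%:C%C).
  by field.
have Pcone : convex_cone_on setT P.
  split=> //.
  - by exists 0 => //; exists phi0, phi0; split=> //; rewrite ?mul0r // subrr scaler0.
  - move=> _ _ _ _ [t t0 [a [b [aS bS -> ->]]]] [u u0 [c [d [cS dS -> ->]]]].
    exists (t + u); first exact: addr_ge0.
    have [g gS [gf gT]] := mix t u a c t0 u0 aS cS.
    have [h hS [hf hT]] := mix t u b d t0 u0 bS dS.
    exists g, h; split=> //; first by rewrite !scalerBr gT hT opprD addrACA.
    by rewrite !mulrBr gf hf; ring.
  - move=> u _ _ u0 [t t0 [a [b [aS bS -> ->]]]]; exists (u * t); first exact: mulr_ge0.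
    by exists a, b; split=> //; rewrite ?mulrA // scalerA -rmorphM.
have Pp y c : P y c -> c <= p y.
  move=> [t t0 [a [b [aS bS -> ->]]]]; have [_ ->] // := p_sub.
  rewrite ler_wpM2l // lerBlDl; apply: le_trans (flip _ _ aS bS) _.
  rewrite lerD2l ler_wpM2l // (big_nth 0) big_mkord; apply: ler_sum => i _.
  by rewrite !mxE -rmorphB normc_real.
have Xsub : csubspace (setT : set 'rV[C]_N) by split.
have [F [FD FZ Fp FP]] := hahn_banach_cone Xsub p_sub Pcone Pp.
pose w := \sum_i (Re (F (delta_mx 0 i)))%:C%C *: x i.
have FT phi psi : CS phi -> CS psi -> Re (F (T phi - T psi)) = sev phi w - sev psi w.
  move=> phiS psiS.
  have Fsum (I : finType) (G : I -> 'rV[C]_N) : F (\sum_i G i) = \sum_i F (G i).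
    apply: (big_morph F) => [y z|]; first exact: FD.
    by rewrite -(scale0r 0) FZ // mul0r.
  have sev_sum chi : CS chi -> sev chi w = \sum_i Re (F (delta_mx 0 i)) * sev chi (x i).
    move=> chiS; rewrite /w (big_morph (sev chi) (sevD chiS) (_ : sev chi 0 = 0)).
      by apply: eq_bigr => i _; rewrite sevZ.
    by rewrite -(scale0r 0) -[0 : C]/(0%:C%C) sevZ // mul0r.
  rewrite (row_sum_delta (T phi - T psi)) Fsum !sev_sum // -sumrB raddf_sum.
  apply: eq_bigr => i _; rewrite /= FZ // !mxE -rmorphB Re_realM; ring.
exists w.
  rewrite /w; elim/big_ind: _ => // i _; apply: EZ; apply: sE; exact: mem_nth.
have half phi psi : CS phi -> CS psi -> f phi - f psi - e <= sev phi w - sev psi w.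
  move=> phiS psiS; rewrite -FT //; apply: FP; exists 1 => //.
  by exists phi, psi; split=> //; rewrite ?scale1r ?mul1r.
move=> phi psi phiS psiS; have := half _ _ phiS psiS; have := half _ _ psiS phiS.
rewrite ler_norml; lra.
Qed.

Lemma mnorm_state_bound (d : V) (t : R) : st d = d -> 0 <= t ->
  (forall phi : state, CS phi -> `|sev phi d| <= t) -> mnorm (M1 d) <= 2 * t.
Proof.
move=> ds t0 h; have [h1 h2] := mpos_state_bound ds h.
have -> : d = d + 'i%C *: 0 by rewrite scaler0 addr0.
have := mpos_M1Z t0 (mpos_unit V) => ht.
by apply: mnorm_re_im => //; rewrite ?addr0 ?subr0.
Qed.

(** Kadison's function representation. Approximate [f] uniformly by self-adjoint
    elements, adjusting the constant with the unit; since states norm the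
    self-adjoint elements, the approximants form a Cauchy sequence, and
    completeness supplies the limit. *)
Lemma kadison_representation (f : state -> R) : complete_mou V ->
  state_affine f -> state_continuous f ->
  exists2 a : V, st a = a & forall phi : state, CS phi -> sev phi a = f phi.
Proof.
move=> Vc faff fcont.
have [[phi0 phi0S]|noS] := pselect (exists phi : state, CS phi); last first.
  by exists 0; [exact: star0|move=> phi phiS; case: noS; exists phi].
have approx (k : nat) : {w : V | st w = w /\
    forall phi : state, CS phi -> `|f phi - sev phi w| <= k.+1%:R^-1}.
  apply: cid.
  have k0 : 0 < k.+1%:R^-1 :> R by rewrite invr_gt0 ltr0Sn.
  have [|t v vs|w ws hw] := @affine_approx f [set v | st v = v] (k.+1%:R^-1)
     (@state_ext R V) (star0 V) _ _ faff fcont k0.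
  - by move=> v w /= vs ws; rewrite starD vs ws.
  - by rewrite /= starZr vs.
  exists (w + (f phi0 - sev phi0 w)%:C%C *: one); split.
    by rewrite starD starZr star_unit ws.
  move=> phi phiS; rewrite sevD // sevZ // sev1 // mulr1 opprD addrA.
  exact: hw.
pose w k := sval (approx k).
have ws k : st (w k) = w k by case: (svalP (approx k)).
have wf k phi : CS phi -> `|f phi - sev phi (w k)| <= k.+1%:R^-1.
  by case: (svalP (approx k)) => _; apply.
have inv_small (e : R) : 0 < e -> exists N : nat, forall n, (N <= n)%N -> n.+1%:R^-1 < e.
  move=> e0; have [N _ hN] := near_infty_natSinv_lt (PosNum e0).
  by exists N => n Nn; exact: hN.
have [l hl] : exists l : V, forall e : R, 0 < e -> exists N, forall n, (N <= n)%N ->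
    mnorm (M1 (w n - l)) < e.
  apply: Vc => e e0; have [N hN] := inv_small (e / 5) (divr_gt0 e0 (ltr0n _ 5)).
  exists N => m n Nm Nn; have := hN _ Nm; have := hN _ Nn => h1 h2.
  apply: (@le_lt_trans _ _ (2 * (m.+1%:R^-1 + n.+1%:R^-1))); last first.
    by move: (m.+1%:R^-1) (n.+1%:R^-1) h1 h2 => a b; lra.
  apply: mnorm_state_bound; first by rewrite starB !ws.
    by rewrite addr_ge0 // invr_ge0.
  move=> phi phiS; rewrite sevB //.
  have -> : sev phi (w m) - sev phi (w n) =
     (f phi - sev phi (w n)) - (f phi - sev phi (w m)) by ring.
  by rewrite (le_trans (ler_normB _ _)) // addrC lerD // wf.
exists (reV l); first exact: reV_sa.
move=> phi phiS; have -> : sev phi (reV l) = sev phi l.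
  rewrite [RHS]/sev (sev_reim phiS l).
  by rewrite /= !(mul0r, mul1r, mulr0, subr0, addr0).
apply/eqP; rewrite -subr_eq0 -normr_le0; apply/ler_addgt0Pl => e e0; rewrite addr0.
have [N hN] := hl _ (divr_gt0 e0 (ltr0n _ 2)).
have [M hM] := inv_small _ (divr_gt0 e0 (ltr0n _ 2)).
have h1 := hN _ (leq_maxl N M); have h2 := hM _ (leq_maxr N M).
set n := maxn N M in h1 h2.
have -> : sev phi l - f phi = - (sev phi (w n - l)) - (f phi - sev phi (w n)).
  by rewrite sevB //; ring.
rewrite (le_trans (ler_normB _ _)) // normrN.
have := wf n _ phiS; have := sev_mnorm phiS (w n - l).
by move: (n.+1%:R^-1) h2 h1 => a; lra.
Qed.

End AffineFunctions.

(** * Convex metrics are norms of differences *)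

Section DifferenceNorm.
Variables (R : realType) (X : lmodType R[i]) (K : set X) (d : X -> X -> R).
Local Notation C := R[i].
Hypothesis Kconv : forall x y (t : R), 0 <= t <= 1 -> K x -> K y ->
  K (t%:C%C *: x + (1 - t)%:C%C *: y).
Hypothesis dmetric : metric_on K d.
Hypothesis dconv : convex_metric K d.
Hypothesis dbal : midpoint_balanced K d.
Hypothesis dconc : midpoint_concave K d.

Lemma met_ge0 x y : K x -> K y -> 0 <= d x y.
Proof. by have [h _ _ _] := dmetric; exact: h. Qed.

Lemma met_xx x : K x -> d x x = 0.
Proof. by have [_ h _ _] := dmetric => Kx; apply/(h _ _ Kx Kx). Qed.

Lemma met_sym x y : K x -> K y -> d x y = d y x.
Proof. by have [_ _ h _] := dmetric; exact: h. Qed.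

Lemma dist_sub_eq x y u v : K x -> K y -> K u -> K v ->
  x - u = y - v -> d x u = d y v.
Proof.
move=> Kx Ky Ku Kv xuyv; apply: dbal => //; congr (_ *: _).
by apply/eqP; rewrite -subr_eq -addrA [v - u]addrC addrA xuyv subrK.
Qed.

(** Convexity bounds both pieces of a subdivided segment, and the triangle
    inequality forces equality. *)
Lemma dist_segment x y (t : R) : K x -> K y -> 0 <= t <= 1 ->
  d x (t%:C%C *: y + (1 - t)%:C%C *: x) = t * d x y.
Proof.
move=> Kx Ky t01; have Kz := Kconv t01 Ky Kx; set z := _ + _ in Kz *.
have h1 : d x z <= t * d x y.
  by have := dconv Kx Ky Kx t01; rewrite (met_xx Kx) mulr0 addr0.
have h2 : d y z <= (1 - t) * d x y.
  by have := dconv Ky Ky Kx t01; rewrite (met_xx Ky) mulr0 add0r (met_sym Ky Kx).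
have [_ _ _ tri] := dmetric.
have := tri _ _ _ Kx Kz Ky; rewrite (met_sym Kz Ky); lra.
Qed.

Definition diffs (f : X) : Prop :=
  exists2 t : R, 0 <= t & exists x y, [/\ K x, K y & f = t%:C%C *: (x - y)].

(** Rescale the pair with the smaller factor along its segment, so that both
    differences are equal as vectors; then midpoint balance applies. *)
Lemma dist_scaled x y x' y' (t s : R) : K x -> K y -> K x' -> K y' ->
  0 <= t -> 0 <= s -> t%:C%C *: (x - y) = s%:C%C *: (x' - y') ->
  t * d x y = s * d x' y'.
Proof.
wlog ts : t s x y x' y' / t <= s.
  move=> h Kx Ky Kx' Ky' t0 s0 e; case: (leP t s) => [ts|/ltW st]; first exact: h.
  by symmetry; apply: h.
move=> Kx Ky Kx' Ky' t0 s0 e; have [s00|sn0] := eqVneq s 0.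
  have -> : t = 0 by apply/le_anti; rewrite t0 -{1}s00 ts.
  by rewrite s00 !mul0r.
have sp : 0 < s by rewrite lt_def sn0.
have h01 : 0 <= t / s <= 1 by rewrite divr_ge0 //= ler_pdivrMr // mul1r.
have Kz := Kconv h01 Ky Kx.
have <- : d x ((t / s)%:C%C *: y + (1 - t / s)%:C%C *: x) = d x' y'.
  apply: dist_sub_eq => //.
  have -> : x' - y' = (t / s)%:C%C *: (x - y).
    have sC : (s%:C%C : C) != 0 by rewrite eq_complex /= (negPf sn0).
    by rewrite mulrC rmorphM -scalerA e scalerA -rmorphM mulVf // scale1r.
  rewrite rmorphB rmorph1 scalerBl scale1r scalerBr opprD opprB.
  by rewrite addrC -addrA subrK addrC.
by rewrite dist_segment //; field.
Qed.

(** The common value of [t * d x y] over all representations [t (x - y)] of [f],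
    see [dist_scaled]; it is arbitrary off [diffs]. *)
Definition diffnorm (f : X) : R :=
  xget 0 [set c | exists2 t : R, 0 <= t &
    exists x y, [/\ K x, K y, f = t%:C%C *: (x - y) & c = t * d x y]].

Lemma diffnormE x y (t : R) : K x -> K y -> 0 <= t ->
  diffnorm (t%:C%C *: (x - y)) = t * d x y.
Proof.
move=> Kx Ky t0; rewrite /diffnorm; case: xgetP => [c _ [s s0 [x' [y' [Kx' Ky' e ->]]]]|].
  by symmetry; exact: dist_scaled.
by move=> /(_ (t * d x y)) []; exists t => //; exists x, y.
Qed.

Lemma diffs_sub x y : K x -> K y -> diffs (x - y).
Proof. by move=> Kx Ky; exists 1 => //; exists x, y; rewrite scale1r. Qed.

Lemma diffnorm_sub x y : K x -> K y -> diffnorm (x - y) = d x y.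
Proof.
by move=> Kx Ky; have := diffnormE Kx Ky ler01; rewrite scale1r mul1r.
Qed.

Lemma diffnorm_ge0 f : diffs f -> 0 <= diffnorm f.
Proof. by move=> [t t0 [x [y [Kx Ky ->]]]]; rewrite diffnormE // mulr_ge0 // met_ge0. Qed.

Lemma diffs0 : K !=set0 -> diffs 0.
Proof. by move=> [x Kx]; rewrite -(subrr x); exact: diffs_sub. Qed.

Lemma diffsZ (t : R) f : diffs f -> diffs (t%:C%C *: f).
Proof.
move=> [s s0 [x [y [Kx Ky ->]]]]; case: (leP 0 t) => t0.
  by exists (t * s); [exact: mulr_ge0|exists x, y; rewrite scalerA -rmorphM].
exists (- t * s); first by rewrite mulr_ge0 // oppr_ge0 ltW.
by exists y, x; rewrite scalerA -rmorphM mulNr rmorphN scaleNr -scalerN opprB.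
Qed.

Lemma diffnormZ (t : R) f : diffs f -> diffnorm (t%:C%C *: f) = `|t| * diffnorm f.
Proof.
move=> [s s0 [x [y [Kx Ky ->]]]]; rewrite diffnormE // scalerA -rmorphM.
case: (leP 0 t) => t0; first by rewrite diffnormE ?mulr_ge0 // ger0_norm // mulrA.
have -> : (t * s)%:C%C *: (x - y) = (- t * s)%:C%C *: (y - x).
  by rewrite mulNr rmorphN scaleNr -scalerN opprB.
by rewrite diffnormE ?mulr_ge0 // ?oppr_ge0 ?(ltW t0) // (ltr0_norm t0) mulrA (met_sym Ky Kx).
Qed.

Lemma diffs_rescale x y (t s : R) : K x -> K y -> 0 <= s -> s <= t ->
  exists2 u, K u & s%:C%C *: (x - y) = t%:C%C *: (u - y).
Proof.
move=> Kx Ky s0 st; have t0 := le_trans s0 st.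
have [t00|tn0] := eqVneq t 0.
  have -> : s = 0 by apply/le_anti; rewrite s0 -{1}t00 st.
  by exists y => //; rewrite subrr scaler0 scale0r.
have tp : 0 < t by rewrite lt_def tn0.
have h01 : 0 <= s / t <= 1 by rewrite divr_ge0 //= ler_pdivrMr // mul1r.
exists ((s / t)%:C%C *: x + (1 - s / t)%:C%C *: y); first exact: Kconv.
rewrite rmorphB rmorph1 scalerBl scale1r -addrA (addrAC y) subrr sub0r.
by rewrite -scalerBr scalerA -rmorphM mulrCA mulfV // mulr1.
Qed.

Lemma diffs_common f g : diffs f -> diffs g ->
  exists2 t : R, 0 <= t & exists x y u v, [/\ K x, K y, K u, K v &
    f = t%:C%C *: (x - y) /\ g = t%:C%C *: (u - v)].
Proof.
move=> [t t0 [x [y [Kx Ky ->]]]] [s s0 [u [v [Ku Kv ->]]]].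
have [ts1 ts2] : t <= t + s /\ s <= t + s by lra.
have [z Kz ->] := diffs_rescale Kx Ky t0 ts1.
have [w Kw ->] := diffs_rescale Ku Kv s0 ts2.
by exists (t + s); [exact: addr_ge0|exists z, y, w, v].
Qed.

Lemma midpoint_diff (x y u v : X) :
  x - y + (u - v) = 2%:C%C *: ((2^-1 : C) *: (x + u) - (2^-1 : C) *: (y + v)).
Proof.
rewrite -scalerBr scalerA opprD addrACA.
by rewrite (_ : 2%:C%C * 2^-1 = 1 :> C) ?scale1r // rmorphMn /= mulfV ?pnatr_eq0.
Qed.

Lemma midpoint_mem x y : K x -> K y -> K ((2^-1 : C) *: (x + y)).
Proof.
move=> Kx Ky; have h01 : 0 <= (2^-1 : R) <= 1 by lra.
have := Kconv h01 Kx Ky; rewrite (_ : 1 - 2^-1 = 2^-1 :> R); last by lra.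
by rewrite -scalerDr fmorphV rmorphMn.
Qed.

Lemma diffsD f g : diffs f -> diffs g -> diffs (f + g).
Proof.
move=> Df Dg; have [t t0 [x [y [u [v [Kx Ky Ku Kv [-> ->]]]]]]] := diffs_common Df Dg.
rewrite -scalerDr midpoint_diff scalerA -rmorphM.
exists (t * 2); first by rewrite mulr_ge0.
by do 2!eexists; split; last reflexivity; exact: midpoint_mem.
Qed.

(** Over a common factor a sum of differences is twice a difference of midpoints,
    so midpoint concavity is exactly the triangle inequality. *)
Lemma diffnormD f g : diffs f -> diffs g -> diffnorm (f + g) <= diffnorm f + diffnorm g.
Proof.
move=> Df Dg; have [t t0 [x [y [u [v [Kx Ky Ku Kv [-> ->]]]]]]] := diffs_common Df Dg.
rewrite -scalerDr midpoint_diff scalerA -rmorphM !diffnormE ?mulr_ge0 //;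
  try exact: midpoint_mem.
rewrite -mulrDr -mulrA ler_wpM2l //.
by have := dconc Kx Ky Ku Kv; lra.
Qed.

End DifferenceNorm.

(** * Matricial separation *)

Section MatrixNorms.
Variables (R : realType) (V : matrix_order_unit_space R).
Local Notation C := R[i].
Local Notation Re := complex.Re.
Local Notation Im := complex.Im.
Local Notation st := (@star R V).
Local Notation one := (munit V).
Local Notation state := (V -> 'M[C]_1).
Variable D : forall n, (V -> 'M[C]_n) -> (V -> 'M[C]_n) -> R.
Arguments D : clear implicits.
Hypothesis V_complete : complete_mou V.
Hypothesis D_metric : matrix_metric D.
Hypothesis D_BW : topology_is_BW (fun n phi psi => (D n phi psi)%:E).
Hypothesis D_conv : forall n, convex_metric (@CS R V n) (D n).
Hypothesis D_bal : forall n, midpoint_balanced (@CS R V n) (D n).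
Hypothesis D_conc : forall n, midpoint_concave (@CS R V n) (D n).

Local Notation W n := (diffs (@CS R V n)).
Local Notation L n := (diffnorm (@CS R V n) (D n)).

Let Kconv n (x y : V -> 'M[C]_n) (t : R) : 0 <= t <= 1 -> CS x -> CS y ->
  CS (t%:C%C *: x + (1 - t)%:C%C *: y).
Proof. exact: CS_conv. Qed.

Let Dmet n : metric_on (@CS R V n) (D n).
Proof. by have [h _ _] := D_metric; exact: h. Qed.

Let L_E n x y (t : R) : @CS R V n x -> CS y -> 0 <= t ->
  L n (t%:C%C *: (x - y)) = t * D n x y.
Proof. exact: (diffnormE (@Kconv n) (Dmet n) (@D_conv n) (@D_bal n)). Qed.

Let L_sub n x y : @CS R V n x -> CS y -> L n (x - y) = D n x y.
Proof. exact: (diffnorm_sub (@Kconv n) (Dmet n) (@D_conv n) (@D_bal n)). Qed.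

Let L_D n f g : W n f -> W n g -> L n (f + g) <= L n f + L n g.
Proof. exact: (diffnormD (@Kconv n) (Dmet n) (@D_conv n) (@D_bal n) (@D_conc n)). Qed.

Let L_Z n (t : R) f : W n f -> L n (t%:C%C *: f) = `|t| * L n f.
Proof. exact: (diffnormZ (@Kconv n) (Dmet n) (@D_conv n) (@D_bal n)). Qed.

Let L_ge0 n f : W n f -> 0 <= L n f.
Proof. exact: (diffnorm_ge0 (@Kconv n) (Dmet n) (@D_conv n) (@D_bal n)). Qed.

Let W_D n f g : W n f -> W n g -> W n (f + g).
Proof. exact: (diffsD (@Kconv n)). Qed.

Let W_0 n : @CS R V n !=set0 -> W n 0.
Proof. exact: diffs0. Qed.

Let L_0 n : @CS R V n !=set0 -> L n 0 = 0.
Proof. by move=> h; rewrite -(scale0r 0) -[0 : C]/(0%:C%C) L_Z ?normr0 ?mul0r //; exact: W_0. Qed.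

Lemma diffs_linear n f : W n f -> linear f.
Proof.
move=> [t _ [x [y [xS yS ->]]]] c u v; have := linear_fB (CS_lin xS) (CS_lin yS) c u v.
rewrite !fctE => ->; rewrite scalerDr; congr (_ + _).
by rewrite !scalerA mulrC.
Qed.

Lemma diffs_star n f v : W n f -> f (st v) = (f v)^t*.
Proof.
move=> [t _ [x [y [xS yS ->]]]]; rewrite !fctE !(CS_star v) //.
by rewrite ctrZ ctrD ctrN conj_real.
Qed.

Lemma diffs_dsum m n (f : V -> 'M[C]_m) (g : V -> 'M[C]_n) : W m f -> W n g ->
  W (m + n)%N (state_dsum f g) /\
  L (m + n)%N (state_dsum f g) = Num.max (L m f) (L n g).
Proof.
move=> fW gW.
have {fW gW} [t t0 [x [y [u [v [xS yS [uS vS -> ->]]]]]]] : exists2 t : R, 0 <= t &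
    exists x y u v, [/\ CS x, CS y & [/\ CS u, CS v,
      f = t%:C%C *: (x - y) & g = t%:C%C *: (u - v)]].
  have [t t0 [x [y [xS yS ->]]]] := fW; have [s s0 [u [v [uS vS ->]]]] := gW.
  have [ts1 ts2] : t <= t + s /\ s <= t + s by lra.
  have [z zS ->] := diffs_rescale (@Kconv m) xS yS t0 ts1.
  have [w wS ->] := diffs_rescale (@Kconv n) uS vS s0 ts2.
  by exists (t + s); [exact: addr_ge0|exists z, y, w, v].
have -> : state_dsum (t%:C%C *: (x - y)) (t%:C%C *: (u - v)) =
    t%:C%C *: (state_dsum x u - state_dsum y v).
  apply/funext => w; rewrite !fctE /state_dsum opp_block_mx add_block_mx.
  by rewrite scale_block_mx !(oppr0, addr0, scaler0).
have [xuS yvS] := (CS_dsum xS uS, CS_dsum yS vS).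
split; first by exists t => //; exists (state_dsum x u), (state_dsum y v).
rewrite !L_E //; have [_ Dsum _] := D_metric; rewrite Dsum //.
by rewrite maxr_pMr.
Qed.

(** A contraction [al] is a compression of an isometry [col_mx al b], with
    [b^* b = 1 - al^* al]. *)
Lemma contraction_dilation m n (al : 'M[C]_(m, n)) : opnorm al <= 1 ->
  exists b : 'M[C]_n, al^t* *m al + b^t* *m b = 1%:M.
Proof.
move=> al1; have [|b bE] := @psd_factor R n (1%:M - al^t* *m al).
  apply: psd_rip => [|x]; first by rewrite ctrD ctrN ctr1 ctrM trmxCK.
  rewrite mulmxBl mul1mx -mulmxA.
  have -> : rip x (x - al^t* *m (al *m x)) = sqn x - sqn (al *m x).
    by rewrite /sqn (ripMl al (al *m x) x) [rip (_ *m _) x]ripC /rip -raddfB /= mulmxBr raddfB.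
  rewrite subr_ge0; apply: le_trans (sqn_opnorm _ _) _.
  rewrite -[leRHS]mul1r ler_wpM2r ?sqn_ge0 //.
  by rewrite expr_le1 // opnorm_ge0.
by exists b; rewrite -bE addrC subrK.
Qed.

(** Complete [al] to an isometry and compress by it. The state [chi] that fills
    the second summand of the dilation cancels in differences. *)
Lemma diffs_contract m n (al : 'M[C]_(m, n)) f : @CS R V n !=set0 ->
  opnorm al <= 1 -> W m f ->
  W n (state_compress al f) /\ L n (state_compress al f) <= L m f.
Proof.
move=> [chi chiS] al1 [t t0 [x [y [xS yS ->]]]].
have [b ab1] := contraction_dilation al1; pose g := col_mx al b.
have g1 : g^t* *m g = 1%:M by rewrite /g tr_col_mx map_row_mx mul_row_col.
have E : state_compress al (t%:C%C *: (x - y)) =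
    t%:C%C *: (state_compress g (state_dsum x chi) -
               state_compress g (state_dsum y chi)).
  apply/funext => v; rewrite !fctE /state_compress /state_dsum /g.
  rewrite tr_col_mx map_row_mx !mul_row_block !mulmx0 !addr0 !add0r !mul_row_col.
  rewrite opprD addrACA subrr addr0 -scalemxAr -scalemxAl.
  by rewrite mulmxBr mulmxBl.
have [xcS ycS] := (CS_dsum xS chiS, CS_dsum yS chiS).
have [xcC ycC] := (CS_compress xcS g1, CS_compress ycS g1).
rewrite E !L_E //; split; first by exists t => //; do 2 eexists; split; last reflexivity.
rewrite ler_wpM2l //; have [_ Dsum Dcomp] := D_metric.
apply: le_trans (Dcomp _ _ _ _ _ xcS ycS g1) _; rewrite Dsum //.
by rewrite (met_xx (Dmet n) chiS) ge_max lexx (met_ge0 (Dmet m)).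
Qed.

Lemma diffs_compress m n (al : 'M[C]_(m, n)) f : @CS R V n !=set0 -> W m f ->
  W n (state_compress al f) /\
  L n (state_compress al f) <= opnorm al ^+ 2 * L m f.
Proof.
move=> CSn fW; have [al0|aln0] := eqVneq (opnorm al) 0.
  have -> : state_compress al f = 0.
    apply/funext => v; rewrite (opnorm_eq0 al0) /state_compress mulmx0.
    by apply/matrixP => i j; rewrite !mxE.
  by rewrite L_0 // al0 expr0n mul0r; split=> //; exact: W_0.
have alp : 0 < opnorm al by rewrite lt_def aln0 opnorm_ge0.
pose be := (opnorm al)^-1%:C%C *: al.
have be1 : opnorm be <= 1.
  have ai : 0 <= (opnorm al)^-1 by rewrite invr_ge0 ltW.
  by apply: le_trans (opnormZr al ai) _; rewrite mulVf.
have [hW hL] := diffs_contract CSn be1 fW.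
have -> : state_compress al f = (opnorm al ^+ 2)%:C%C *: state_compress be f.
  apply/funext => v; rewrite fctE /state_compress /be ctrZ conj_real.
  rewrite -!scalemxAl -scalemxAr !scalerA -!rmorphM.
  rewrite -[LHS]scale1r; congr (_ *: _); rewrite -(rmorph1 (real_complex R)).
  by congr (_%:C%C); field.
rewrite L_Z // ger0_norm ?sqr_ge0 //; split; first exact: diffsZ.
by rewrite ler_wpM2l ?sqr_ge0.
Qed.

(** Differences are maps that commute with the involution, a real space; its
    complex span is what the complex Hahn-Banach theorem acts on. *)
Definition cdiffs n (f : V -> 'M[C]_n) : Prop :=
  exists g h, [/\ W n g, W n h & f = g + 'i%C *: h].

Definition repart n (f : V -> 'M[C]_n) : V -> 'M[C]_n :=
  (2^-1 : R)%:C%C *: (f + fun v => (f (st v))^t*).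

Lemma repart_diffs n g h : W n g -> W n h -> repart (g + 'i%C *: h) = g.
Proof.
move=> gW hW; apply/funext => v; rewrite /repart !fctE.
rewrite (diffs_star v gW) (diffs_star v hW) ctrD ctrZ !trmxCK conj_i scaleNr.
by rewrite addrACA subrr addr0 scalerDr -scalerDl half_half scale1r.
Qed.

Lemma diffsN n f : W n f -> W n (- f).
Proof.
by move=> fW; rewrite -scaleN1r -[X in X *: _](rmorphN1 (real_complex R)); exact: diffsZ.
Qed.

Lemma diffs_cdiffs n f : @CS R V n !=set0 -> W n f -> cdiffs f.
Proof. by move=> CSn fW; exists f, 0; rewrite scaler0 addr0; split=> //; exact: W_0. Qed.

Lemma cdiffs_csubspace n : @CS R V n !=set0 -> csubspace (@cdiffs n).
Proof.
move=> CSn; split.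
- exact: diffs_cdiffs (W_0 CSn).
- move=> _ _ [g [h [gW hW ->]]] [g' [h' [gW' hW' ->]]].
  exists (g + g'), (h + h'); split; [exact: W_D|exact: W_D|].
  by rewrite scalerDr addrACA.
- move=> [a b] _ [g [h [gW hW ->]]].
  exists (a%:C%C *: g - b%:C%C *: h), (b%:C%C *: g + a%:C%C *: h); split.
  + by apply: W_D; [exact: diffsZ|apply: diffsN; exact: diffsZ].
  + by apply: W_D; exact: diffsZ.
  apply/funext => v; apply/matrixP => i j; rewrite !fctE !mxE.
  case: (g v i j) => g1 g2; case: (h v i j) => h1 h2.
  by apply/eqP; rewrite eq_complex /=; apply/andP; split; apply/eqP; ring.
Qed.

(** The seminorm to dominate F is [L] of the self-adjoint part: it vanishes on
    [i g] for differences [g], which forces F to be real on differences. *)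
Lemma norming_functional n (f0 : V -> 'M[C]_n) : W n f0 ->
  exists F : (V -> 'M[C]_n) -> C,
  [/\ forall f g, cdiffs f -> cdiffs g -> F (f + g) = F f + F g,
      forall (c : C) f, cdiffs f -> F (c *: f) = c * F f,
      forall g, W n g -> F g = (Re (F g))%:C%C,
      forall g, W n g -> Re (F g) <= L n g &
      Re (F f0) = L n f0].
Proof.
move=> f0W; have CSn : @CS R V n !=set0 by have [t _ [x [y [xS _ _]]]] := f0W; exists x.
have Wsub := cdiffs_csubspace CSn.
pose p (f : V -> 'M[C]_n) := L n (repart f).
have pE g h : W n g -> W n h -> p (g + 'i%C *: h) = L n g.
  by move=> gW hW; rewrite /p repart_diffs.
have p0 g : W n g -> p g = L n g.
  by move=> gW; have := pE g 0 gW (W_0 CSn); rewrite scaler0 addr0.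
have p_sub : sublinear_on (@cdiffs n) p.
  split.
    move=> _ _ [g [h [gW hW ->]]] [g' [h' [gW' hW' ->]]].
    rewrite addrACA -scalerDr !pE //; [exact: L_D|exact: W_D|exact: W_D].
  move=> t _ t0 [g [h [gW hW ->]]].
  rewrite scalerDr scalerA mulrC -scalerA !pE //; try exact: diffsZ.
  by rewrite L_Z // ger0_norm.
have f0c := diffs_cdiffs CSn f0W.
have Pp y s := @ray_le _ _ _ _ f0 y s p_sub f0c.
have [F [FD FZ Fp FP]] := hahn_banach_cone Wsub p_sub (ray_cone (p f0) Wsub f0c) Pp.
have FL g : W n g -> Re (F g) <= L n g.
  by move=> gW; rewrite -p0 //; apply: Fp; exact: diffs_cdiffs.
exists F; split=> //.
- move=> g gW; have gWc := diffs_cdiffs CSn gW.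
  have i0 h : W n h -> Re (F ('i%C *: h)) <= 0.
    move=> hW; have Wih : cdiffs ('i%C *: h).
      by have [_ _ WZ] := Wsub; apply: WZ; exact: diffs_cdiffs.
    apply: le_trans (Fp _ Wih) _; have := pE 0 h (W_0 CSn) hW; rewrite add0r => ->.
    by rewrite L_0.
  have := i0 _ gW; have := i0 _ (diffsN gW).
  rewrite -scaleN1r [_ *: (_ *: g)]scalerA mulrC -scalerA !FZ //; last first.
    by have [_ _ WZ] := Wsub; apply: WZ.
  case: (F g) => a b /=.
  rewrite !(mul0r, mul1r, sub0r, mulN1r, add0r, addr0, opprK, oppr0) => h1 h2.
  by apply/eqP; rewrite eq_complex /= eqxx; apply/eqP/le_anti; lra.
- apply/le_anti; rewrite FL //= -(p0 _ f0W); apply: FP; exact: ray1.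
Qed.

Definition sandwich m n (be ga : 'M[C]_(m, n)) (g : V -> 'M[C]_m) : V -> 'M[C]_n :=
  fun v => be^t* *m g v *m ga.

Lemma quad_add_scale m n (G : 'M[C]_m) (x y : 'M[C]_(m, n)) (c d : C) :
  Num.conj c = d ->
  (x + c *: y)^t* *m G *m (x + c *: y) =
  x^t* *m G *m x + c *: (x^t* *m G *m y) + (d *: (y^t* *m G *m x) +
  (d * c) *: (y^t* *m G *m y)).
Proof.
move=> cd; rewrite ctrD ctrZ cd mulmxDl mulmxDl mulmxDr mulmxDr -scalemxAl -scalemxAl -scalemxAl.
by rewrite -scalemxAr -scalemxAr scalerA.
Qed.

Lemma polarization_sum m n (p x y q A1 A2 A3 A4 : 'M[C]_(m, n)) :
  A1 = p + x + (1 *: y + (1 * 1) *: q) ->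
  A2 = p - x + ((-1) *: y + ((-1) * (-1)) *: q) ->
  A3 = p + 'i%C *: x + ((- 'i%C) *: y + ((- 'i%C) * 'i%C) *: q) ->
  A4 = p - 'i%C *: x + ('i%C *: y + ('i%C * (- 'i%C)) *: q) ->
  x = (4^-1 : R)%:C%C *: (A1 - A2) + 'i%C *: ((4^-1 : R)%:C%C *: (A4 - A3)).
Proof.
move=> -> -> -> ->; apply/matrixP => i j; rewrite !mxE.
case: (p i j) => p1 p2; case: (q i j) => q1 q2.
case: (x i j) => x1 x2; case: (y i j) => y1 y2.
by apply/eqP; rewrite eq_complex /=; apply/andP; split; apply/eqP; field.
Qed.

Lemma polarization m n (G : 'M[C]_m) (be ga : 'M[C]_(m, n)) :
  be^t* *m G *m ga =
    (4^-1 : R)%:C%C *: ((be + ga)^t* *m G *m (be + ga) -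
                        (be - ga)^t* *m G *m (be - ga))
    + 'i%C *: ((4^-1 : R)%:C%C *:
         ((be - 'i%C *: ga)^t* *m G *m (be - 'i%C *: ga) -
          (be + 'i%C *: ga)^t* *m G *m (be + 'i%C *: ga))).
Proof.
have cNi : Num.conj (- 'i%C : C) = 'i%C.
  by apply/eqP; rewrite -[Num.conj _]/(conjc (- 'i%C)) eq_complex /= opprK oppr0 eqxx eqxx.
have e1 := quad_add_scale G be ga (rmorph1 _); rewrite !scale1r in e1.
have e2 := quad_add_scale G be ga (rmorphN1 _).
have e3 := quad_add_scale G be ga (conj_i R).
have e4 := quad_add_scale G be ga cNi.
apply: (@polarization_sum _ _ (be^t* *m G *m be) _ (ga^t* *m G *m be) (ga^t* *m G *m ga)).
- by rewrite e1 mulr1 !scale1r.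
- by move: e2; rewrite scaleN1r [(-1) *: (be^t* *m G *m ga)]scaleN1r.
- exact: e3.
- by move: e4; rewrite scaleNr [(- 'i%C) *: (be^t* *m G *m ga)]scaleNr.
Qed.

Lemma sandwich_polar m n (be ga : 'M[C]_(m, n)) (g : V -> 'M[C]_m) :
  sandwich be ga g =
    (4^-1 : R)%:C%C *: (state_compress (be + ga) g - state_compress (be - ga) g)
    + 'i%C *: ((4^-1 : R)%:C%C *: (state_compress (be - 'i%C *: ga) g -
                                  state_compress (be + 'i%C *: ga) g)).
Proof. by apply/funext => v; exact: polarization. Qed.

Lemma compressD m n (al : 'M[C]_(m, n)) (f g : V -> 'M[C]_m) :
  state_compress al (f + g) = state_compress al f + state_compress al g.
Proof. by apply/funext => v; rewrite /state_compress mulmxDr mulmxDl. Qed.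

Lemma compressZ m n (al : 'M[C]_(m, n)) c (f : V -> 'M[C]_m) :
  state_compress al (c *: f) = c *: state_compress al f.
Proof. by apply/funext => v; rewrite /state_compress -scalemxAr -scalemxAl. Qed.

Lemma cdiffsD n f g : @CS R V n !=set0 -> cdiffs f -> cdiffs g -> @cdiffs n (f + g).
Proof. by move=> /cdiffs_csubspace[_ WD _]; exact: WD. Qed.

Lemma cdiffsZ n c f : @CS R V n !=set0 -> cdiffs f -> @cdiffs n (c *: f).
Proof. by move=> /cdiffs_csubspace[_ _ WZ]; exact: WZ. Qed.

Lemma compress_diffs m n (al : 'M[C]_(m, n)) g : @CS R V n !=set0 -> W m g ->
  W n (state_compress al g).
Proof. by move=> CSn gW; have [] := diffs_compress al CSn gW. Qed.

Lemma diffsB n f g : W n f -> W n g -> W n (f - g).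
Proof. by move=> fW gW; apply: W_D => //; exact: diffsN. Qed.

Lemma sandwich_cdiffs m n (be ga : 'M[C]_(m, n)) g : @CS R V n !=set0 ->
  cdiffs g -> cdiffs (sandwich be ga g).
Proof.
move=> CSn [g1 [g2 [g1W g2W ->]]].
have sW h : W m h -> cdiffs (sandwich be ga h).
  move=> hW; rewrite sandwich_polar; do 2 eexists; split; last reflexivity;
    by apply: diffsZ; apply: diffsB; exact: compress_diffs.
have -> : sandwich be ga (g1 + 'i%C *: g2) =
    sandwich be ga g1 + 'i%C *: sandwich be ga g2.
  by apply/funext => v; rewrite !fctE /sandwich mulmxDr mulmxDl -scalemxAr -scalemxAl.
by apply: cdiffsD => //; [exact: sW|apply: cdiffsZ => //; exact: sW].
Qed.

(** As the two topologies agree, a D-ball of states contains a neighbourhood for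
    pointwise convergence, on which [f] varies little. *)
Lemma lipschitz_state_continuous (f : state -> R) (c : R) : 0 <= c ->
  (forall phi psi : state, CS phi -> CS psi -> `|f phi - f psi| <= c * D 1%N phi psi) ->
  state_continuous f.
Proof.
move=> c0 flip phi phiS d d0; have c1 : 0 < c + 1 by lra.
have [Dge0 Deq Dsym Dtri] := Dmet 1.
pose r := d / (c + 1); have r0 : 0 < r by rewrite divr_gt0.
pose U := [set psi : state | CS psi /\ D 1%N phi psi < r].
have UBW : BW_open U.
  apply/D_BW; split=> [psi []//|psi [psiS psir]].
  exists (r - D 1%N phi psi); first by rewrite subr_gt0.
  move=> chi chiS; rewrite lte_fin => h; split=> //.
  by apply: le_lt_trans (Dtri _ _ _ phiS psiS chiS) _; rewrite -ltrBrDl.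
have Uphi : U phi by split=> //; rewrite (met_xx (Dmet 1)).
have [_ /(_ _ Uphi)[s [e e0 hs]]] := UBW.
exists ([seq reV v | v <- s] ++ [seq imV v | v <- s]), (e / 3).
split; first by rewrite divr_gt0.
move=> psi psiS hpsi; have [_ psir] : U psi.
  apply: hs => // v vs.
  have h1 := hpsi (reV v); rewrite mem_cat map_f // in h1; have {}h1 := h1 isT.
  have h2 := hpsi (imV v); rewrite mem_cat orbC map_f // in h2; have {}h2 := h2 isT.
  have opn (A : 'M[C]_1) : opnorm A <= Normc.normc (A ord0 ord0).
    apply: opnorm_le => [|x]; first exact: normc_ge0.
    by rewrite [A]mx11_scalar mul_scalar_mx hnormZc mxE eqxx mulr1n.
  apply: le_lt_trans (opn _) _; rewrite !mxE (sev_reim phiS) (sev_reim psiS).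
  set a := sev psi (reV v) in h1 *; set b := sev phi (reV v) in h1 *.
  set p := sev psi (imV v) in h2 *; set q := sev phi (imV v) in h2 *.
  have -> : a%:C%C + 'i%C * p%:C%C - (b%:C%C + 'i%C * q%:C%C) =
     (a - b)%:C%C + 'i%C * (p - q)%:C%C :> C.
    by apply/eqP; rewrite eq_complex /=; apply/andP; split; apply/eqP; ring.
  apply: le_lt_trans (le_normcD _ _) _; rewrite Normc.normcM.
  have ni : Normc.normc ('i%C : C) = 1 by rewrite /= expr0n add0r expr1n sqrtr1.
  rewrite !normc_real ni mul1r; lra.
apply: le_lt_trans (flip _ _ psiS phiS) _; rewrite Dsym //.
have [->|cn0] := eqVneq c 0; first by rewrite mul0r.
have cp : 0 < c by rewrite lt_def cn0.
apply: (@lt_le_trans _ _ (c * r)); first by rewrite ltr_pM2l.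
by rewrite /r mulrCA ler_piMr ?(ltW d0) // ler_pdivrMr // mul1r; lra.
Qed.

Section Representation.
Variables (n : nat) (F : (V -> 'M[C]_n) -> C).
Hypothesis CSn : @CS R V n !=set0.
Hypothesis CS1 : @CS R V 1 !=set0.
Hypothesis F_D : forall f g, cdiffs f -> cdiffs g -> F (f + g) = F f + F g.
Hypothesis F_Z : forall (c : C) f, cdiffs f -> F (c *: f) = c * F f.
Hypothesis F_real : forall g, W n g -> F g = (Re (F g))%:C%C.
Hypothesis F_le : forall g, W n g -> Re (F g) <= L n g.

Lemma F_N f : cdiffs f -> F (- f) = - F f.
Proof. by move=> fW; rewrite -(scaleN1r f) F_Z // mulN1r. Qed.

Lemma F_abs g : W n g -> `|Re (F g)| <= L n g.
Proof.
move=> gW; rewrite ler_norml F_le // andbT lerNl.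
have := F_le (diffsN gW); rewrite F_N ?ReN; last exact: diffs_cdiffs.
rewrite -(scaleN1r g) -[X in X *: _](rmorphN1 (real_complex R)) L_Z // normrN1 mul1r.
by [].
Qed.

(** The function [phi |-> F (ga^* phi ga)], normalised by a base state [chi], is
    affine and, F being bounded by the norm L, Lipschitz for D; so it is
    continuous and Kadison's representation applies. *)
Lemma compress_representation (ga : 'M[C]_(1, n)) : exists a : V,
  forall phi psi : state, CS phi -> CS psi ->
  F (state_compress ga (phi - psi)) = phi a ord0 ord0 - psi a ord0 ord0.
Proof.
have [chi chiS] := CS1.
have gW phi psi : CS phi -> CS psi -> W n (state_compress ga (phi - psi)).
  by move=> phiS psiS; apply: compress_diffs => //; exact: diffs_sub.
pose f (phi : state) := Re (F (state_compress ga (phi - chi))).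
have gC phi psi (phiS : CS phi) (psiS : CS psi) := diffs_cdiffs CSn (gW _ _ phiS psiS).
have fB phi psi : CS phi -> CS psi -> f phi - f psi = Re (F (state_compress ga (phi - psi))).
  move=> phiS psiS; rewrite /f.
  have -> : phi - chi = (phi - psi) + (psi - chi) by rewrite addrA subrK.
  by rewrite compressD (F_D (gC _ _ phiS psiS) (gC _ _ psiS chiS)) ReD addrK.
have faff : state_affine f.
  move=> phi psi t phiS psiS t01; rewrite /f.
  have -> : t%:C%C *: phi + (1 - t)%:C%C *: psi - chi =
      t%:C%C *: (phi - chi) + (1 - t)%:C%C *: (psi - chi).
    by rewrite !scalerBr addrACA -opprD -scalerDl -rmorphD (addrC t) subrK scale1r.
  have phiW := gC _ _ phiS chiS; have psiW := gC _ _ psiS chiS.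
  have -> : state_compress ga (t%:C%C *: (phi - chi) + (1 - t)%:C%C *: (psi - chi)) =
      t%:C%C *: state_compress ga (phi - chi) + (1 - t)%:C%C *: state_compress ga (psi - chi).
    exact: etrans (compressD _ _ _) (congr2 +%R (compressZ _ _ _) (compressZ _ _ _)).
  rewrite (etrans (F_D (cdiffsZ t%:C%C CSn phiW) (cdiffsZ (1 - t)%:C%C CSn psiW))
    (congr2 +%R (F_Z t%:C%C phiW) (F_Z (1 - t)%:C%C psiW))).
  by rewrite ReD !Re_realM.
have fcont : state_continuous f.
  apply: (@lipschitz_state_continuous f (opnorm ga ^+ 2)); first exact: sqr_ge0.
  move=> phi psi phiS psiS; rewrite fB // (le_trans (F_abs (gW _ _ phiS psiS))) //.
  by rewrite -(L_sub phiS psiS); have [] := diffs_compress ga CSn (diffs_sub phiS psiS).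
have [a asa fa] := kadison_representation V_complete faff fcont.
exists a => phi psi phiS psiS; rewrite F_real; last exact: gW.
by rewrite -fB // -!fa // (sev_saE phiS asa) (sev_saE psiS asa) -rmorphB.
Qed.

(** By polarisation, from the case [be = ga]. *)
Lemma sandwich_representation (be ga : 'M[C]_(1, n)) : exists a : V,
  forall h : V -> 'M[C]_1, cdiffs h -> F (sandwich be ga h) = h a ord0 ord0.
Proof.
have [a1 h1] := compress_representation (be + ga).
have [a2 h2] := compress_representation (be - ga).
have [a3 h3] := compress_representation (be - 'i%C *: ga).
have [a4 h4] := compress_representation (be + 'i%C *: ga).
pose q : C := (4^-1 : R)%:C%C.
exists (q *: (a1 - a2) + 'i%C *: (q *: (a3 - a4))).
set a := _ + _.
have sub phi psi : CS phi -> CS psi ->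
    F (sandwich be ga (phi - psi)) = (phi - psi) a ord0 ord0.
  move=> phiS psiS; have gW c := compress_diffs c CSn (diffs_sub phiS psiS).
  have gC c := diffs_cdiffs CSn (gW c).
  have gB (c d : 'M[C]_(1, n)) : cdiffs (state_compress c (phi - psi) - state_compress d (phi - psi)).
    by apply: diffs_cdiffs => //; apply: diffsB; exact: gW.
  have FB c d : F (state_compress c (phi - psi) - state_compress d (phi - psi)) =
      F (state_compress c (phi - psi)) - F (state_compress d (phi - psi)).
    by rewrite F_D ?F_N //; apply: diffs_cdiffs => //; apply: diffsN; exact: gW.
  have gQ c d := cdiffsZ q CSn (gB c d); have giQ c d := cdiffsZ 'i%C CSn (gQ c d).
  have FQ c d : F (q *: (state_compress c (phi - psi) - state_compress d (phi - psi))) =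
      q * (F (state_compress c (phi - psi)) - F (state_compress d (phi - psi))).
    exact: etrans (F_Z q (gB c d)) (congr1 _ (FB c d)).
  rewrite sandwich_polar -/q (etrans (F_D (gQ _ _) (giQ _ _))
    (congr2 +%R (FQ _ _) (etrans (F_Z 'i%C (gQ _ _)) (congr1 _ (FQ _ _))))).
  rewrite (h1 _ _ phiS psiS) (h2 _ _ phiS psiS) (h3 _ _ phiS psiS) (h4 _ _ phiS psiS).
  have lE chi : CS chi -> chi a ord0 ord0 = q * (chi a1 ord0 ord0 - chi a2 ord0 ord0)
      + 'i%C * (q * (chi a3 ord0 ord0 - chi a4 ord0 ord0)).
    move=> chiS; have cl := CS_lin chiS.
    by rewrite /a (linD cl) !(linZ cl) !(linB cl) !mxE.
  have -> : (phi - psi) a ord0 ord0 = phi a ord0 ord0 - psi a ord0 ord0.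
    by rewrite !fctE mxE [X in _ + X]mxE.
  by rewrite !lE // /q; ring.
have subW h : W 1%N h -> F (sandwich be ga h) = h a ord0 ord0.
  move=> [t t0 [phi [psi [phiS psiS ->]]]].
  have -> : sandwich be ga (t%:C%C *: (phi - psi)) = t%:C%C *: sandwich be ga (phi - psi).
    by apply/funext => v; rewrite !fctE /sandwich -scalemxAr -scalemxAl.
  rewrite F_Z ?sub // ?fctE ?mxE //.
  by apply: sandwich_cdiffs => //; apply: diffs_cdiffs => //; exact: diffs_sub.
move=> _ [g1 [g2 [g1W g2W ->]]].
have sW h : W 1%N h -> cdiffs (sandwich be ga h).
  by move=> hW; apply: sandwich_cdiffs => //; exact: diffs_cdiffs.
have -> : sandwich be ga (g1 + 'i%C *: g2) =
    sandwich be ga g1 + 'i%C *: sandwich be ga g2.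
  by apply/funext => v; rewrite !fctE /sandwich mulmxDr mulmxDl -scalemxAr -scalemxAl.
rewrite F_D ?F_Z ?subW //; [by rewrite !fctE !mxE|exact: sW|exact: sW|].
by apply: cdiffsZ => //; exact: sW.
Qed.

Lemma F_sum (I : Type) (s : seq I) (G : I -> V -> 'M[C]_n) :
  (forall i, cdiffs (G i)) ->
  cdiffs (\sum_(i <- s) G i) /\ F (\sum_(i <- s) G i) = \sum_(i <- s) F (G i).
Proof.
move=> GW; have F0 : F 0 = 0.
  by rewrite -(scale0r (0 : V -> 'M[C]_n)) F_Z ?mul0r //; apply: diffs_cdiffs => //; exact: W_0.
elim: s => [|i s [IH1 IH2]].
  by rewrite !big_nil; split=> //; apply: diffs_cdiffs => //; exact: W_0.
by rewrite !big_cons; split; [exact: cdiffsD|rewrite F_D ?IH2].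
Qed.

(** The functionals [g |-> F (e_i^* g e_j)] on level 1 are represented by elements
    of V, which are the entries of the matrix. Thus F comes from V itself and not
    merely from its bidual. *)
Lemma functional_matrix : exists a : 'M[V]_n, forall f, W n f ->
  F f = \tr (papp f a 1%:M).
Proof.
pose e i : 'M[C]_(1, n) := delta_mx 0 i.
have ex i j : {a : V | forall h : V -> 'M[C]_1, cdiffs h ->
    F (sandwich (e i) (e j) h) = h a ord0 ord0}.
  by apply: cid; exact: sandwich_representation.
exists (\matrix_(i, j) sval (ex i j)) => f fW.
pose h i j : V -> 'M[C]_1 := sandwich (delta_mx i 0) (delta_mx j 0) f.
have hE i j v : h i j v ord0 ord0 = f v i j.
  rewrite /h /sandwich -mulmxA -colE.
  by rewrite ctr_delta -rowE !mxE.
have hW i j : cdiffs (h i j).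
  by apply: sandwich_cdiffs => //; exact: diffs_cdiffs.
have fE : f = \sum_i \sum_j sandwich (e i) (e j) (h i j).
  apply/funext => v; apply/matrixP => p q.
  have sE (I : Type) (s : seq I) (G : I -> V -> 'M[C]_n) : (\sum_(i <- s) G i) v = \sum_(i <- s) G i v.
    by elim: s => [|x s IH]; rewrite ?big_nil // !big_cons fctE IH.
  rewrite sE summxE.
  under eq_bigr => i _.
    rewrite sE summxE.
    under eq_bigr => j _.
      rewrite /sandwich [h i j v]mx11_scalar hE mul_mx_scalar -scalemxAl mxE.
      rewrite mxE big_ord1 ctrE !mxE eqxx /=.
      over.
    over.
  rewrite (bigD1 p) //= (bigD1 q) //= !eqxx rmorph1 !mulr1.
  rewrite big1 => [|j jq]; last by rewrite eq_sym (negPf jq) !mulr0.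
  rewrite big1 => [|i ip]; first by rewrite !addr0.
  by rewrite big1 // => j _; rewrite eq_sym (negPf ip) rmorph0 mul0r mulr0.
have sW i j : cdiffs (sandwich (e i) (e j) (h i j)) by exact: sandwich_cdiffs.
rewrite {1}fE (F_sum _ (fun i => (F_sum _ (sW i)).1)).2.
rewrite /mxtrace; apply: eq_bigr => i _; rewrite (F_sum _ (sW i)).2 mxE.
apply: eq_bigr => j _; rewrite mulmx1 (svalP (ex i j)) // hE mxE.
by [].
Qed.

Lemma dsum_diffs k m (f : V -> 'M[C]_k) (g : V -> 'M[C]_m) : W k f -> W m g ->
  L k f <= 1 -> L m g <= 1 ->
  W (k + m)%N (state_dsum f g) /\ L (k + m)%N (state_dsum f g) <= 1.
Proof.
move=> fW gW f1 g1; have [h ->] := diffs_dsum fW gW; split=> //.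
by rewrite ge_max f1.
Qed.

(** The pairs [(al^* al, F (al^* f al))] with [L f <= 1], over all levels, form a
    convex cone: a sum of two is the pair of a direct sum of the [f] and of the
    column of the [al]. By the contractivity of L the second component is at
    most [opnorm (al^* al)], so one functional on the scalar matrices dominates
    F on all levels at once. *)
Lemma dominating_functional : exists l : 'M[C]_n -> C,
  [/\ forall h h', l (h + h') = l h + l h',
      forall c h, l (c *: h) = c * l h,
      forall h, Re (l h) <= opnorm h &
      forall k (f : V -> 'M[C]_k) (al : 'M[C]_(k, n)), W k f -> L k f <= 1 ->
        Re (F (state_compress al f)) <= Re (l (al^t* *m al))].
Proof.
pose P (h : 'M[C]_n) (s : R) := exists k (f : V -> 'M[C]_k) (al : 'M[C]_(k, n)),
  [/\ W k f, L k f <= 1, h = al^t* *m al & s = Re (F (state_compress al f))].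
have op_sub : sublinear_on setT (@opnorm R n n).
  split=> [x y _ _|t x t0 _]; first exact: opnormD.
  apply/le_anti; rewrite opnormZr //=; have [->|tn0] := eqVneq t 0.
    by rewrite mul0r opnorm_ge0.
  have tp : 0 < t by rewrite lt_def tn0.
  rewrite -ler_pdivlMl //; have := @opnormZr R n n t^-1 (t%:C%C *: x).
  rewrite invr_ge0 scalerA -rmorphM mulVf // rmorph1 scale1r; exact.
(* half of the C*-identity *)
have op_sq k (al : 'M[C]_(k, n)) : opnorm al ^+ 2 <= opnorm (al^t* *m al).
  have c0 := opnorm_ge0 (al^t* *m al).
  rewrite -[leRHS]sqr_sqrtr // ler_pXn2r ?nnegrE ?opnorm_ge0 ?sqrtr_ge0 //.
  apply: opnorm_le_sqn => [|x]; first exact: sqrtr_ge0.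
  rewrite sqr_sqrtr // /sqn ripMl mulmxA ripC; apply: le_trans (ler_rip _ _) _.
  by rewrite -/(sqn x) -sqr_hnorm expr2 mulrCA ler_wpM2l ?hnorm_ge0 ?opnormP.
have F0 : F 0 = 0.
  by rewrite -(scale0r (0 : V -> 'M[C]_n)) F_Z ?mul0r //; apply: diffs_cdiffs => //; exact: W_0.
have FC k (f : V -> 'M[C]_k) (al : 'M[C]_(k, n)) : W k f -> cdiffs (state_compress al f).
  by move=> fW; apply: diffs_cdiffs => //; exact: compress_diffs.
have Pcone : convex_cone_on setT P.
  split=> //.
  - exists n, 0, 0; split.
    + exact: W_0.
    + by rewrite L_0 // ler01.
    + by rewrite mulmx0.
    + have -> : state_compress (0 : 'M[C]_n) (0 : V -> 'M[C]_n) = 0.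
        by apply/funext => v; rewrite /state_compress mulmx0.
      by rewrite F0.
  - move=> _ _ _ _ [k [f [al [fW f1 -> ->]]]] [m [g [be [gW g1 -> ->]]]].
    have [fgW fg1] := dsum_diffs fW gW f1 g1.
    exists (k + m)%N, (state_dsum f g), (col_mx al be); split=> //.
      by rewrite tr_col_mx map_row_mx mul_row_col.
    have -> : state_compress (col_mx al be) (state_dsum f g) =
        state_compress al f + state_compress be g.
      apply/funext => v; rewrite !fctE /state_compress /state_dsum.
      by rewrite tr_col_mx map_row_mx mul_row_block !mulmx0 addr0 add0r mul_row_col.
    by rewrite F_D ?ReD //; exact: FC.
  - move=> t _ _ t0 [k [f [al [fW f1 -> ->]]]].
    exists k, f, ((Num.sqrt t)%:C%C *: al); split=> //.
      rewrite ctrZ conj_real -scalemxAl -scalemxAr scalerA -rmorphM -expr2.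
      by rewrite sqr_sqrtr.
    have -> : state_compress ((Num.sqrt t)%:C%C *: al) f = t%:C%C *: state_compress al f.
      apply/funext => v; rewrite !fctE /state_compress ctrZ conj_real.
      by rewrite -!scalemxAl -scalemxAr scalerA -rmorphM -expr2 sqr_sqrtr.
    by rewrite F_Z ?Re_realM //; exact: FC.
have Pp h s : P h s -> s <= opnorm h.
  move=> [k [f [al [fW f1 -> ->]]]]; apply: le_trans (op_sq _ _).
  have [cW cL] := diffs_compress al CSn fW.
  apply: le_trans (F_le cW) _; apply: le_trans cL _.
  by rewrite -[leRHS]mulr1 ler_wpM2l ?sqr_ge0.
have Msub : csubspace (setT : set 'M[C]_n) by split.
have [l [lD lZ lp lP]] := hahn_banach_cone Msub op_sub Pcone Pp.
exists l; split=> [h h'|c h|h|k f al fW f1]; first exact: lD.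
- exact: lZ.
- exact: lp.
- by apply: lP; exists k, f, al.
Qed.

End Representation.

Lemma Re_trace_ctr n (A G : 'M[C]_n) : G^t* = G ->
  Re (\tr (A^t* *m G)) = Re (\tr (A *m G)).
Proof.
move=> Gh; rewrite -[LHS]complexRe_conj -trace_adj ctrM trmxCK Gh.
by rewrite mxtrace_mulC.
Qed.

(** The Gram form [al |-> l (al^* al) + e |al|^2] of a positive functional is
    definite thanks to the summand with [e]; a change of variables [th] turns it
    into the Hilbert-Schmidt norm. *)
Lemma gram_normalise n (l : 'M[C]_n -> C) (e : R) : 0 < e ->
  (forall h h', l (h + h') = l h + l h') -> (forall c h, l (c *: h) = c * l h) ->
  (forall al : 'M[C]_(1, n), 0 <= Re (l (al^t* *m al))) ->
  exists2 th : 'M[C]_n, th \in unitmx & forall k (X : 'M[C]_(k, n)),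
    Re (l ((X *m th^t*)^t* *m (X *m th^t*))) + e * sqn (X *m th^t*) = sqn X.
Proof.
move=> e0 lD lZ lpos.
pose rho0 : 'M[C]_n := \matrix_(i, j) l (delta_mx j i).
have l_tr h : l h = \tr (rho0 *m h).
  have l0 : l 0 = 0 by rewrite -(scale0r 0) lZ mul0r.
  have lsum (I : finType) (G : I -> 'M[C]_n) : l (\sum_i G i) = \sum_i l (G i).
    exact: (big_morph l lD l0).
  transitivity (\sum_i \sum_j h i j * l (delta_mx i j)).
    rewrite {1}(matrix_sum_delta h) lsum; apply: eq_bigr => i _.
    by rewrite lsum; apply: eq_bigr => j _; rewrite lZ.
  rewrite exchange_big; apply: eq_bigr => j _; rewrite mxE.
  by apply: eq_bigr => i _; rewrite !mxE mulrC.
pose rho : 'M[C]_n := (2^-1 : R)%:C%C *: (rho0 + rho0^t*) + e%:C%C%:M.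
have rho_herm : rho^t* = rho.
  rewrite /rho ctrD ctrZ ctrD trmxCK conj_real [_^t* + _]addrC; congr (_ + _).
  by rewrite -scalemx1 ctrZ ctr1 conj_real.
have rhoE k (al : 'M[C]_(k, n)) :
    Re (\tr (rho *m (al^t* *m al))) = Re (l (al^t* *m al)) + e * sqn al.
  set G := al^t* *m al; have Gh : G^t* = G by rewrite /G ctrM trmxCK.
  rewrite mulmxDl mxtraceD ReD mul_scalar_mx mxtraceZ Re_realM; congr (_ + _).
  rewrite -scalemxAl mxtraceZ Re_realM mulmxDl mxtraceD ReD.
  rewrite [X in _ * X](_ : _ = Re (l G) + Re (l G)).
    by move: (Re (l G)) => r; lra.
  by rewrite l_tr; congr (_ + _); exact: Re_trace_ctr.
have rho_ge (x : 'cV[C]_n) : e * sqn x <= rip x (rho *m x).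
  have -> : rip x (rho *m x) = Re (\tr (rho *m (x *m x^t*))).
    by rewrite /rip mxtrace_mulC mulmxA.
  have := rhoE _ (x^t*); rewrite trmxCK => ->.
  have -> : sqn (x^t*) = sqn x by rewrite /sqn /rip trmxCK mxtrace_mulC.
  by rewrite lerDr; have := lpos (x^t*); rewrite trmxCK.
have [|S SE] := @psd_factor R n rho.
  by apply: psd_rip => // x; apply: le_trans (rho_ge x); rewrite mulr_ge0 ?sqn_ge0 // ltW.
have Su : S \in unitmx.
  rewrite unitmxE unitfE -det_tr; apply/negP => /det0P[v vn0 vS].
  have Sv : S *m v^T = 0 by rewrite -[S]trmxK -trmx_mul vS trmx0.
  have := rho_ge v^T; rewrite SE -mulmxA Sv mulmx0 /rip mulmx0 mxtrace0.
  rewrite /= pmulr_rle0 // => h; have /sqn_eq0 v0 : sqn v^T = 0.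
    by apply/le_anti; rewrite h sqn_ge0.
  by move: vn0; rewrite -[v]trmxK v0 trmx0 eqxx.
exists (invmx S); first by rewrite unitmx_inv.
move=> k X; rewrite -rhoE; set al := X *m _.
have alS : al *m S^t* = X by rewrite /al -mulmxA -ctrM mulmxV // ctr1 mulmx1.
clearbody al.
have -> : \tr (rho *m (al^t* *m al)) = \tr ((al *m S^t*)^t* *m (al *m S^t*)).
  by rewrite SE ctrM trmxCK mxtrace_mulC !mulmxA mxtrace_mulC !mulmxA.
by rewrite alS.
Qed.

(** The matricial separation of Effros and Winkler. Let F norm [f0], let the
    matrix [a] represent F, and let [l] dominate it. The twist [b] of [a] by
    the normalisation [th] of [l] has [F (al^* f al)], with [al = X th^*], as the
    quadratic form of [<<f, b>>] at [X]; the domination by [l] then reads as the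
    bound [L f] on the operator norm. Conversely [X = (th^-1)^*] gives
    [F f0 = L f0], and its norm is at most [1 + e] because [l 1 <= 1]. *)
Lemma separation_diffs n (f0 : V -> 'M[C]_n) (e : R) : @CS R V 1 !=set0 ->
  W n f0 -> 0 < e ->
  exists2 b : 'M[V]_n, forall k (f : V -> 'M[C]_k), W k f -> opnorm (pairing f b) <= L k f &
    L n f0 <= (1 + e) * opnorm (pairing f0 b).
Proof.
move=> CS1 f0W e0.
have CSn : @CS R V n !=set0 by have [t _ [x [y [xS _ _]]]] := f0W; exists x.
have [F [FD FZ Freal Fle Ff0]] := norming_functional f0W.
have [a aF] := functional_matrix CSn CS1 FD FZ Freal Fle.
have [l [lD lZ lop lF]] := dominating_functional CSn FD FZ Fle.
have FC k (f : V -> 'M[C]_k) (al : 'M[C]_(k, n)) : W k f ->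
    F (state_compress al f) = \tr (al^t* *m papp f a al).
  by move=> fW; rewrite aF ?papp_compress ?mulmx1 //; exact: compress_diffs.
have F0 : F 0 = 0.
  by rewrite -(scale0r (0 : V -> 'M[C]_n)) FZ ?mul0r //; apply: diffs_cdiffs => //; exact: W_0.
have lpos (al : 'M[C]_(1, n)) : 0 <= Re (l (al^t* *m al)).
  have := lF _ 0 al (W_0 CS1); rewrite L_0 // => /(_ ler01).
  have -> : state_compress al (0 : V -> 'M[C]_1) = 0.
    by apply/funext => v; rewrite /state_compress mulmx0 mul0mx.
  by rewrite F0.
(* summing d over the n diagonal entries of 1%:M costs at most e *)
pose d := e / n.+1%:R; have d0 : 0 < d by rewrite divr_gt0.
have [th thu thE] := gram_normalise d0 lD lZ lpos.
pose b := mact th^T a (th^t*)^T.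
have bE k (f : V -> 'M[C]_k) X : W k f ->
    \tr (X^t* *m papp f b X) = F (state_compress (X *m th^t*) f).
  move=> fW; rewrite FC // papp_mact; last exact: diffs_linear.
  by rewrite !trmxK mulmxA mxtrace_mulC ctrM trmxCK mulmxA.
have bound k (f : V -> 'M[C]_k) (c : R) X : W k f -> 0 < c -> L k f <= c ->
    Re (\tr (X^t* *m papp f b X)) <= c * sqn X.
  move=> fW c0 fc; have gW : W k (c^-1%:C%C *: f) by exact: diffsZ.
  have g1 : L k (c^-1%:C%C *: f) <= 1.
    by rewrite L_Z // gtr0_norm ?invr_gt0 // mulrC ler_pdivrMr // mul1r.
  have := lF _ _ (X *m th^t*) gW g1.
  have -> : state_compress (X *m th^t*) (c^-1%:C%C *: f) =
      c^-1%:C%C *: state_compress (X *m th^t*) f.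
    by apply/funext => v; rewrite !fctE /state_compress -scalemxAr -scalemxAl.
  rewrite FZ; last by apply: diffs_cdiffs => //; exact: compress_diffs.
  rewrite Re_realM bE // ler_pdivrMl // => /le_trans; apply.
  by rewrite ler_wpM2l ?(ltW c0) // -(thE _ X) lerDl mulr_ge0 ?sqn_ge0 // ltW.
have b_real k (f : V -> 'M[C]_k) X : W k f -> Im (\tr (X^t* *m papp f b X)) = 0.
  by move=> fW; rewrite bE // Freal //; exact: compress_diffs.
have quadE k (f : V -> 'M[C]_k) (x : 'cV[C]_(n * k)) :
   rip x (pairing f b *m x) = Re (\tr ((tomx x)^t* *m papp f b (tomx x))).
  by rewrite rip_pairing.
exists b => [k f fW|].
  apply/ler_addgt0Pr => c c0.
  have Lc : 0 < L k f + c by rewrite ltr_wpDl ?L_ge0.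
  apply: opnorm_herm; first exact: ltW.
    by apply: herm_of_real_quad => x; rewrite quad_pairing; exact: b_real.
  move=> x; rewrite ler_norml -sqn_tomx quadE bound ?lerDl ?(ltW c0) // andbT.
  have := bound _ _ _ (tomx x) (diffsN fW) Lc.
  have -> : L k (- f) = L k f.
    by rewrite -(scaleN1r f) -[X in X *: _](rmorphN1 (real_complex R)) L_Z // normrN1 mul1r.
  have -> : papp (- f) b (tomx x) = - papp f b (tomx x).
    apply/matrixP => i j; rewrite [LHS]mxE [RHS]mxE [in RHS]mxE -sumrN.
    by apply: eq_bigr => q _; rewrite fctE mulNmx mxE.
  rewrite mulmxN raddfN ReN lerDl (ltW c0) => /(_ isT); rewrite lerNl.
  by [].
pose X := (invmx th)^t*; have Xth : X *m th^t* = 1%:M by rewrite -ctrM mulmxV // ctr1.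
have sX : sqn X <= 1 + e.
  rewrite -(thE _ X) Xth ctr1 mulmx1; have := lop 1%:M.
  have o1 : opnorm (1%:M : 'M[C]_n) <= 1.
    by apply: opnorm_le => // x; rewrite mul1mx mul1r.
  have -> : sqn (1%:M : 'M[C]_n) = n%:R.
    by rewrite /sqn /rip ctr1 mulmx1 mxtrace1 -(rmorph_nat (real_complex R)).
  have : d * n%:R <= e.
    by rewrite /d mulrAC ler_pdivrMr // ler_wpM2l ?(ltW e0) // ler_nat.
  by move=> h1 h2; lra.
have : L n f0 <= opnorm (pairing f0 b) * sqn X.
  have <- : rip X (papp f0 b X) = L n f0.
    rewrite /rip bE // Xth -Ff0; congr (Re (F _)); apply/funext => v.
    by rewrite /state_compress ctr1 mul1mx mulmx1.
  apply: le_trans (ler_rip _ _) _; rewrite -sqr_hnorm expr2 mulrCA.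
  by rewrite ler_wpM2l ?hnorm_ge0 // hnorm_papp.
by move/le_trans; apply; rewrite mulrC ler_wpM2r ?opnorm_ge0.
Qed.

Lemma CS1_nonempty n (phi : V -> 'M[C]_n.+1) : CS phi -> @CS R V 1 !=set0.
Proof.
move=> phiS; exists (state_compress (delta_mx ord0 0) phi); apply: CS_compress => //.
by rewrite ctr_delta mul_delta_mx; apply/matrixP => i j; rewrite !mxE !ord1.
Qed.

(** In size 0 the distance vanishes; in positive size a compression by a unit
    vector provides the state that [separation_diffs] asks for. *)
Theorem separation n (phi0 psi0 : V -> 'M[C]_n) (e : R) :
  CS phi0 -> CS psi0 -> 0 < e ->
  exists2 b : 'M[V]_n, forall k (phi psi : V -> 'M[C]_k), CS phi -> CS psi ->
      opnorm (pairing phi b - pairing psi b) <= D k phi psi &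
    D n phi0 psi0 <= (1 + e) * opnorm (pairing phi0 b - pairing psi0 b).
Proof.
case: n phi0 psi0 => [|n] phi0 psi0 phiS psiS e0.
  have -> : phi0 = psi0 by apply/funext => v; apply/matrixP => -[].
  exists 0 => [k phi psi fS gS|]; last first.
    by rewrite (met_xx (Dmet 0)) // subrr opnorm0 mulr0.
  rewrite (pairing0 0 (CS_lin fS)) (pairing0 0 (CS_lin gS)) subrr opnorm0.
  exact: (met_ge0 (Dmet k)).
have CS1 := CS1_nonempty phiS.
have [b b1 b2] := separation_diffs CS1 (diffs_sub phiS psiS) e0.
exists b => [k phi psi fS gS|].
  by rewrite pairing_fB -L_sub //; apply: b1; exact: diffs_sub.
by rewrite pairing_fB -L_sub.
Qed.

End MatrixNorms.

(** * The Lipschitz gauge of a metric *)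

Section LipschitzGauge.
Variables (R : realType) (V : matrix_order_unit_space R).
Local Notation C := R[i].
Local Notation Re := complex.Re.
Local Notation Im := complex.Im.
Local Notation st := (@star R V).
Local Notation one := (munit V).
Local Notation state := (V -> 'M[C]_1).
Variable D : forall n, (V -> 'M[C]_n) -> (V -> 'M[C]_n) -> R.
Arguments D : clear implicits.
Hypothesis D_met : forall n, metric_on (@CS R V n) (D n).

Definition lip_bound n (a : 'M[V]_n) (t : R) : Prop :=
  forall k (phi psi : V -> 'M[C]_k), CS phi -> CS psi ->
  opnorm (pairing phi a - pairing psi a) <= t * D k phi psi.

(** The Lipschitz constant of the function that [a] induces on matrix states. *)
Definition lip_gauge n (a : 'M[V]_n) : \bar R :=
  ereal_inf [set t%:E | t in [set t : R | 0 <= t /\ lip_bound a t]].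

Lemma lip_gauge_ge0 n (a : 'M[V]_n) : (0 <= lip_gauge a)%E.
Proof. by apply: le_ereal_inf_tmp => _ [t [t0 _] <-]; rewrite lee_fin. Qed.

Lemma lip_gauge_le n (a : 'M[V]_n) (t : R) : 0 <= t -> lip_bound a t ->
  (lip_gauge a <= t%:E)%E.
Proof. by move=> t0 at'; apply: ereal_inf_lbound; exists t. Qed.

Lemma lip_gaugeP n (a : 'M[V]_n) (t : R) :
  (lip_gauge a <= t%:E)%E -> lip_bound a t.
Proof.
move=> at' k phi psi phiS psiS; apply/ler_addgt0Pr => e e0.
have D0 := met_ge0 (D_met k) phiS psiS.
have d0 : 0 < e / (D k phi psi + 1) by rewrite divr_gt0 // ltr_wpDl.
have : (lip_gauge a < (t + e / (D k phi psi + 1))%:E)%E.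
  by apply: le_lt_trans at' _; rewrite lte_fin ltrDl.
move=> /ereal_inf_lt[_ [s [s0 sa] <-]]; rewrite lte_fin => st'.
apply: le_trans (sa _ _ _ phiS psiS) _.
apply: le_trans (ler_wpM2r D0 (ltW st')) _.
rewrite mulrDl lerD2l mulrAC ler_pdivrMr ?ltr_wpDl //.
by rewrite ler_wpM2l ?(ltW e0) // lerDl.
Qed.

Variant lip_gauge_spec n (a : 'M[V]_n) : \bar R -> Prop :=
| LipFinite t of 0 <= t & lip_bound a t : lip_gauge_spec a t%:E
| LipInfinite : lip_gauge_spec a +oo%E.

Lemma lip_gauge_case n (a : 'M[V]_n) : lip_gauge_spec a (lip_gauge a).
Proof.
have := lip_gauge_ge0 a; have := @lip_gaugeP _ a; case: (lip_gauge a) => [t h t0|_ _|_].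
- by apply: LipFinite; [rewrite -lee_fin|exact: h].
- exact: LipInfinite.
- by rewrite leeNy_eq.
Qed.

Lemma lip_boundD n (a b : 'M[V]_n) (s t : R) : lip_bound a s -> lip_bound b t ->
  lip_bound (a + b) (s + t).
Proof.
move=> ha hb k phi psi phiS psiS.
rewrite !pairingD; [|exact: CS_lin|exact: CS_lin].
rewrite opprD addrACA mulrDl; apply: le_trans (opnormD _ _) _.
by apply: lerD; [exact: ha|exact: hb].
Qed.

Lemma lip_boundZ n (a : 'M[V]_n) (c : C) (t : R) : lip_bound a t ->
  lip_bound (mxscalev c a) (Normc.normc c * t).
Proof.
move=> ha k phi psi phiS psiS.
rewrite !pairingZ; [|exact: CS_lin|exact: CS_lin].
rewrite -scalerBr; apply: le_trans (opnormZ _ _) _.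
by rewrite -mulrA ler_wpM2l ?normc_ge0 // ha.
Qed.

Lemma lip_bound_star n (a : 'M[V]_n) (t : R) : lip_bound a t ->
  lip_bound (madj st a) t.
Proof.
move=> ha k phi psi phiS psiS.
rewrite !pairing_madj; [|by move=> v; exact: CS_star|by move=> v; exact: CS_star].
by rewrite -ctrN -ctrD opnorm_adj ha.
Qed.

Lemma lip_bound_scalar n (A : 'M[C]_n) (t : R) : 0 <= t ->
  lip_bound (mtensor one A) t.
Proof.
move=> t0 k phi psi phiS psiS.
have -> : pairing phi (mtensor one A) = pairing psi (mtensor one A).
  apply/matrixP => p q; rewrite !mxE (linZ (CS_lin phiS)) (linZ (CS_lin psiS)).
  by rewrite (CS_unit phiS) (CS_unit psiS).
by rewrite subrr opnorm0 mulr_ge0 // (met_ge0 (D_met k)).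
Qed.

Lemma lip_bound0 n (t : R) : 0 <= t -> lip_bound (0 : 'M[V]_n) t.
Proof.
move=> t0; have -> : (0 : 'M[V]_n) = mtensor one 0.
  by apply/matrixP => i j; rewrite !mxE scale0r.
exact: lip_bound_scalar.
Qed.

Lemma lip_gauge0 n : lip_gauge (0 : 'M[V]_n) = 0%E.
Proof.
apply/le_anti; rewrite lip_gauge_ge0 andbT.
by apply: lip_gauge_le => //; exact: lip_bound0.
Qed.

Lemma mdsum_opnorm_ge r m n (f : V -> 'M[C]_r) (v : 'M[V]_m) (w : 'M[V]_n) :
  linear f -> opnorm (pairing f v) <= opnorm (pairing f (mdsum v w)) /\
              opnorm (pairing f w) <= opnorm (pairing f (mdsum v w)).
Proof.
move=> fl.
have p0 p (a : 'M[V]_p) : papp f a 0 = 0.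
  by apply/matrixP => i j; rewrite !mxE big1 // => q _; rewrite mulmx0 mxE.
split; apply: opnorm_pairing_le => [|X]; try exact: opnorm_ge0.
  have := hnorm_papp f (mdsum v w) (row_mx X 0).
  by rewrite papp_mdsum // p0 /hnorm !sqn_row !sqn0 !addr0.
have := hnorm_papp f (mdsum v w) (row_mx 0 X).
by rewrite papp_mdsum // p0 /hnorm !sqn_row !sqn0 !add0r.
Qed.

Lemma lip_gauge_mdsum m n (v : 'M[V]_m) (w : 'M[V]_n) :
  lip_gauge (mdsum v w) = maxe (lip_gauge v) (lip_gauge w).
Proof.
apply/le_anti/andP; split.
  case: (lip_gauge_case v) => [s s0 vs|]; last by rewrite maxye leey.
  case: (lip_gauge_case w) => [t t0 wt|]; last by rewrite maxey leey.
  rewrite -EFin_max; apply: lip_gauge_le; first by rewrite le_max s0.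
  move=> k phi psi phiS psiS; have fl := linear_fB (CS_lin phiS) (CS_lin psiS).
  have D0 := met_ge0 (D_met k) phiS psiS.
  rewrite pairing_fB; apply: opnorm_pairing_mdsum => //.
  + by rewrite mulr_ge0 // le_max s0.
  + rewrite -pairing_fB; apply: le_trans (vs _ _ _ phiS psiS) _.
    by rewrite ler_wpM2r // le_max lexx.
  + rewrite -pairing_fB; apply: le_trans (wt _ _ _ phiS psiS) _.
    by rewrite ler_wpM2r // le_max lexx orbT.
case: (lip_gauge_case (mdsum v w)) => [t t0 h|]; last by rewrite leey.
have hk k phi psi (phiS : @CS R V k phi) (psiS : CS psi) :=
  mdsum_opnorm_ge v w (linear_fB (CS_lin phiS) (CS_lin psiS)).
rewrite ge_max; apply/andP; split; apply: lip_gauge_le => // k phi psi phiS psiS;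
  rewrite pairing_fB; have [h1 h2] := hk _ _ _ phiS psiS;
  [apply: le_trans h1 _|apply: le_trans h2 _]; rewrite -pairing_fB; exact: h.
Qed.

Lemma mact0l m n p q (v : 'M[V]_(m, n)) (b : 'M[C]_(n, q)) :
  mact (0 : 'M[C]_(p, m)) v b = 0.
Proof.
apply/matrixP => i j; rewrite !mxE big1 // => k _; rewrite big1 // => l _.
by rewrite mxE mul0r scale0r.
Qed.

Lemma mact0r m n p q (v : 'M[V]_(m, n)) (a : 'M[C]_(p, m)) :
  mact a v (0 : 'M[C]_(n, q)) = 0.
Proof.
apply/matrixP => i j; rewrite !mxE big1 // => k _; rewrite big1 // => l _.
by rewrite mxE mulr0 scale0r.
Qed.

Lemma lip_gauge_matrix_gauge : matrix_gauge lip_gauge.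
Proof.
split.
- move=> n; split; first exact: lip_gauge_ge0.
  + move=> v w; case: (lip_gauge_case v) => [s s0 vs|]; last first.
      by rewrite addye ?leey // gt_eqF // (lt_le_trans (ltNyr 0)) ?lip_gauge_ge0.
    case: (lip_gauge_case w) => [t t0 wt|]; last by rewrite addey ?leey.
    rewrite -EFinD; apply: lip_gauge_le; [exact: addr_ge0|exact: lip_boundD].
  + move=> c v; case: (lip_gauge_case v) => [s s0 vs|].
      rewrite -EFinM; apply: lip_gauge_le; last exact: lip_boundZ.
      by rewrite mulr_ge0 // normc_ge0.
    have [c0|cn0] := eqVneq (Normc.normc c) 0.
      rewrite c0 mul0e (Normc.eq0_normc c0).
      have -> : mxscalev 0 v = 0 by apply/matrixP => i j; rewrite !mxE scale0r.
      by rewrite lip_gauge0.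
    by rewrite gt0_muley ?leey // lte_fin lt_def cn0 normc_ge0.
- move=> m n v w; exact: lip_gauge_mdsum.
- move=> m n v a b; case: (lip_gauge_case v) => [s s0 vs|].
    rewrite -!EFinM; apply: lip_gauge_le; first by rewrite !mulr_ge0 ?opnorm_ge0.
    move=> k phi psi phiS psiS; have fl := linear_fB (CS_lin phiS) (CS_lin psiS).
    rewrite pairing_fB; apply: le_trans (opnorm_pairing_mact _ _ _ fl) _.
    have -> : opnorm a * s * opnorm b * D k phi psi =
      opnorm a * (s * D k phi psi) * opnorm b by ring.
    rewrite -pairing_fB; apply: ler_wpM2r; first exact: opnorm_ge0.
    by apply: ler_wpM2l; [exact: opnorm_ge0|exact: vs].
  have [a0|an0] := eqVneq (opnorm a) 0.
    by rewrite a0 mul0e mul0e (opnorm_eq0 a0) mact0l lip_gauge0.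
  rewrite gt0_muley; last by rewrite lte_fin lt_def an0 opnorm_ge0.
  have [b0|bn0] := eqVneq (opnorm b) 0.
    by rewrite b0 mule0 (opnorm_eq0 b0) mact0r lip_gauge0.
  by rewrite gt0_mulye ?leey // lte_fin lt_def bn0 opnorm_ge0.
Qed.

Lemma lip_gauge_star n (v : 'M[V]_n) : lip_gauge (madj st v) = lip_gauge v.
Proof.
have le (w : 'M[V]_n) : (lip_gauge (madj st w) <= lip_gauge w)%E.
  case: (lip_gauge_case w) => [t t0 wt|]; last by rewrite leey.
  by apply: (lip_gauge_le t0); apply: lip_bound_star; exact: wt.
have vv : madj st (madj st v) = v by apply/matrixP => i j; rewrite !mxE starK.
have h := le (madj st v); rewrite vv in h.
by apply: le_anti; apply/andP; split; [exact: le v|exact: h].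
Qed.

Lemma pairing_state_entry n (phi : state) (v : 'M[V]_n) i j :
  pairing phi v (mxtens.mxtens_index (i, ord0)) (mxtens.mxtens_index (j, ord0)) =
  phi (v i j) ord0 ord0.
Proof. by rewrite mxE !mxtens.mxtens_indexK. Qed.

(** If the constant of [v] is 0, then the entries of [v] take the same value at
    all states, and states separate the points of V. *)
Lemma lip_gauge_eq0 n (v : 'M[V]_n) :
  lip_gauge v = 0%E <-> exists A : 'M[C]_n, v = mtensor one A.
Proof.
split=> [v0|[A ->]]; last first.
  apply/le_anti; rewrite lip_gauge_ge0 andbT.
  by apply: lip_gauge_le => //; exact: lip_bound_scalar.
have h : lip_bound v 0 by apply: lip_gaugeP; rewrite v0.
have [[phi0 phi0S]|noS] := pselect (exists phi : state, CS phi); last first.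
  exists 0; apply/matrixP => i j; rewrite !mxE scale0r; apply: states_separate.
  by move=> phi phiS; case: noS; exists phi.
exists (\matrix_(i, j) phi0 (v i j) ord0 ord0); apply/matrixP => i j; rewrite !mxE.
apply/eqP; rewrite -subr_eq0; apply/eqP; apply: states_separate => phi phiS.
have /eqP := h _ _ _ phiS phi0S; rewrite mul0r => /eqP h0.
have /opnorm_eq0/matrixP h1 : opnorm (pairing phi v - pairing phi0 v) = 0.
  by apply/le_anti; rewrite opnorm_ge0 andbT.
have := h1 (mxtens.mxtens_index (i, ord0)) (mxtens.mxtens_index (j, ord0)).
rewrite mxE [X in _ + X]mxE !pairing_state_entry mxE => h2.
rewrite (linB (CS_lin phiS)) (linZ (CS_lin phiS)) (CS_unit phiS) !mxE eqxx mulr1.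
exact: h2.
Qed.

(** A Lipschitz bound is a family of inequalities that are continuous for the
    norm, as matrix states are contractive. *)
Lemma lip_gauge_lsc : lsc_gauge lip_gauge.
Proof.
move=> n t t0 a ha; apply: lip_gauge_le; first exact: ltW.
move=> k phi psi phiS psiS; apply/ler_addgt0Pr => e e0.
have [b /lip_gaugeP bt bae] := ha _ (divr_gt0 e0 (ltr0n _ 2)).
have bnd chi : @CS R V k chi -> opnorm (pairing chi (b - a)) <= e / 2.
  move=> [cl ccp _ c1]; apply: le_trans (opnorm_pairing_mnorm _ cl ccp c1) _.
  exact: ltW.
have -> : pairing phi a - pairing psi a =
    (pairing phi b - pairing psi b) + (pairing psi (b - a) + pairing phi (a - b)).
  rewrite !pairingD; try exact: CS_lin.
  have pN chi c : @CS R V k chi -> pairing chi (- c : 'M[V]_n) = - pairing chi c.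
    by move=> cS; apply/matrixP => p q; rewrite !mxE (linN (CS_lin cS)) mxE.
  rewrite !pN //; apply/matrixP => p q; rewrite !mxE; ring.
apply: le_trans (opnormD _ _) _; apply: lerD; first exact: bt.
have o1 : opnorm (pairing phi (a - b)) <= e / 2.
  have -> : pairing phi (a - b) = - pairing phi (b - a).
    by apply/matrixP => p q; rewrite !mxE -opprB (linN (CS_lin phiS)) mxE.
  by rewrite opnormN; exact: bnd.
apply: le_trans (opnormD _ _) _; rewrite [leRHS]splitr.
by apply: lerD; [exact: bnd psiS|exact: o1].
Qed.

Lemma le_DG n (phi psi : V -> 'M[C]_n) (c : R) r (a : 'M[V]_r) :
  lip_bound a 1 -> c <= opnorm (pairing phi a - pairing psi a) ->
  (c%:E <= DG lip_gauge phi psi)%E.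
Proof.
move=> a1 ca; apply: (@le_trans _ _ (opnorm (pairing phi a - pairing psi a))%:E).
  by rewrite lee_fin.
by apply: ereal_sup_ubound; exists r, a; split=> //; apply: lip_gauge_le => //; exact: ler01.
Qed.

Lemma DG_le n (phi psi : V -> 'M[C]_n) : CS phi -> CS psi ->
  (DG lip_gauge phi psi <= (D n phi psi)%:E)%E.
Proof.
move=> phiS psiS; apply: ge_ereal_sup => _ [r [a [a1 ->]]]; rewrite lee_fin.
by have := lip_gaugeP a1 phiS psiS; rewrite mul1r.
Qed.

Hypothesis D_sep : forall n (phi0 psi0 : V -> 'M[C]_n) (e : R),
  CS phi0 -> CS psi0 -> 0 < e ->
  exists2 b : 'M[V]_n, lip_bound b 1 &
    D n phi0 psi0 <= (1 + e) * opnorm (pairing phi0 b - pairing psi0 b).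

(** The gauge gives at most D by construction, and at least D because the
    elements supplied by [D_sep] nearly attain it. *)
Lemma DG_eq n (phi psi : V -> 'M[C]_n) : CS phi -> CS psi ->
  (D n phi psi)%:E = DG lip_gauge phi psi.
Proof.
move=> phiS psiS; have h1 := DG_le phiS psiS; apply/le_anti/andP; split=> //.
have h0 : (0%:E <= DG lip_gauge phi psi)%E.
  by apply: (@le_DG n phi psi 0 0 0); [exact: lip_bound0|exact: opnorm_ge0].
have hb b : lip_bound b 1 -> ((opnorm (pairing phi b - pairing psi b))%:E <=
    DG lip_gauge phi psi)%E.
  by move=> b1; apply: (le_DG b1).
move: (DG lip_gauge phi psi) h0 h1 hb => [x| |] // x0 _ hb.
rewrite lee_fin in x0; rewrite lee_fin; apply/ler_addgt0Pr => e e0.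
have x1 : 0 < x + 1 by rewrite ltr_wpDl.
have [b b1 hD] := D_sep phiS psiS (divr_gt0 e0 x1).
have := hb _ _ b1; rewrite lee_fin => bx; apply: le_trans hD _.
apply: (@le_trans _ _ ((1 + e / (x + 1)) * x)).
  by apply: ler_wpM2l => //; rewrite addr_ge0 // divr_ge0 // ltW.
rewrite mulrDl mul1r lerD2l mulrAC ler_pdivrMr //.
by rewrite ler_wpM2l ?(ltW e0) // lerDl.
Qed.

(** Density of the elements with finite gauge is an instance of [affine_approx],
    which asks for a real space of self-adjoint elements. *)
Definition lip_sa (w : V) : Prop :=
  st w = w /\ exists2 t : R, 0 <= t & lip_bound (M1 w) t.

Lemma lip_saD v w : lip_sa v -> lip_sa w -> lip_sa (v + w).
Proof.
move=> [vs [s s0 vt]] [ws [t t0 wt]]; split; first by rewrite starD vs ws.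
by exists (s + t); [exact: addr_ge0|rewrite M1D; exact: lip_boundD].
Qed.

Lemma lip_saZ (t : R) v : lip_sa v -> lip_sa (t%:C%C *: v).
Proof.
move=> [vs [s s0 vt]]; split; first by rewrite starZr vs.
exists (Normc.normc (t%:C%C : C) * s); first by rewrite mulr_ge0 // normc_ge0.
by rewrite -mxscalev_M1; exact: lip_boundZ.
Qed.

Lemma lip_sa_unit (t : R) : lip_sa (t%:C%C *: one).
Proof.
split; first by rewrite starZr star_unit.
exists 0 => //; have -> : M1 (t%:C%C *: one) = mtensor one (const_mx t%:C%C).
  by apply/matrixP => i j; rewrite !mxE.
exact: lip_bound_scalar.
Qed.

Lemma lip_sa_reV w (t : R) : 0 <= t -> lip_bound (M1 w) t ->
  lip_sa (reV w) /\ lip_sa (imV w).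
Proof.
move=> t0 wt; have ws : lip_bound (M1 (st w)) t.
  have -> : M1 (st w) = madj st (M1 w) by apply/matrixP => i j; rewrite !mxE.
  exact: lip_bound_star.
have scl c v s : 0 <= s -> lip_bound (M1 v) s ->
    exists2 r : R, 0 <= r & lip_bound (M1 (c *: v)) r.
  move=> s0 vs; exists (Normc.normc c * s); first by rewrite mulr_ge0 // normc_ge0.
  by rewrite -mxscalev_M1; exact: lip_boundZ.
split; split; rewrite ?reV_sa ?imV_sa //.
  apply: (scl _ _ (t + t)); first exact: addr_ge0.
  by rewrite M1D; exact: lip_boundD.
have [r r0 hr] := scl (-1) w t t0 wt.
have [r' r'0 hr'] : exists2 r' : R, 0 <= r' & lip_bound (M1 ('i%C *: (st w - w))) r'.
  apply: (scl _ _ (t + r)); first exact: addr_ge0.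
  by rewrite M1D; apply: (lip_boundD ws); rewrite -scaleN1r; exact: hr.
exact: scl hr'.
Qed.

(** D separates distinct states, so by [D_sep] some element of gauge at most 1
    does. *)
Lemma lip_sa_separates (phi psi : state) : CS phi -> CS psi ->
  (forall v, lip_sa v -> sev phi v = sev psi v) -> phi = psi.
Proof.
move=> phiS psiS h; have [b b1 hD] := D_sep phiS psiS ltr01.
have bE : b = M1 (b ord0 ord0) by apply/matrixP => i j; rewrite mxE !ord1.
have [r i] : lip_sa (reV (b ord0 ord0)) /\ lip_sa (imV (b ord0 ord0)).
  by apply: (lip_sa_reV ler01); rewrite -bE; exact: b1.
have e : pairing phi b = pairing psi b.
  apply/matrixP => p q; rewrite !mxE !ord1.
  by rewrite (sev_reim phiS) (sev_reim psiS) (h _ r) (h _ i).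
rewrite e subrr opnorm0 mulr0 in hD.
have [Dge0 Deq _ _] := D_met 1; apply/(Deq _ _ phiS psiS)/le_anti.
by rewrite hD Dge0.
Qed.

Lemma lip_sa_approx (x : V) (e : R) : st x = x -> 0 < e ->
  exists2 w, lip_sa w & forall phi : state, CS phi -> `|sev phi (w - x)| <= e.
Proof.
move=> xs e0.
have [[phi0 phi0S]|noS] := pselect (exists phi : state, CS phi); last first.
  exists (0%:C%C *: one); first exact: lip_sa_unit.
  by move=> phi phiS; case: noS; exists phi.
have cont : state_continuous (fun phi => sev phi x).
  move=> phi phiS d d0; exists [:: x], d; split=> // psi psiS; apply.
  by rewrite inE eqxx.
have E0 : lip_sa 0 by have := lip_sa_unit 0; rewrite scale0r.
have [w wE hw] := affine_approx lip_sa_separates E0 lip_saD lip_saZ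
  (sev_affine x) cont e0.
exists (w + (sev phi0 x - sev phi0 w)%:C%C *: one).
  exact: lip_saD wE (lip_sa_unit _).
move=> phi phiS; rewrite sevB // sevD // sevZ // sev1 // mulr1.
have := hw _ _ phi0S phiS; congr (is_true (`|_| <= _)); ring.
Qed.

Lemma lip_gauge_dense : mnorm_dense [set v : V | (lip_gauge (M1 v) < +oo)%E].
Proof.
move=> v e e0; have d0 : 0 < e / 4 by rewrite divr_gt0.
have [w1 [w1s [t1 t10 w1t]] h1] := lip_sa_approx (reV_sa v) d0.
have [w2 [w2s [t2 t20 w2t]] h2] := lip_sa_approx (imV_sa v) d0.
exists (w1 + 'i%C *: w2).
  rewrite /= M1D -mxscalev_M1.
  apply: (@le_lt_trans _ _ (t1 + Normc.normc ('i%C : C) * t2)%:E); last exact: ltry.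
  apply: lip_gauge_le; first by rewrite addr_ge0 // mulr_ge0 // normc_ge0.
  by apply: (lip_boundD w1t); apply: lip_boundZ; exact: w2t.
have -> : w1 + 'i%C *: w2 - v = (w1 - reV v) + 'i%C *: (w2 - imV v).
  by rewrite {1}(reimV v) scalerBr opprD addrACA.
have s1 : st (w1 - reV v) = w1 - reV v by rewrite starB w1s reV_sa.
have s2 : st (w2 - imV v) = w2 - imV v by rewrite starB w2s imV_sa.
have [a1 a2] := mpos_state_bound s1 h1; have [b1 b2] := mpos_state_bound s2 h2.
by apply: le_lt_trans (mnorm_re_im (ltW d0) a1 a2 b1 b2) _; lra.
Qed.

Lemma lip_gauge_Lipschitz : matrix_Lipschitz_gauge lip_gauge.
Proof.
split.
- exact: lip_gauge_matrix_gauge.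
- exact: lip_gauge_eq0.
- exact: lip_gauge_star.
- exact: lip_gauge_dense.
Qed.

End LipschitzGauge.

(** * Necessity of the three conditions *)

Section Necessity.
Variables (R : realType) (V : matrix_order_unit_space R).
Local Notation C := R[i].
Variable D : forall n, (V -> 'M[C]_n) -> (V -> 'M[C]_n) -> R.
Arguments D : clear implicits.
Variable G : forall n, 'M[V]_n -> \bar R.
Hypothesis DG_D : forall (n : nat) (phi psi : V -> 'M[C]_n),
  CS phi -> CS psi -> (D n phi psi)%:E = DG G phi psi.

(** The gauge distance is the supremum of the seminorms
    [f |-> opnorm (pairing f a)] at [f = phi - psi]: it bounds each of them, and
    it is the least bound. The three conditions hold for each seminorm. *)
Lemma DG_bound n (phi psi : V -> 'M[C]_n) r (a : 'M[V]_r) : CS phi -> CS psi ->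
  (G a <= 1)%E -> opnorm (pairing (phi - psi) a) <= D n phi psi.
Proof.
move=> phiS psiS a1; rewrite -lee_fin DG_D // -pairing_fB.
by apply: ereal_sup_ubound; exists r, a.
Qed.

Lemma DG_least n (phi psi : V -> 'M[C]_n) (c : R) : CS phi -> CS psi ->
  (forall r (a : 'M[V]_r), (G a <= 1)%E -> opnorm (pairing (phi - psi) a) <= c) ->
  D n phi psi <= c.
Proof.
move=> phiS psiS h; rewrite -lee_fin DG_D //.
apply: ge_ereal_sup => _ [r [a [a1 ->]]]; rewrite lee_fin pairing_fB; exact: h.
Qed.

Lemma DG_convex n : convex_metric (@CS R V n) (D n).
Proof.
move=> x y z t xS yS zS t01; have wS := CS_conv t01 yS zS.
have /andP[t0 t1] := t01; have s0 : 0 <= 1 - t by rewrite subr_ge0.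
apply: (DG_least xS wS) => r a a1.
have -> : x - (t%:C%C *: y + (1 - t)%:C%C *: z) =
    t%:C%C *: (x - y) + (1 - t)%:C%C *: (x - z).
  rewrite !scalerBr addrACA -opprD -scalerDl -rmorphD (addrC t) subrK.
  by rewrite scale1r.
rewrite pairing_fD !pairing_fZ; apply: le_trans (opnormD _ _) _.
apply: lerD; (apply: le_trans (opnormZr _ _) _; first by []);
  by apply: ler_wpM2l => //; exact: DG_bound.
Qed.

Lemma DG_balanced n : midpoint_balanced (@CS R V n) (D n).
Proof.
move=> x y u v xS yS uS vS e.
have E : x - u = y - v.
  have h2 : (2^-1 : C) != 0 by rewrite invr_neq0 // pnatr_eq0.
  move: e => /(scalerI h2) e; apply/eqP; rewrite subr_eq addrAC eq_sym subr_eq.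
  by rewrite e.
apply/le_anti/andP; split.
  by apply: (DG_least xS uS) => r a a1; rewrite E; exact: DG_bound.
by apply: (DG_least yS vS) => r a a1; rewrite -E; exact: DG_bound.
Qed.

Lemma CS_midpoint n (x y : V -> 'M[C]_n) : CS x -> CS y ->
  CS ((2^-1 : C) *: (x + y)).
Proof. by apply: midpoint_mem => f g t; exact: CS_conv. Qed.

Lemma DG_concave n : midpoint_concave (@CS R V n) (D n).
Proof.
move=> x y u v xS yS uS vS.
apply: (DG_least (CS_midpoint xS uS) (CS_midpoint yS vS)) => r a a1.
have -> : (2^-1 : C) *: (x + u) - (2^-1 : C) *: (y + v) =
    (2^-1 : R)%:C%C *: ((x - y) + (u - v)).
  by rewrite -scalerBr opprD addrACA fmorphV rmorphMn.
rewrite pairing_fZ pairing_fD.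
have h0 : 0 <= (2^-1 : R) by rewrite invr_ge0.
apply: le_trans (opnormZr _ h0) _; apply: ler_wpM2l => //.
by apply: le_trans (opnormD _ _) _; apply: lerD; exact: DG_bound.
Qed.

End Necessity.

Theorem theorem6p12 (R : realType) (V : matrix_order_unit_space R)
    (D : forall n : nat, (V -> 'M[R[i]]_n) -> (V -> 'M[R[i]]_n) -> R)
    (V_complete : complete_mou V)
    (D_metric : matrix_metric D)
    (D_BW : topology_is_BW (fun n phi psi => (D n phi psi)%:E)) :
  (exists G : forall n : nat, 'M[V]_n -> \bar R,
     [/\ matrix_Lip_gauge G, lsc_gauge G &
         forall (n : nat) (phi psi : V -> 'M[R[i]]_n),
           CS phi -> CS psi -> (D n phi psi)%:E = DG G phi psi])
  <->
  [/\ forall n : nat, convex_metric (@CS R V n) (D n),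
      forall n : nat, midpoint_balanced (@CS R V n) (D n) &
      forall n : nat, midpoint_concave (@CS R V n) (D n)].
Proof.
split=> [[G [_ _ DG_D]]|[D_conv D_bal D_conc]].
  split=> n; [exact: (DG_convex DG_D)|exact: (DG_balanced DG_D)|].
  exact: (DG_concave DG_D).
have [D_met _ _] := D_metric.
have D_sep n (phi psi : V -> 'M[R[i]]_n) (e : R) : CS phi -> CS psi -> 0 < e ->
    exists2 b : 'M[V]_n, lip_bound D b 1 &
      D n phi psi <= (1 + e) * opnorm (pairing phi b - pairing psi b).
  move=> phiS psiS e0.
  have [b b1 b2] := separation V_complete D_metric D_BW D_conv D_bal D_conc phiS psiS e0.
  by exists b => // k f g fS gS; rewrite mul1r; exact: b1.
have DE n (phi psi : V -> 'M[R[i]]_n) (phiS : CS phi) (psiS : CS psi) :=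
  DG_eq D_met D_sep phiS psiS.
exists (lip_gauge D); split; [split|exact: lip_gauge_lsc|exact: DE].
  exact: lip_gauge_Lipschitz.
move=> n U; rewrite -(D_BW n U); split=> -[UK Uo]; split=> // x Ux;
  have [e e0 he] := Uo _ Ux; exists e => // y yS.
  by rewrite (DE n x y (UK _ Ux) yS); exact: he.
by rewrite -(DE n x y (UK _ Ux) yS); exact: he.
Qed.
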